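(* Let $n>k\ge1$ be coprime integers, $\eta$ in the upper half-plane, $\Lambda=\mathbb{Z}+\mathbb{Z}\eta$. If $\tau\in\mathbb{C}\setminus\frac1{2n}\Lambda$, then: (1) $R_\tau(z)$ is an isomorphism if and only if $z\notin\pm\tau+\frac1n\Lambda$; (2) for all $\zeta\in\frac1n\Lambda$, $\operatorname{im}R_\tau(\tau+\zeta)=\ker R_\tau(-\tau-\zeta)$ and $\operatorname{im}R_\tau(-\tau-\zeta)=\ker R_\tau(\tau+\zeta)$; (3) for every $p\in\mathbb{C}$, the multiplicity of $p$ as a zero of the holomorphic function $z\mapsto\det R_\tau(z)$ equals the nullity of $R_\tau(p)$, and this number is $\binom{n+1}{2}$ if $p\in\tau+\frac1n\Lambda$, $\binom n2$ if $p\in-\tau+\frac1n\Lambda$, and $0$ otherwise. If instead $\tau\in\frac1{2n}\Lambda\setminus\frac1n\Lambda$, then $\dim\ker R_\tau(\tau)=\dim\ker R_\tau(-\tau)\ge\binom{n+1}{2}$.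
   Context: Write $e(z)=e^{2\pi i z}$ and $\theta(z)=\sum_{m\in\mathbb{Z}}(-1)^m e\big(mz+\tfrac12 m(m-1)\eta\big)$. For $\alpha\in\mathbb{Z}$ put $\theta_\alpha(z)=e\big(\alpha z+\tfrac{\alpha}{2n}+\tfrac{\alpha(\alpha-n)}{2n}\eta\big)\prod_{m=0}^{n-1}\theta\big(z+\tfrac mn+\tfrac{\alpha}{n}\eta\big)$, regarded as indexed by $\alpha\in\mathbb{Z}_n$. Let $V$ be an $n$-dimensional complex vector space with basis $x_i$, $i\in\mathbb{Z}_n$. For $\tau\in\mathbb{C}\setminus\frac1n\Lambda$ and $z\in\mathbb{C}$, define $R_\tau(z)\in\mathrm{End}(V\otimes V)$ by $$R_\tau(z)(x_i\otimes x_j)=\frac{\theta_0(-z)\cdots\theta_{n-1}(-z)}{\theta_1(0)\cdots\theta_{n-1}(0)}\sum_{r\in\mathbb{Z}_n}\frac{\theta_{j-i+r(k-1)}(-z+\tau)}{\theta_{j-i-r}(-z)\,\theta_{kr}(\tau)}\,x_{j-r}\otimes x_{i+r}.$$ *)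

(* Defs.v *)
From HB Require Import structures.
From mathcomp Require Import all_boot all_order all_algebra.
From mathcomp Require Import all_classical all_reals all_analysis.
From mathcomp Require Import complex.

Set Implicit Arguments.
Unset Strict Implicit.
Unset Printing Implicit Defensive.

Import Order.TTheory GRing.Theory Num.Theory.
Import numFieldNormedType.Exports.
Local Open Scope classical_set_scope.
Local Open Scope ring_scope.
Local Open Scope complex_scope.

(* Equip the complex numbers R[i] with their canonical normed/topological
   structure (the one MathComp-Analysis gives any numClosedFieldType). *)
HB.instance Definition _ (R : rcfType) := NormedModule.copy R[i] (R[i])^o.

Section Theta.
Variable R : realType.
Local Notation C := R[i].

(* e(z) = exp(2 pi i z), written out: for z = a + i b,
   e(z) = exp(-2 pi b) (cos(2 pi a) + i sin(2 pi a)). *)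
Definition ee (z : C) : C :=
  (expR (- (2 * pi * complex.Im z)))%:C *
  ((cos (2 * pi * complex.Re z))%:C + 'i * (sin (2 * pi * complex.Re z))%:C).

Definition theta_term (eta z : C) (m : int) : C :=
  (-1) ^+ `|m|%N * ee (m%:~R * z + ((m * (m - 1))%:~R / 2%:R) * eta).

Definition theta_partial (eta z : C) (N : nat) : C :=
  \sum_(k < (2 * N).+1) theta_term eta z (k%:Z - N%:Z).

(* theta(z) = sum_{m in Z} (-1)^m e(m z + m(m-1)/2 eta)  (limit of the
   symmetric partial sums; the series converges absolutely for Im eta > 0) *)
Definition theta (eta z : C) : C := lim (theta_partial eta z @ \oo).

Definition theta_a (n : nat) (eta : C) (alpha : int) (z : C) : C :=
  ee (alpha%:~R * z + alpha%:~R / (2 * n)%:R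
      + (alpha * (alpha - n%:Z))%:~R / (2 * n)%:R * eta)
  * \prod_(m < n) theta eta (z + m%:R / n%:R + alpha%:~R / n%:R * eta).

Definition theta_n (n : nat) (eta : C) (alpha : int) (z : C) : C :=
  theta_a n eta (alpha %% n%:Z)%Z z.

Definition in_lat (m : nat) (eta w : C) : Prop :=
  exists a b : int, w = (a%:~R + b%:~R * eta) / m%:R.

(* Basis of V (x) V: the index q : 'I_(n*n) encodes x_(q / n) (x) x_(q mod n). *)
Definition fst_idx (n : nat) (q : 'I_(n * n)) : int := (q %/ n)%N%:Z.
Definition snd_idx (n : nat) (q : 'I_(n * n)) : int := (q %% n)%N%:Z.

(* Coefficient of x_(j-r) (x) x_(i+r) in R_tau(z)(x_i (x) x_j), with the
   removable singularity cancelled: the factor theta_(j-i-r)(-z) in the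
   prefactor is cancelled against the denominator. *)
Definition Rcoef (n k : nat) (eta tau z : C) (i j r : int) : C :=
  (\prod_(a < n | (a%:Z != ((j - i - r) %% n%:Z)%Z)) theta_n n eta a%:Z (- z))
  / (\prod_(a < n | (0 < a)%N) theta_n n eta a%:Z 0)
  * (theta_n n eta (j - i + r * (k%:Z - 1)) (- z + tau)
     / theta_n n eta (k%:Z * r) tau).

(* The matrix of R_tau(z) in the basis x_i (x) x_j, in MathComp's row-vector
   convention: row q is the image of the q-th basis vector, i.e.
   R_tau(z) acts as v |-> v *m Rmx. *)
Definition Rmx (n k : nat) (eta tau z : C) : 'M[C]_(n * n) :=
  \matrix_(q, l)
    \sum_(r < n)
      (if ((fst_idx l - (snd_idx q - r%:Z)) %% n%:Z == 0)%Z
          && ((snd_idx l - (fst_idx q + r%:Z)) %% n%:Z == 0)%Z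
       then Rcoef n k eta tau z (fst_idx q) (snd_idx q) r%:Z
       else 0).

Definition nullity (m : nat) (M : 'M[C]_m) : nat := (m - \rank M)%N.

Definition zero_mult (f : C -> C) (p : C) (m : nat) : Prop :=
  exists2 L : C, L != 0 & (fun z => f z / (z - p) ^+ m) @ p^' --> L.

End Theta.

(* Main.v *)
Require Import Defs.
From HB Require Import structures.
From mathcomp Require Import all_boot all_order all_algebra.
From mathcomp Require Import all_classical all_reals all_analysis.
From mathcomp Require Import complex.
From mathcomp Require Import zify ring lra.

Set Implicit Arguments.
Unset Strict Implicit.
Unset Printing Implicit Defensive.

Import Order.TTheory GRing.Theory Num.Theory.
Import numFieldNormedType.Exports.
Local Open Scope classical_set_scope.
Local Open Scope ring_scope.
Local Open Scope complex_scope.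

(** Up to Gaussian factors the theta function is an odd entire function [sg] that satisfies
    Weierstrass' three-term identity, and the entries of R are values of Kronecker's function
    s(x+y)/(s(x)s(y)).  Fay's identity for this function makes the off-diagonal part of
    R(z)R(-z) telescope, so R(z)R(-z) is a scalar matrix, and its scalar has simple zeros,
    exactly on +-tau + Lambda/n.

    At such a point p the function det R(z) det R(-z) vanishes to the order n^2, and the two
    nullities add up to at least n^2 because R(p)R(-p) = 0.  Each determinant vanishes at least
    to the order given by the nullity, so all these inequalities are equalities: multiplicity
    equals nullity, and the ranks at p and -p are complementary.

    A translation of z by Lambda/n multiplies R by invertible monomial matrices, which leaves the
    points +-tau.  The ranks at tau and at -tau are lower semicontinuous in tau and have a
    constant sum off Lambda/2n, so they are locally constant there, hence constant along
    horizontal and vertical lines (in the basis 1, eta) that avoid Lambda/2n.  As tau tends to 0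
    the matrices at +-tau tend to 1 -+ flip, whose ranks are the two binomials.  On
    Lambda/2n - Lambda/n semicontinuity gives the inequality. *)

(** * Limits of complex functions *)

(** Neither Liouville's theorem nor residues are used: where elliptic functions are classically
    identified by comparing poles, an explicit identity, valid up to a non-zero constant, takes
    their place. Constants such as [c], [ka] and [L] are shown not to vanish and nothing more, since
    zeros and ranks do not see them. The finite triple product is the source of the zeros of theta,
    of the simplicity of the zero at 1 and of the relations between different moduli; the three-term
    identity comes from splitting a double series by parity.

    Two sigma functions occur: the entries of R are built from modulus [n%:R * eta], while the
    scalar of R(z)R(-z) has modulus [eta]. The product formulas connect the two.

    The limit at the origin is delicate because the coefficient with r = 0 has the denominator
    theta_0(tau), which tends to 0 with tau. On the line z = c tau another factor vanishes at the
    same rate, and c = 1, -1 are the two exceptional points. *)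

Section Tends.
Variable K : numFieldType.

(** The epsilon form of [f @ F --> a] (see [tendsP]); over a [numFieldType] one calculus serves real
    and complex limits alike. *)
Definition tends (T : Type) (F : set_system T) (f : T -> K) (a : K) :=
  forall e : K, 0 < e -> F [set t | `|a - f t| < e].

Variables (T : Type) (F : set_system T).
Context {FF : Filter F}.

Lemma tendsP (f : T -> K) (a : K) : tends F f a <-> f @ F --> a.
Proof.
split=> h; first by apply/cvgrPdist_lt; exact: h.
by move/cvgrPdist_lt: h => h; exact: h.
Qed.

Lemma tends_near (f g : T -> K) (a : K) :
  F [set t | f t = g t] -> tends F f a -> tends F g a.
Proof.
move=> fg fa e e0; apply: filterS (filterI fg (fa e e0)) => t [/= E].
by rewrite E.
Qed.

Lemma tends_ext (f g : T -> K) (a : K) :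
  (forall t, f t = g t) -> tends F f a -> tends F g a.
Proof. by move=> fg; apply: tends_near; apply: filterE. Qed.

Lemma tends_cst (a : K) : tends F (fun=> a) a.
Proof. by apply/tendsP; exact: cvg_cst. Qed.

Lemma tendsD (f g : T -> K) (a b : K) :
  tends F f a -> tends F g b -> tends F (fun t => f t + g t) (a + b).
Proof. by move=> /tendsP h1 /tendsP h2; apply/tendsP; exact: cvgD. Qed.

Lemma tendsM (f g : T -> K) (a b : K) :
  tends F f a -> tends F g b -> tends F (fun t => f t * g t) (a * b).
Proof. by move=> /tendsP h1 /tendsP h2; apply/tendsP; exact: cvgM. Qed.

Lemma tendsN (f : T -> K) (a : K) : tends F f a -> tends F (fun t => - f t) (- a).
Proof. by move=> /tendsP h1; apply/tendsP; exact: cvgN. Qed.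

Lemma tendsB (f g : T -> K) (a b : K) :
  tends F f a -> tends F g b -> tends F (fun t => f t - g t) (a - b).
Proof. by move=> fa gb; apply: tendsD fa (tendsN gb). Qed.

Lemma tendsMl (c : K) (f : T -> K) (a : K) :
  tends F f a -> tends F (fun t => c * f t) (c * a).
Proof. by move=> fa; apply: tendsM fa; apply: tends_cst. Qed.

Lemma tendsV (f : T -> K) (a : K) :
  a != 0 -> tends F f a -> tends F (fun t => (f t)^-1) a^-1.
Proof. by move=> a0 /tendsP h1; apply/tendsP; exact: cvgV. Qed.

Lemma tends_sum (I : Type) (r : seq I) (P : pred I) (f : I -> T -> K) (a : I -> K) :
  (forall i, P i -> tends F (f i) (a i)) ->
  tends F (fun t => \sum_(i <- r | P i) f i t) (\sum_(i <- r | P i) a i).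
Proof.
move=> h; elim: r => [|i r IH].
  by under [X in tends _ X]eq_fun do rewrite big_nil; rewrite big_nil; exact: tends_cst.
under [X in tends _ X]eq_fun do rewrite big_cons; rewrite big_cons.
by case: ifP => // Pi; apply: tendsD IH; exact: h.
Qed.

Lemma tends_prod (I : Type) (r : seq I) (P : pred I) (f : I -> T -> K) (a : I -> K) :
  (forall i, P i -> tends F (f i) (a i)) ->
  tends F (fun t => \prod_(i <- r | P i) f i t) (\prod_(i <- r | P i) a i).
Proof.
move=> h; elim: r => [|i r IH].
  by under [X in tends _ X]eq_fun do rewrite big_nil; rewrite big_nil; exact: tends_cst.
under [X in tends _ X]eq_fun do rewrite big_cons; rewrite big_cons.
by case: ifP => // Pi; apply: tendsM IH; exact: h.
Qed.

Lemma tendsX (n : nat) (f : T -> K) (a : K) :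
  tends F f a -> tends F (fun t => f t ^+ n) (a ^+ n).
Proof.
move=> fa; elim: n => [|n IH]; first by apply: tends_ext (tends_cst 1) => t.
by rewrite exprS; apply: tends_ext (tendsM fa IH) => t; rewrite exprS.
Qed.

Lemma tends_neq0 (f : T -> K) (a : K) :
  a != 0 -> tends F f a -> F [set t | f t != 0].
Proof.
move=> a0 fa; have := fa `|a|; rewrite normr_gt0 => /(_ a0).
by apply: filterS => t /=; apply: contraTneq => ->; rewrite subr0 ltxx.
Qed.

Lemma tends_det (n : nat) (M : T -> 'M[K]_n) (M0 : 'M[K]_n) :
  (forall i j, tends F (fun t => M t i j) (M0 i j)) ->
  tends F (fun t => \det (M t)) (\det M0).
Proof.
move=> h; rewrite /determinant; apply: tends_sum => s _.
by apply: tendsM (tends_cst _) _; apply: tends_prod => i _.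
Qed.

Lemma tends_mulmx (m n p : nat) (M : T -> 'M[K]_(m, n)) (N : T -> 'M[K]_(n, p))
  (M0 : 'M[K]_(m, n)) (N0 : 'M[K]_(n, p)) :
  (forall i j, tends F (fun t => M t i j) (M0 i j)) ->
  (forall i j, tends F (fun t => N t i j) (N0 i j)) ->
  forall i j, tends F (fun t => (M t *m N t) i j) ((M0 *m N0) i j).
Proof.
move=> hM hN i j; rewrite mxE.
apply: tends_ext (_ : tends F (fun t => \sum_k M t i k * N t k j) _).
  by move=> t; rewrite mxE.
by apply: tends_sum => k _; exact: tendsM.
Qed.

End Tends.

Arguments tends_cst {K T F FF} a e.
Arguments tendsMl {K T F FF} c [f a].

Section TendsComp.
Variable K : numFieldType.
Lemma tends_comp (T U : Type) (F : set_system T) (G : set_system U)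
  (f : U -> K) (g : T -> U) (a : K) :
  g @ F `=>` G -> tends G f a -> tends F (f \o g) a.
Proof. by move=> gFG fa e e0; exact: (gFG _ (fa e e0)). Qed.

Lemma tends_unique (T : Type) (F : set_system T) (FF : ProperFilter F)
  (f : T -> K) (a b : K) : tends F f a -> tends F f b -> a = b.
Proof.
move=> fa fb; apply/eqP; apply/negP => /negP ab.
have d0 : 0 < `|a - b| / 2 by rewrite divr_gt0 ?normr_gt0 ?subr_eq0.
have [t [/= h1 h2]] := filter_ex (filterI (fa _ d0) (fb _ d0)).
have : `|a - b| < `|a - b| / 2 + `|a - b| / 2.
  apply: le_lt_trans (ltrD h1 h2); rewrite [`|b - _|]distrC.
  by apply: le_trans (ler_normD _ _); rewrite addrA subrK.
by rewrite -splitr ltxx.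
Qed.

Lemma tends_mono (T : Type) (F G : set_system T) (f : T -> K) (a : K) :
  F `=>` G -> tends G f a -> tends F f a.
Proof. by move=> FG fa e e0; exact: (FG _ (fa e e0)). Qed.
End TendsComp.

Section Complex.
Variable R : realType.
Local Notation C := R[i].

(** The norm of [R[i]] takes its values in [R[i]]; [nm] moves it to the totally ordered field [R],
    where real estimates apply. *)
Definition nm (z : C) : R := complex.Re `|z|.

Lemma nmE z : `|z| = (nm z)%:C.
Proof. by rewrite /nm normc_def. Qed.

Lemma nm_ge0 z : 0 <= nm z.
Proof. by rewrite -lecR -nmE normr_ge0. Qed.
Hint Resolve nm_ge0 : core.

Lemma nmM z w : nm (z * w) = nm z * nm w.
Proof. by apply: complexI; rewrite rmorphM /= -!nmE normrM. Qed.

Lemma nmD z w : nm (z + w) <= nm z + nm w.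
Proof. by rewrite -lecR rmorphD /= -!nmE ler_normD. Qed.

Lemma nmN z : nm (- z) = nm z.
Proof. by apply: complexI; rewrite -!nmE normrN. Qed.

Lemma nmB z w : nm (z - w) <= nm z + nm w.
Proof. by rewrite -(nmN w) nmD. Qed.

Lemma nmBC z w : nm (z - w) = nm (w - z).
Proof. by rewrite -nmN opprB. Qed.

Lemma nm0 : nm 0 = 0.
Proof. by apply: complexI; rewrite -nmE normr0. Qed.

Lemma nm1 : nm 1 = 1.
Proof. by apply: complexI; rewrite -nmE normr1. Qed.

Lemma nmV z : nm z^-1 = (nm z)^-1.
Proof. by apply: complexI; rewrite fmorphV /= -!nmE normfV. Qed.

Lemma nmX z n : nm (z ^+ n) = nm z ^+ n.
Proof. by apply: complexI; rewrite rmorphXn /= -!nmE normrX. Qed.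

Lemma nmXz z (m : int) : nm (z ^ m) = nm z ^ m.
Proof. by case: m => n; rewrite ?NegzE -?exprnN ?nmV nmX. Qed.

Lemma nm_gt0 z : (0 < nm z) = (z != 0).
Proof. by rewrite -ltcR -nmE normr_gt0. Qed.

Lemma nm_sum (I : Type) (r : seq I) (P : pred I) (f : I -> C) :
  nm (\sum_(i <- r | P i) f i) <= \sum_(i <- r | P i) nm (f i).
Proof.
rewrite -lecR rmorph_sum /= -nmE.
apply: le_trans (ler_norm_sum _ _ _) _; rewrite le_eqVlt; apply/orP; left.
by apply/eqP/eq_bigr => i _; rewrite nmE.
Qed.

Lemma nm_prod (I : Type) (r : seq I) (P : pred I) (f : I -> C) :
  nm (\prod_(i <- r | P i) f i) = \prod_(i <- r | P i) nm (f i).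
Proof. exact: (big_morph nm nmM nm1). Qed.

Lemma nmBB z w : nm z - nm w <= nm (z - w).
Proof. by rewrite lerBlDr; apply: le_trans (nmD _ _); rewrite subrK. Qed.

Lemma nm_real (x : R) : nm x%:C = `|x|.
Proof. by rewrite /nm normc_def /= expr0n /= addr0 sqrtr_sqr. Qed.

Lemma nm_Re z : `|complex.Re z| <= nm z.
Proof. by rewrite -lecR -nmE normc_ge_Re. Qed.

Lemma nm_Im z : `|complex.Im z| <= nm z.
Proof.
have := nm_Re (z * 'i); rewrite ReiNIm normrN nmM.
suff -> : nm 'i = 1 by rewrite mulr1.
by rewrite /nm normc_def /= expr0n expr1n /= add0r sqrtr1.
Qed.

Lemma tendsC (T : Type) (F : set_system T) {FF : Filter F} (f : T -> C) (a : C) :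
  tends F f a <-> f @ F --> a.
Proof.
split=> h; first by apply/cvgrPdist_lt; exact: h.
by move/cvgrPdist_lt: h => h; exact: h.
Qed.

Section Filt.
Variables (T : Type) (F : set_system T).
Context {FF : Filter F}.

Lemma tends_nmP (f : T -> C) (a : C) :
  tends F f a <-> (forall e : R, 0 < e -> F [set t | nm (a - f t) < e]).
Proof.
split=> [h e e0|h e e0].
  have := h e%:C; rewrite ltcR => /(_ e0); apply: filterS => t /=.
  by rewrite nmE ltcR.
have -> : e = (complex.Re e)%:C by rewrite RRe_real // gtr0_real.
move: e0; rewrite ltcE => /andP[_ /= e0].
by apply: filterS (h _ e0) => t /=; rewrite nmE ltcR.
Qed.

Lemma tends_squeeze (f : T -> C) (a : C) (g : T -> R) :
  F [set t | nm (a - f t) <= g t] -> tends F g 0 -> tends F f a.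
Proof.
move=> fg g0; apply/tends_nmP => e e0.
apply: filterS (filterI fg (g0 e e0)) => t [/= h1]; rewrite sub0r normrN => h2.
by apply: le_lt_trans h1 (le_lt_trans (ler_norm _) h2).
Qed.

Lemma tends_real (f : T -> R) (a : R) :
  tends F f a -> tends F (fun t => (f t)%:C) a%:C.
Proof.
move=> fa; apply/tends_nmP => e /fa; apply: filterS => t /=.
by rewrite -rmorphB nm_real.
Qed.

Lemma tends_ReIm (f : T -> C) (a : C) :
  tends F (fun t => complex.Re (f t)) (complex.Re a) ->
  tends F (fun t => complex.Im (f t)) (complex.Im a) -> tends F f a.
Proof.
move=> /tends_real h1 /tends_real h2; rewrite [a]complexE.
apply: tends_ext (tendsD h1 (tendsMl 'i h2)) => t /=.
by rewrite [RHS]complexE.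
Qed.

Lemma tends_nm (f : T -> C) (a : C) :
  tends F f a -> tends F (fun t => nm (f t)) (nm a).
Proof.
move=> /tends_nmP fa e /fa; apply: filterS => t /= h.
apply: le_lt_trans h; rewrite ler_norml nmBB andbT.
by rewrite lerNl opprB nmBC nmBB.
Qed.

Lemma tends_nm_lt (f : T -> C) (a : C) (c : R) :
  tends F f a -> nm a < c -> F [set t | nm (f t) < c].
Proof.
move=> /tends_nm fa ac; have := fa (c - nm a); rewrite subr_gt0 => /(_ ac).
apply: filterS => t /= h.
have := le_lt_trans (ler_norm _) h; rewrite ltrBrDr => h'.
have : nm (f t) - nm a < c - nm a.
  by apply: le_lt_trans (ler_norm _) _; rewrite distrC.
by rewrite ltrBlDr subrK.
Qed.

Lemma tends_nm_gt (f : T -> C) (a : C) (c : R) :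
  tends F f a -> c < nm a -> F [set t | c < nm (f t)].
Proof.
move=> /tends_nm fa ac; have := fa (nm a - c); rewrite subr_gt0 => /(_ ac).
apply: filterS => t /= h.
have := le_lt_trans (ler_norm _) h.
by rewrite ltrD2l ltrN2.
Qed.
End Filt.

Lemma tends_nm_le (T : Type) (F : set_system T) (FF : ProperFilter F) (f : T -> C) (a : C) (c : R) :
  tends F f a -> F [set t | nm (f t) <= c] -> nm a <= c.
Proof.
move=> fa fc; rewrite leNgt; apply/negP => /(tends_nm_gt fa) h.
by have [t [/= h1 h2]] := filter_ex (filterI fc h); have := lt_le_trans h2 h1; rewrite ltxx.
Qed.

Lemma dnbhsC (p : C) (P : set C) :
  p^' P <-> exists2 e : R, 0 < e & forall z, z != p -> nm (p - z) < e -> P z.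
Proof.
split.
  move=> /nbhs_ballP [e /= e0 h]; exists (complex.Re e).
    by move: e0; rewrite ltcE => /andP[].
  move=> z zp pz; apply: h => //; rewrite -ball_normE /=.
  have -> : e = (complex.Re e)%:C by rewrite RRe_real // gtr0_real.
  by rewrite nmE ltcR.
move=> [e e0 h]; apply/nbhs_ballP; exists e%:C; first by rewrite /= ltcR.
move=> z; rewrite -ball_normE /= nmE ltcR => pz zp; exact: h.
Qed.

Lemma nbhsC (p : C) (P : set C) :
  nbhs p P <-> exists2 e : R, 0 < e & forall z, nm (p - z) < e -> P z.
Proof.
split.
  move=> /nbhs_ballP [e /= e0 h]; exists (complex.Re e).
    by move: e0; rewrite ltcE => /andP[].
  move=> z pz; apply: h => //; rewrite -ball_normE /=.
  have -> : e = (complex.Re e)%:C by rewrite RRe_real // gtr0_real.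
  by rewrite nmE ltcR.
move=> [e e0 h]; apply/nbhs_ballP; exists e%:C; first by rewrite /= ltcR.
move=> z; rewrite -ball_normE /= nmE ltcR => pz; exact: h.
Qed.

Lemma geometric_increments_tends (u : nat -> C) (D r : R) :
  0 <= r < 1 -> (forall n, nm (u n.+1 - u n) <= D * r ^+ n) ->
  exists l, tends \oo u l.
Proof.
move=> /andP[r0 r1] h.
(* [g] stands for the real or the imaginary part: additive and bounded by the modulus, so its
   telescoping series is dominated by a geometric one. *)
have H (g : C -> R) : (forall z w, g (z - w) = g z - g w) ->
    (forall z, `|g z| <= nm z) -> exists l, tends \oo (g \o u) l.
  move=> gB gn.
  have cv : cvgn (series (telescope (g \o u))).
    apply: normed_cvg; apply: (@series_le_cvg _ _ (fun n => D * r ^+ n)).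
    - by move=> n; exact: normr_ge0.
    - by move=> n; apply: le_trans (h n); exact: nm_ge0.
    - by move=> n; rewrite /telescope /= -gB; apply: le_trans (gn _) (h n).
    - by apply: is_cvg_geometric_series; rewrite ger0_norm.
  have /cvg_ex [l hl] := cv.
  have hl' : tends \oo (series (telescope (g \o u))) l by apply/tendsP.
  exists (g (u 0%N) + l).
  apply: (tends_ext _ (tendsD (tends_cst (g (u 0%N))) hl')) => n.
  by rewrite /= seriesEnat /= telescope_sumr // addrC subrK.
have [a ha] := H (@complex.Re R) (fun z w => raddfB (@complex.Re R : Rcomplex R -> R) z w) nm_Re.
have [b hb] := H (@complex.Im R) (fun z w => raddfB (@complex.Im R : Rcomplex R -> R) z w) nm_Im.
by exists (a +i* b); exact: tends_ReIm.
Qed.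

End Complex.
#[global] Hint Resolve nm_ge0 : core.

(** * Two-sided series *)

Section Zsum.
Variable R : realType.
Local Notation C := R[i].

Lemma expr_to0 (D r e : R) : 0 <= r < 1 -> 0 < e -> exists N : nat, D * r ^+ N < e.
Proof.
move=> /andP[r0 r1] e0; have r1' : `|r| < 1 by rewrite ger0_norm.
have h : tends \oo (fun n => D * r ^+ n) (D * 0).
  by apply: tendsMl; apply/tendsP; exact: cvg_expr.
have [N /= hN] := filter_ex (h e e0); exists N.
by move: hN; rewrite mulr0 sub0r normrN; apply: le_lt_trans; exact: ler_norm.
Qed.

Lemma tendsn_mul_expr0 (D r : R) : 0 <= r < 1 -> tends \oo (fun n => D * r ^+ n) 0.
Proof.
move=> /andP[r0 r1]; have r1' : `|r| < 1 by rewrite ger0_norm.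
by rewrite -[X in tends _ _ X](mulr0 D); apply: tendsMl; apply/tendsP; exact: cvg_expr.
Qed.

Lemma tends_subseq (f : nat -> C) (g : nat -> nat) (a : C) :
  (forall n, (n <= g n)%N) -> tends \oo f a -> tends \oo (f \o g) a.
Proof.
move=> gn fa e e0; have [N _ h] := fa e e0; exists N => // n /= Nn.
exact: h (leq_trans Nn (gn n)).
Qed.

Definition zpart (a : int -> C) (N : nat) : C :=
  \sum_(k < (2 * N).+1) a (k%:Z - N%:Z).

Definition zsum (a : int -> C) : C := lim (zpart a @ \oo).

Lemma zsumE (a : int -> C) l : tends \oo (zpart a) l -> zsum a = l.
Proof. by move=> /tendsC h; apply: cvg_lim => //. Qed.

Lemma zpartS a N :
  zpart a N.+1 = zpart a N + (a N.+1%:Z + a (- N.+1%:Z)).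
Proof.
rewrite /zpart; have -> : (2 * N.+1).+1 = (2 * N).+3 by lia.
rewrite big_ord_recl big_ord_recr /= addrCA [X in _ + X]addrC.
congr (_ + (a _ + a _)); rewrite /= ?/bump /=; [|lia|lia].
by apply: eq_bigr => i _; congr a; rewrite /bump /=; lia.
Qed.

Lemma zpart0 a : zpart a 0 = a 0.
Proof. by rewrite /zpart big_ord_recl big_ord0 addr0. Qed.

Lemma zpartN a N : zpart (fun m => a (- m)) N = zpart a N.
Proof.
elim: N => [|N IH]; first by rewrite !zpart0 oppr0.
by rewrite !zpartS IH opprK [X in _ + X]addrC.
Qed.

Lemma zpart_shift a N :
  zpart (fun m => a (m + 1)) N = zpart a N - a (- N%:Z) + a (N%:Z + 1).
Proof.
elim: N => [|N IH]; first by rewrite !zpart0 oppr0 add0r subrr add0r.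
rewrite !zpartS IH.
have -> : (- N.+1%:Z + 1 = - N%:Z :> int)%R by lia.
have -> : (N.+1%:Z = N%:Z + 1 :> int)%R by lia.
ring.
Qed.

Lemma zpart_lin a b c N :
  zpart (fun m => c * a m + b m) N = c * zpart a N + zpart b N.
Proof. by rewrite /zpart big_split /= mulr_sumr. Qed.

(** The odd numbers [2 * s + 1] with [-N <= s <= N] overshoot the window by [2 * N + 1], hence the
    correction. *)
Lemma zpart_split a N :
  zpart a (2 * N) = zpart (fun s => a (2 * s)) N + zpart (fun s => a (2 * s + 1)) N
                    - a (2 * N%:Z + 1).
Proof.
elim: N => [|N IH]; first by rewrite !zpart0 !mulr0 add0r addrK.
have -> : (2 * N.+1 = (2 * N).+2)%N by lia.
rewrite !zpartS IH.
have -> : ((2 * N).+2%:Z = 2 * N.+1%:Z)%R by lia.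
have -> : ((2 * N).+1%:Z = 2 * N%:Z + 1)%R by lia.
have -> : (2 * (- N.+1%:Z) = - (2 * N.+1%:Z))%R by lia.
have -> : (- (2 * N.+1%:Z) + 1 = - (2 * N%:Z + 1))%R by lia.
ring.
Qed.

Section Geo.
Variables (B r : R).
Hypothesis r01 : 0 <= r < 1.
Let r0 : 0 <= r. Proof. by case/andP: r01. Qed.
Let r1 : r < 1. Proof. by case/andP: r01. Qed.

(** Domination by a two-sided geometric sequence. Keeping [B] and [r] explicit makes it uniform over
    families, as dominated convergence requires. *)
Definition geo (a : int -> C) := forall m, nm (a m) <= B * r ^+ `|m|%N.

Lemma geo_ge0 a : geo a -> 0 <= B.
Proof. by move=> h; have := h 0; rewrite absz0 expr0 mulr1; exact: le_trans (nm_ge0 _). Qed.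

Lemma geo_increment a N : geo a -> nm (zpart a N.+1 - zpart a N) <= 2 * B * r ^+ N.
Proof.
move=> h; rewrite zpartS addrAC subrr add0r; apply: le_trans (nmD _ _) _.
have := h N.+1%:Z; have := h (- N.+1%:Z); rewrite abszN absz_nat exprS => h1 h2.
have h3 : B * (r * r ^+ N) <= B * r ^+ N.
  by rewrite ler_wpM2l ?(geo_ge0 h) // ler_piMl ?exprn_ge0 // ltW.
lra.
Qed.

Lemma zsum_tends a : geo a -> tends \oo (zpart a) (zsum a).
Proof.
move=> h; have [l hl] := geometric_increments_tends r01 (fun n => geo_increment n h).
by rewrite (zsumE hl).
Qed.

Lemma zpart_tail a N M : geo a ->
  nm (zpart a (N + M) - zpart a N) <= 2 * B / (1 - r) * r ^+ N.
Proof.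
move=> h.
have r1' : 0 < 1 - r by rewrite subr_gt0.
(* With the extra factor [1 - r ^+ M] the bound is exactly additive, so the induction on [M]
   closes. *)
suff H : nm (zpart a (N + M) - zpart a N) <= 2 * B / (1 - r) * r ^+ N * (1 - r ^+ M).
  apply: le_trans H _; apply: ler_piMr; last by rewrite gerBl exprn_ge0.
  by rewrite mulr_ge0 ?exprn_ge0 // divr_ge0 ?mulr_ge0 ?(geo_ge0 h) // ltW.
elim: M => [|M IH]; first by rewrite addn0 subrr nm0 expr0 subrr mulr0.
rewrite addnS -(subrK (zpart a (N + M)) (zpart a _)) -addrA.
apply: le_trans (nmD _ _) _.
have := lerD (geo_increment (N + M) h) IH; move/le_trans; apply.
rewrite exprD exprS le_eqVlt; apply/orP; left; apply/eqP; field.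
by rewrite gt_eqF.
Qed.

Lemma zsum_tail a N : geo a -> nm (zsum a - zpart a N) <= 2 * B / (1 - r) * r ^+ N.
Proof.
move=> h; have hs := tendsB (zsum_tends h) (tends_cst (zpart a N)).
apply: (tends_nm_le _ (tendsB (zsum_tends h) (tends_cst (zpart a N)))).
exists N => // M /= NM; rewrite -(subnKC NM); exact: zpart_tail.
Qed.

Lemma zpart_le a N : geo a -> nm (zpart a N) <= (B + 2 * B / (1 - r)).
Proof.
move=> h; have := zpart_tail 0 N h; rewrite add0n expr0 mulr1 zpart0 => h1.
have := h 0; rewrite expr0 mulr1 => h0.
rewrite -(subrK (a 0) (zpart a N)); apply: le_trans (nmD _ _) _; lra.
Qed.

Lemma zsum_le a : geo a -> nm (zsum a) <= (B + 2 * B / (1 - r)).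
Proof.
move=> h; apply: (tends_nm_le _ (zsum_tends h)).
by exists 0%N => // M _; exact: zpart_le.
Qed.

Lemma geo_to0 a (f : nat -> int) : (forall n, (n <= `|f n|)%N) -> geo a ->
  tends \oo (fun n => a (f n)) 0.
Proof.
move=> hf h; apply: (tends_squeeze _ (tendsn_mul_expr0 B r01)).
apply: filterE => n /=; rewrite sub0r nmN; apply: le_trans (h _) _.
by rewrite ler_wpM2l ?(geo_ge0 h) // ler_wiXn2l // ltW.
Qed.

Lemma zsum_shift a : geo a -> tends \oo (zpart (fun m => a (m + 1))) (zsum a).
Proof.
move=> h; rewrite -[zsum a]addr0 -[X in tends _ _ (_ + X)]oppr0 -[X in tends _ _ X]addr0.
apply: (tends_ext (fun N => esym (zpart_shift a N))).
apply: tendsD; [apply: tendsB; first exact: zsum_tends|]; apply: geo_to0 => // n; lia.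
Qed.

(** Dominated convergence for series: the tails beyond [N] are small uniformly in [t], and the head
    is a finite sum. *)
Lemma tannery (T : Type) (F : set_system T) {FF : Filter F}
    (a_ : T -> int -> C) (a : int -> C) :
  F [set t | geo (a_ t)] -> geo a -> (forall m, tends F (a_ ^~ m) (a m)) ->
  tends F (fun t => zsum (a_ t)) (zsum a).
Proof.
move=> hF ha h; apply/tends_nmP => e e0.
have e3 : 0 < e / 3 by lra.
have [N hN] := expr_to0 (2 * B / (1 - r)) r01 e3.
have hp : tends F (fun t => zpart (a_ t) N) (zpart a N).
  by apply: tends_sum => k _; exact: h.
have /tends_nmP hp' := hp.
apply: filterS (filterI hF (hp' _ e3)) => t [/= h1 h2].
have h3 := zsum_tail N ha; have h4 := zsum_tail N h1.
have -> : zsum a - zsum (a_ t) = (zsum a - zpart a N) + (zpart a N - zpart (a_ t) N)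
    + (zpart (a_ t) N - zsum (a_ t)) by ring.
rewrite nmBC in h4.
have := nmD ((zsum a - zpart a N) + (zpart a N - zpart (a_ t) N)) (zpart (a_ t) N - zsum (a_ t)).
have := nmD (zsum a - zpart a N) (zpart a N - zpart (a_ t) N).
rewrite nmBC in h4; move: h3 h4; rewrite ![nm (zsum (a_ t) - _)]nmBC; lra.
Qed.

End Geo.

Lemma geoZ B r c a : geo B r a -> geo (nm c * B) r (fun m => c * a m).
Proof. by move=> h m; rewrite nmM -mulrA ler_wpM2l ?nm_ge0. Qed.

Lemma zsum_lin B r c a b : 0 <= r < 1 -> geo B r a -> geo B r b ->
  zsum (fun m => c * a m + b m) = c * zsum a + zsum b.
Proof.
move=> r01 ha hb; apply: zsumE.
apply: (tends_ext (fun N => esym (zpart_lin a b c N))).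
by apply: tendsD; [apply: tendsMl; exact: (zsum_tends r01 ha)|exact: (zsum_tends r01 hb)].
Qed.

Lemma zsumZ B r c a : 0 <= r < 1 -> geo B r a ->
  zsum (fun m => c * a m) = c * zsum a.
Proof.
move=> r01 ha; apply: zsumE.
apply: (tends_ext (f := fun N => c * zpart a N)).
  by move=> N; rewrite /zpart mulr_sumr.
by apply: tendsMl; exact: (zsum_tends r01 ha).
Qed.

Lemma zsumN a : zsum (fun m => a (- m)) = zsum a.
Proof.
rewrite /zsum; suff -> : zpart (fun m => a (- m)) = zpart a by [].
by apply/funext => N; exact: zpartN.
Qed.

Lemma zsum_addz B r a (k : int) : 0 < r < 1 -> geo B r a -> zsum (fun m => a (m + k)) = zsum a.
Proof.
move=> /andP[r0 r1] h; have r01 : 0 <= r < 1 by rewrite ltW.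
have key (n : nat) b : geo B r b -> zsum (fun m => b (m + n%:Z)) = zsum b.
  move=> hb; elim: n => [|n IH].
    by congr zsum; apply/funext => m; rewrite addr0.
  (* A shift by [n] costs a factor [r ^- n] in the constant, because [|m| <= |m + n| + n]. *)
  rewrite -IH -(zsumE (zsum_shift (B := B * r ^- n) r01 (a := fun m => b (m + n%:Z)) _)).
    by congr zsum; apply/funext => m; congr b; lia.
  move=> m; apply: le_trans (hb _) _; rewrite -mulrA ler_wpM2l ?(geo_ge0 hb) //.
  rewrite mulrC ler_pdivlMr ?exprn_gt0 // -exprD ler_wiXn2l //; [exact: ltW|exact: ltW|lia].
case: k => n; first exact: key.
rewrite -(zsumN a) -(key n.+1 (fun m => a (- m))).
  rewrite -[LHS]zsumN; congr zsum; apply/funext => m; congr a; lia.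
by move=> m; rewrite -abszN; exact: h.
Qed.

Lemma zsum_split B r a : 0 <= r < 1 -> geo B r a ->
  zsum a = zsum (fun s => a (2 * s)) + zsum (fun s => a (2 * s + 1)).
Proof.
move=> r01 h; have [r0 r1] := andP r01.
have h1 : geo B r (fun s => a (2 * s)).
  move=> m; apply: le_trans (h _) _; rewrite ler_wpM2l ?(geo_ge0 h) // ler_wiXn2l //; [exact: ltW|lia].
have h2 : geo B r (fun s => a (2 * s + 1)).
  move=> m; apply: le_trans (h _) _; rewrite ler_wpM2l ?(geo_ge0 h) // ler_wiXn2l //; [exact: ltW|lia].
apply: (tends_unique _ (F := \oo) (f := zpart a \o (fun N => 2 * N)%N)).
  by apply: tends_subseq; [move=> n; lia|exact: (zsum_tends r01 h)].
rewrite -[X in tends _ _ X]subr0.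
apply: (tends_ext (fun N => esym (zpart_split a N))).
apply: tendsB; first by apply: tendsD; [exact: (zsum_tends r01 h1)|exact: (zsum_tends r01 h2)].
by apply: (geo_to0 r01 _ h) => n; lia.
Qed.

(** Both iterated sums are the limit in [N] of the sum over all [m] and over [|d| <= N]: Tannery's
    theorem evaluates it one way, additivity over the finite range of [d] the other way. *)
Lemma zsum_exchange B r (G : int -> int -> C) : 0 <= r < 1 ->
  (forall m d, nm (G m d) <= B * r ^+ `|m|%N * r ^+ `|d|%N) ->
  zsum (fun m => zsum (G m)) = zsum (fun d => zsum (G ^~ d)).
Proof.
move=> r01 h; have [r0 r1] := andP r01.
have hG1 m : geo (B * r ^+ `|m|%N) r (G m) by move=> d; exact: h.
have hG2 d : geo (B * r ^+ `|d|%N) r (G ^~ d).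
  by move=> m; apply: le_trans (h _ _) _; rewrite mulrAC.
have B0 : 0 <= B by have := geo_ge0 (hG1 0); rewrite expr0 mulr1.
have hc : 0 < 1 - r by rewrite subr_gt0.
have hs1 : geo (B + 2 * B / (1 - r)) r (fun m => zsum (G m)).
  move=> m; apply: le_trans (zsum_le r01 (hG1 m)) _.
  by rewrite le_eqVlt; apply/orP; left; apply/eqP; ring.
have hs2 : geo (B + 2 * B / (1 - r)) r (fun d => zsum (G ^~ d)).
  move=> d; apply: le_trans (zsum_le r01 (hG2 d)) _.
  by rewrite le_eqVlt; apply/orP; left; apply/eqP; ring.
have hgB d : geo B r (G ^~ d).
  move=> m; apply: le_trans (hG2 d m) _; rewrite ler_wpM2r ?exprn_ge0 //.
  by rewrite ler_piMr // exprn_ile1 // ltW.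
apply: (tends_unique _ (F := \oo) (f := fun N => zsum (fun m => zpart (G m) N))).
  apply: (tannery r01 _ hs1).
    apply: filterE => N /= m; apply: le_trans (zpart_le r01 N (hG1 m)) _.
    by rewrite le_eqVlt; apply/orP; left; apply/eqP; ring.
  by move=> m; exact: (zsum_tends r01 (hG1 m)).
apply: (tends_ext (f := zpart (fun d => zsum (G ^~ d)))); last exact: (zsum_tends r01 hs2).
move=> N; rewrite /zpart.
elim: (2 * N).+1 => [|n IH].
  rewrite big_ord0; apply/esym/zsumE.
  apply: (tends_ext (f := fun=> 0)); last exact: tends_cst.
  by move=> M; rewrite /zpart big1 // => k _; rewrite big_ord0.
rewrite big_ord_recr /= IH.
set g := fun m => _; set G' := G^~ _.
have -> : (fun m => \sum_(i < n.+1) G m (i%:Z - N%:Z)) = fun m => 1 * g m + G' m.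
  by apply/funext => m; rewrite big_ord_recr /= mul1r.
have gg : geo (\sum_(i < n) B) r g.
  move=> m; apply: le_trans (nm_sum _ _ _) _; rewrite mulr_suml.
  by apply: ler_sum => i _; exact: hgB.
rewrite (zsum_lin (B := \sum_(i < n.+1) B) (r := r)) ?mul1r //.
  by move=> m; apply: le_trans (gg m) _; rewrite ler_wpM2r ?exprn_ge0 // big_ord_recr /= lerDl.
move=> m; apply: le_trans (hgB _ m) _; rewrite ler_wpM2r ?exprn_ge0 // big_ord_recr /= lerDr.
by apply: sumr_ge0.
Qed.

(** The double sum over pairs of indices is arranged by their sum [d] and split by the parity of
    [d]; the lattice is then rotated to [(s + t, s - t)] or [(s + t + 1, s - t)]. Rate [r ^+ 2] for
    the factors leaves rate [r] in both [m] and [d], since [2|m| + 2|d - m| >= |m| + |d|]. *)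
Lemma zsum_mul_rotate B r (x y u v u' v' : int -> C) : 0 < r < 1 ->
  geo B (r ^+ 2) x -> geo B (r ^+ 2) y -> geo B r u -> geo B r v -> geo B r u' -> geo B r v' ->
  (forall s t, x (s + t) * y (s - t) = u s * v t) ->
  (forall s t, x (s + t + 1) * y (s - t) = u' s * v' t) ->
  zsum x * zsum y = zsum u * zsum v + zsum u' * zsum v'.
Proof.
move=> r01' hx hy hu hv hu' hv' e1 e2.
have [r0 r1] := andP r01'; have r01 : 0 <= r < 1 by rewrite ltW.
have r01s : 0 < r ^+ 2 < 1 by rewrite exprn_gt0 // exprn_ilt1 // ltW.
have r01s' : 0 <= r ^+ 2 < 1 by rewrite exprn_ge0 ?exprn_ilt1 // ltW.
have B0 := geo_ge0 hx.
have hle m d : nm (x m * y (d - m)) <= B * B * r ^+ `|m|%N * r ^+ `|d|%N.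
  rewrite nmM; apply: le_trans (ler_pM _ _ (hx m) (hy (d - m))) _; rewrite ?nm_ge0 //.
  rewrite mulrACA -[leRHS]mulrA ler_wpM2l ?mulr_ge0 //.
  rewrite -!exprM -!exprD ler_wiXn2l //; [exact: ltW|exact: ltW|lia].
have hN : geo B (r ^+ 2) (fun d => y (- d)) by move=> m; rewrite -abszN; exact: hy.
have E1 : zsum x * zsum y = zsum (fun m => zsum (fun d => x m * y (d - m))).
  rewrite mulrC -(zsumZ _ r01s' hx); congr zsum; apply/funext => m.
  rewrite (zsumZ _ r01s' (B := B * (r ^+ 2) ^- `|m|%N)).
    by rewrite mulrC (zsum_addz (- m) r01s hy).
  move=> d; apply: le_trans (hy _) _; rewrite -mulrA ler_wpM2l //.
  rewrite mulrC ler_pdivlMr ?exprn_gt0 // -exprD ler_wiXn2l ?exprn_ge0 ?exprn_ile1 // ?ltW //.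
  lia.
rewrite E1 (zsum_exchange r01 hle).
have hg d : geo (B * B * r ^+ `|d|%N) r (fun m => x m * y (d - m)).
  by move=> m; apply: le_trans (hle m d) _; rewrite mulrAC.
have hs : geo (B * B + 2 * (B * B) / (1 - r)) r (fun d => zsum (fun m => x m * y (d - m))).
  move=> d; apply: le_trans (zsum_le r01 (hg d)) _.
  have hc : 0 < 1 - r by rewrite subr_gt0.
  by rewrite le_eqVlt; apply/orP; left; apply/eqP; ring.
rewrite (zsum_split r01 hs); congr (_ + _).
  rewrite [RHS]mulrC -(zsumZ _ r01 hu); congr zsum; apply/funext => s.
  rewrite [RHS]mulrC -(zsumZ _ r01 hv) -(zsum_addz s r01' (hg (2 * s))).
  congr zsum; apply/funext => t; rewrite -e1; congr (x _ * y _); lia.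
rewrite [RHS]mulrC -(zsumZ _ r01 hu'); congr zsum; apply/funext => s.
rewrite [RHS]mulrC -(zsumZ _ r01 hv') -(zsum_addz (s + 1) r01' (hg (2 * s + 1))).
congr zsum; apply/funext => t; rewrite -e2; congr (x _ * y _); lia.
Qed.

End Zsum.

(** * The exponential function *)

Section Exponential.
Variable R : realType.
Local Notation C := R[i].

Definition cis (x : R) : C := (cos x)%:C + 'i * (sin x)%:C.

Lemma cisD x y : cis (x + y) = cis x * cis y.
Proof.
rewrite /cis cosD sinD rmorphB !rmorphD !rmorphM /=.
have hi : 'i * 'i = -1 :> C by rewrite -expr2 sqr_i.
have -> : forall a b c d : C, (a + 'i * b) * (c + 'i * d) = a * c + ('i * 'i) * (b * d) + 'i * (b * c + a * d).
  by move=> a b c d; ring.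
by rewrite hi mulN1r.
Qed.

Lemma eeE (z : C) : ee z = (expR (- (2 * pi * complex.Im z)))%:C * cis (2 * pi * complex.Re z).
Proof. by []. Qed.

Lemma eeD (x y : C) : ee (x + y) = ee x * ee y.
Proof.
have hR : complex.Re (x + y) = complex.Re x + complex.Re y by case: (x) (y) => [? ?] [? ?].
have hI : complex.Im (x + y) = complex.Im x + complex.Im y by case: (x) (y) => [? ?] [? ?].
by rewrite (eeE (x + y)) (eeE x) (eeE y) hR hI !(mulrDr (2 * pi)) opprD expRD cisD rmorphM mulrACA.
Qed.

Lemma ee0 : ee 0 = 1 :> C.
Proof. by rewrite eeE /= !mulr0 oppr0 expR0 /cis cos0 sin0 mulr0 addr0 mul1r. Qed.

Lemma ee_neq0 (z : C) : ee z != 0.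
Proof.
apply/eqP => h; have := ee0; rewrite -(subrr z) eeD h mul0r => /eqP.
by rewrite eq_sym oner_eq0.
Qed.

Lemma eeN (z : C) : ee (- z) = (ee z)^-1.
Proof.
by apply: (mulfI (ee_neq0 z)); rewrite -eeD subrr ee0 divff ?ee_neq0.
Qed.

Lemma eeB (x y : C) : ee (x - y) = ee x / ee y.
Proof. by rewrite eeD eeN. Qed.

Lemma eeMn (n : nat) (z : C) : ee (n%:R * z) = ee z ^+ n.
Proof.
elim: n => [|n IH]; first by rewrite mul0r ee0.
by rewrite -natr1 mulrDl mul1r eeD IH exprSr.
Qed.

Lemma eeMz (m : int) (z : C) : ee (m%:~R * z) = ee z ^ m.
Proof.
case: m => n; first by rewrite -pmulrn eeMn.
by rewrite NegzE mulrNz mulNr eeN -pmulrn eeMn exprnN.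
Qed.

Lemma ee1 : ee 1 = 1 :> C.
Proof.
rewrite eeE /= mulr0 oppr0 expR0 mul1r mulr1 /cis mulr_natl cos2pi sin2pi.
by rewrite mulr0 addr0.
Qed.

Lemma ee_int (m : int) : ee (m%:~R : C) = 1.
Proof. by rewrite -[_%:~R]mulr1 eeMz ee1 exp1rz. Qed.

Lemma ee_half : ee (2^-1 : C) = -1.
Proof.
have -> : (2^-1 : C) = (2^-1)%:C by rewrite fmorphV rmorph_nat.
rewrite eeE /= mulr0 oppr0 expR0 mul1r mulrAC divff // mul1r /cis cospi sinpi.
by rewrite mulr0 addr0 rmorphN1.
Qed.

Lemma nm_cis x : nm (cis x) = 1.
Proof.
rewrite /nm normc_def /cis /= !(mul0r, mulr0, mul1r, add0r, addr0, subr0).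
by rewrite cos2Dsin2 sqrtr1.
Qed.

Lemma nm_ee (z : C) : nm (ee z) = expR (- (2 * pi * complex.Im z)).
Proof. by rewrite eeE nmM nm_cis mulr1 nm_real ger0_norm ?expR_ge0. Qed.

(** Modulus one kills the imaginary part. Subtracting the floor leaves [0 <= x < 1], where
    [sin (pi * x)] vanishes at 0 only. *)
Lemma ee_eq1 (z : C) : ee z = 1 -> exists m : int, z = m%:~R.
Proof.
move=> h; have hI : complex.Im z = 0.
  have := nm_ee z; rewrite h nm1 => /esym; rewrite -expR0 => /expR_inj /eqP.
  by rewrite oppr_eq0 mulf_eq0 gt_eqF ?mulr_gt0 ?pi_gt0 //= => /eqP.
pose m := Num.floor (complex.Re z); exists m.
pose x := complex.Re z - m%:~R.
have hz : z = x%:C + m%:~R.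
  by rewrite /x rmorphB /= rmorph_int subrK [LHS]complexE hI mulr0 addr0.
have hx : ee x%:C = 1 by rewrite -h hz eeD ee_int mulr1.
have x01 : 0 <= x < 1.
  have /andP[f1 f2] := floor_itv (complex.Re z).
  by rewrite /x subr_ge0 f1 /= ltrBlDl; move: f2; rewrite intrD.
move: hx; rewrite eeE /= mulr0 oppr0 expR0 mul1r /cis => /(congr1 (@complex.Re R)).
rewrite /= !(mul0r, mulr0, mul1r, add0r, addr0, subr0) => hc.
suff x0 : x = 0 by rewrite hz x0 add0r.
have : sin (pi * x) ^+ 2 = 0.
  have h1 : cos (pi * x *+ 2) = 1 by rewrite -[_ *+ 2]mulr_natl mulrA.
  have h2 := cos_mulr2n (pi * x); rewrite h1 -mulr_natl in h2.
  by rewrite sin2cos2; lra.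
move=> /eqP; rewrite expf_eq0 /= => /eqP hs.
apply/eqP; rewrite eq_le; case/andP: x01 => x0 x1; rewrite x0 andbT leNgt; apply/negP => xp.
suff : 0 < sin (pi * x) by rewrite hs ltxx.
by apply: sin_gt0_pi; rewrite mulr_gt0 ?pi_gt0 //= gtr_pMr ?pi_gt0.
Qed.

Section Filt.
Variables (T : Type) (F : set_system T).
Context {FF : Filter F}.

Lemma tends_contR (g : R -> R) (f : T -> R) (a : R) :
  continuous g -> tends F f a -> tends F (fun t => g (f t)) (g a).
Proof.
move=> cg /tendsP fa; apply/tendsP.
by apply: (@continuous_cvg _ R R _ _ f g a) => //; exact: cg.
Qed.

Lemma tends_Re (f : T -> C) a : tends F f a -> tends F (fun t => complex.Re (f t)) (complex.Re a).
Proof.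
move=> /tends_nmP fa e /fa; apply: filterS => t /=; apply: le_lt_trans.
by apply: le_trans (nm_Re _); case: (a) (f t) => [? ?] [? ?].
Qed.

Lemma tends_Im (f : T -> C) a : tends F f a -> tends F (fun t => complex.Im (f t)) (complex.Im a).
Proof.
move=> /tends_nmP fa e /fa; apply: filterS => t /=; apply: le_lt_trans.
by apply: le_trans (nm_Im _); case: (a) (f t) => [? ?] [? ?].
Qed.

Lemma tends_cis (f : T -> R) a : tends F f a -> tends F (fun t => cis (f t)) (cis a).
Proof.
move=> fa; apply: tendsD; first exact: (tends_real (tends_contR (@continuous_cos R) fa)).
by apply: tendsMl; exact: (tends_real (tends_contR (@continuous_sin R) fa)).
Qed.

Lemma tends_ee (f : T -> C) a : tends F f a -> tends F (fun t => ee (f t)) (ee a).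
Proof.
move=> fa; rewrite /ee; apply: tendsM.
  apply: tends_real; apply: (tends_contR (g := @expR R)); first exact: continuous_expR.
  by apply: tendsN; apply: tendsMl; exact: tends_Im.
by apply: tends_cis; apply: tendsMl; exact: tends_Re.
Qed.
End Filt.

Lemma is_derive0_quotient (f : R -> R) (d : R) : is_derive (0 : R) (1 : R) f d ->
  exists2 E : R -> R, (forall x, f x = f 0 + x * E x) & tends (nbhs (0 : R)) E d.
Proof.
move=> hd; exists (fun x => if x == 0 then d else (f x - f 0) / x).
  by move=> x; case: eqP => [->|/eqP x0]; rewrite ?mul0r ?addr0 // mulrC divfK // addrC subrK.
have hc : (fun h : R => h^-1 *: ((f \o shift 0) (h *: (1 : R)) - f 0)) @ 0^' --> d.
  by have [h1 <-] := hd; exact: h1.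
move=> e e0; have /tendsP h2 := hc.
have := h2 _ e0; rewrite /dnbhs /within /=; apply: filterS => x /= hx.
case: eqP => [_|/eqP x0]; first by rewrite subrr normr0.
have := hx x0; rewrite /shift /= addr0 [_ *: 1]mulr1.
by rewrite [_ *: _]mulrC.
Qed.

Lemma ee_diff0 : tends ((0 : C)^') (fun h : C => (ee h - 1) / h) ((2 * pi)%:C * 'i).
Proof.
have [E hE tE] := is_derive0_quotient (is_derive_expR (0 : R)).
have [S hS tS] := is_derive0_quotient (is_derive_sin (0 : R)).
have [D hD tD] := is_derive0_quotient (is_derive_cos (0 : R)).
rewrite expR0 in hE tE; rewrite sin0 in hS; rewrite cos0 in hD tS; rewrite sin0 oppr0 in tD.
pose u (h : C) := - (2 * pi * complex.Im h); pose v (h : C) := 2 * pi * complex.Re h.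
have tid : tends ((0 : C)^') (id : C -> C) 0.
  by apply/tends_nmP => e e0; apply/dnbhsC; exists e.
have tu : tends ((0 : C)^') u (- (2 * pi * complex.Im (0 : C))).
  by apply: tendsN; apply: tendsMl; exact: (tends_Im tid).
have tv : tends ((0 : C)^') v (2 * pi * complex.Re (0 : C)).
  by apply: tendsMl; exact: (tends_Re tid).
rewrite /= mulr0 ?oppr0 in tu; rewrite /= mulr0 in tv.
have cu : u @ (0 : C)^' --> (0 : R) by apply/tendsP.
have cv : v @ (0 : C)^' --> (0 : R) by apply/tendsP.
have tcis : tends ((0 : C)^') (fun h => cis (v h)) 1.
  suff <- : cis 0 = 1 by exact: tends_cis.
  by rewrite /cis cos0 sin0 mulr0 addr0.
(* [A] and [B] are the error factors: the remainder of first order is [u A + v B], with [u] and [v]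
   at most [2 * pi * nm h] in absolute value. *)
pose A h := (E (u h))%:C * cis (v h) - 1.
pose B h := (D (v h))%:C + 'i * ((S (v h))%:C - 1).
have tA : tends ((0 : C)^') A 0.
  rewrite -[X in tends _ _ X](subrr 1); apply: tendsB; last exact: tends_cst.
  rewrite -[X in tends _ _ X](mul1r 1); apply: tendsM => //.
  exact: (tends_real (tends_comp cu tE)).
have tB : tends ((0 : C)^') B 0.
  rewrite [X in tends _ _ X](_ : 0 = (0 : R)%:C + 'i * ((1 : R)%:C - 1)); last first.
    by rewrite subrr mulr0 addr0.
  apply: tendsD; first exact: (tends_real (tends_comp cv tD)).
  apply: tendsMl; apply: tendsB; last exact: tends_cst.
  exact: (tends_real (tends_comp cv tS)).
have tg : tends ((0 : C)^') (fun h => 2 * pi * (nm (A h) + nm (B h))) 0.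
  rewrite -[X in tends _ _ X](mulr0 (2 * pi)); apply: tendsMl.
  rewrite [X in tends _ _ X](_ : 0 = nm (0 : C) + nm (0 : C)); last by rewrite nm0 addr0.
  by apply: tendsD; exact: tends_nm.
apply: tends_squeeze tg; apply/dnbhsC; exists 1 => // h h0 _ /=.
have key : ee h - 1 - (2 * pi)%:C * 'i * h = (u h)%:C * A h + (v h)%:C * B h.
  rewrite eeE -/(u h) -/(v h) hE /A /B {1}/cis hD hS.
  have -> : (2 * pi)%:C * 'i * h = 'i * (v h)%:C + (u h)%:C.
    rewrite [h in LHS]complexE /u /v rmorphN !rmorphM /=.
    rewrite mulrDr [_ * 'i * ('i * _)]mulrA -[_ * 'i * 'i]mulrA -expr2 sqr_i; ring.
  rewrite /cis hD hS add0r !rmorphD !rmorphM /=; ring.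
have -> : (2 * pi)%:C * 'i - (ee h - 1) / h = - ((u h)%:C * A h + (v h)%:C * B h) / h.
  by rewrite -key; field.
rewrite mulNr nmN nmM nmV ler_pdivrMr ?nm_gt0 //.
apply: le_trans (nmD _ _) _; rewrite !nmM !nm_real.
have p0 : 0 <= 2 * pi :> R by rewrite mulr_ge0 ?pi_ge0.
have h1 : `|u h| <= 2 * pi * nm h by rewrite /u normrN normrM ger0_norm // ler_wpM2l ?nm_Im.
have h2 : `|v h| <= 2 * pi * nm h by rewrite /v normrM ger0_norm // ler_wpM2l ?nm_Re.
rewrite mulrDr mulrDl ![_ * nm _ * nm h]mulrAC.
by apply: lerD; rewrite ler_wpM2r ?nm_ge0.
Qed.

Lemma eta_neq0 (z : C) : 0 < complex.Im z -> z != 0.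
Proof. by apply: contraTneq => ->; rewrite ltxx. Qed.

End Exponential.

(** * Differentiability *)

Section Differentiability.
Variable R : realType.
Local Notation C := R[i].

(* Caratheodory's form of complex differentiability at a point. *)
Definition cdiff (f : C -> C) (p : C) :=
  exists Q d, (forall z, f z = f p + (z - p) * Q z) /\ tends (nbhs p) Q d.

Lemma tends_id (p : C) : tends (nbhs p) id p.
Proof. by apply/tends_nmP => e e0; apply/nbhsC; exists e. Qed.

Lemma dnbhs_sub (p : C) : (p^') `=>` nbhs p.
Proof. by move=> A /nbhsC [e e0 h]; apply/dnbhsC; exists e => // z _; exact: h. Qed.

Lemma tends_nbhs (f : C -> C) (p : C) : tends (p^') f (f p) -> tends (nbhs p) f (f p).
Proof.
move=> h; apply/tends_nmP => e e0; have /tends_nmP/(_ e e0)/dnbhsC [d d0 hd] := h.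
apply/nbhsC; exists d => // z pz /=; case: (eqVneq z p) => [->|zp].
  by rewrite subrr nm0.
exact: hd.
Qed.

Lemma cdiff_cont (f : C -> C) (p : C) : cdiff f p -> tends (nbhs p) f (f p).
Proof.
move=> [Q [d [h tQ]]].
have -> : f = fun z => f p + (z - p) * Q z by apply/funext.
rewrite [X in tends _ _ X](_ : _ = f p + (p - p) * d); last by rewrite subrr !mul0r.
apply: tendsD; first exact: tends_cst.
by apply: tendsM => //; apply: tendsB; [exact: tends_id|exact: tends_cst].
Qed.

Lemma cdiff_quotient (f : C -> C) (p d : C) : tends (p^') (fun z => (f z - f p) / (z - p)) d -> cdiff f p.
Proof.
move=> h; pose Q z := if z == p then d else (f z - f p) / (z - p).
have Qp : Q p = d by rewrite /Q eqxx.
exists Q, d; split.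
  move=> z; rewrite /Q; case: eqP => [->|/eqP zp]; first by rewrite subrr mul0r addr0.
  by rewrite mulrC divfK ?subr_eq0 // addrC subrK.
rewrite -Qp; apply: tends_nbhs; rewrite Qp; apply: tends_near h.
by apply/dnbhsC; exists 1 => // z zp _ /=; rewrite /Q (negPf zp).
Qed.

Lemma cdiff_cst (c p : C) : cdiff (fun=> c) p.
Proof. by exists (fun=> 0), 0; split=> [z|]; rewrite ?mulr0 ?addr0 //; exact: tends_cst. Qed.

Lemma cdiff_id (p : C) : cdiff id p.
Proof. by exists (fun=> 1), 1; split=> [z|]; rewrite ?mulr1 1?addrC ?subrK //; exact: tends_cst. Qed.

Lemma cdiffD (f g : C -> C) (p : C) : cdiff f p -> cdiff g p -> cdiff (fun z => f z + g z) p.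
Proof.
move=> [Q [d [hf tQ]]] [S [e [hg tS]]]; exists (fun z => Q z + S z), (d + e).
by split=> [z|]; [rewrite [in LHS]hf [in LHS]hg; ring|exact: tendsD].
Qed.

Lemma cdiffM (f g : C -> C) (p : C) : cdiff f p -> cdiff g p -> cdiff (fun z => f z * g z) p.
Proof.
move=> df dg; have tg := cdiff_cont dg.
move: df dg => [Q [d [hf tQ]]] [S [e [hg tS]]].
exists (fun z => Q z * g z + f p * S z), (d * g p + f p * e).
split=> [z|]; first by rewrite [in LHS]hf mulrDl {1}[in LHS]hg; ring.
by apply: tendsD; [exact: tendsM|exact: tendsMl].
Qed.

Lemma cdiff_comp (f g : C -> C) (p : C) : cdiff g p -> cdiff f (g p) -> cdiff (fun z => f (g z)) p.
Proof.
move=> dg df; have tg := cdiff_cont dg.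
move: df dg => [Q [d [hf tQ]]] [S [e [hg tS]]].
exists (fun z => Q (g z) * S z), (d * e); split=> [z|].
  rewrite [in LHS]hf; have -> : g z - g p = (z - p) * S z by rewrite [in LHS]hg addrC addKr.
  ring.
by apply: tendsM => //; apply: tends_comp tQ; apply/tendsC.
Qed.

Lemma cdiffMl (c : C) (f : C -> C) (p : C) : cdiff f p -> cdiff (fun z => c * f z) p.
Proof. by apply: cdiffM; exact: cdiff_cst. Qed.

Lemma cdiffMr (c : C) (f : C -> C) (p : C) : cdiff f p -> cdiff (fun z => f z * c) p.
Proof. by move=> h; apply: cdiffM h _; exact: cdiff_cst. Qed.

Lemma cdiffN (f : C -> C) (p : C) : cdiff f p -> cdiff (fun z => - f z) p.
Proof.
move=> /(cdiffMl (-1)); rewrite (_ : (fun z => -1 * f z) = fun z => - f z) //.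
by apply/funext => z; rewrite mulN1r.
Qed.

Lemma cdiff_sum (I : Type) (r : seq I) (P : pred I) (f : I -> C -> C) (p : C) :
  (forall i, P i -> cdiff (f i) p) -> cdiff (fun z => \sum_(i <- r | P i) f i z) p.
Proof.
move=> h; elim: r => [|i r IH].
  by under eq_fun do rewrite big_nil; exact: cdiff_cst.
under eq_fun do rewrite big_cons.
by case: (boolP (P i)) => // Pi; apply: cdiffD => //; exact: h.
Qed.

Lemma cdiff_prod (I : Type) (r : seq I) (P : pred I) (f : I -> C -> C) (p : C) :
  (forall i, P i -> cdiff (f i) p) -> cdiff (fun z => \prod_(i <- r | P i) f i z) p.
Proof.
move=> h; elim: r => [|i r IH].
  by under eq_fun do rewrite big_nil; exact: cdiff_cst.
under eq_fun do rewrite big_cons.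
by case: (boolP (P i)) => // Pi; apply: cdiffM => //; exact: h.
Qed.

Lemma cdiff_ee (p : C) : cdiff (@ee R) p.
Proof.
apply: (cdiff_quotient (d := ee p * ((2 * pi)%:C * 'i))).
apply: (tends_near (f := fun z => ee p * ((ee (z - p) - 1) / (z - p)))).
  apply/dnbhsC; exists 1 => // z zp _ /=; rewrite mulrA mulrBr mulr1 -eeD.
  by rewrite [p + _]addrC subrK.
have hs : (fun z : C => z - p) @ p^' `=>` (0 : C)^'.
  move=> A /dnbhsC [e e0 h]; apply/dnbhsC; exists e => // z zp pz /=; apply: h.
    by rewrite subr_eq0.
  by rewrite sub0r opprB.
have H : tends (p^') (fun z : C => (ee (z - p) - 1) / (z - p)) ((2 * pi)%:C * 'i).
  by move=> e e0; exact: (hs _ (@ee_diff0 R e e0)).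
exact: tendsMl H.
Qed.

End Differentiability.

(** * The theta series *)

Section LaurentTheta.
Variable R : realType.
Local Notation C := R[i].

(* The exponent m(m-1)/2 as a natural number. *)
Definition tri (m : int) : nat :=
  match m with Posz n => 'C(n, 2) | Negz n => 'C(n.+2, 2) end.

Lemma bin2_mul2 n : (2 * 'C(n, 2) = n * n.-1)%N.
Proof. by elim: n => // n IH; rewrite binS bin1 mulnDr IH; case: n {IH} => //= n; nia. Qed.

Lemma tri2 (m : int) : (2 * tri m)%:Z = m * (m - 1).
Proof. by case: m => n; rewrite /tri bin2_mul2 ?NegzE; [case: n => //= n|]; lia. Qed.

Lemma tri_ge (m : int) : ('C(`|m|%N, 2) <= tri m)%N.
Proof. by case: m => n //; exact: leq_bin2l. Qed.

(** The theta series in the multiplicative variables [q = e(eta)], [w = e(z)], where translation by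
    [eta] becomes multiplication by [q]. *)
Definition tterm (q w : C) (m : int) : C := q ^+ tri m * (- w) ^ m.

End LaurentTheta.

HB.lock Definition T (R : realType) (q w : R[i]) : R[i] := zsum (tterm q w).

Section LaurentThetaTheory.
Variable R : realType.
Local Notation C := R[i].

Lemma TE (q w : C) : T q w = zsum (tterm q w).
Proof. by rewrite T.unlock. Qed.

Lemma theta_termE (eta z : C) m : theta_term eta z m = tterm (ee eta) (ee z) m.
Proof.
rewrite /theta_term eeD eeMz /tterm.
have -> : (m * (m - 1))%:~R / 2%:R = (tri m)%:R :> C.
  by rewrite -tri2 -pmulrn natrM mulrAC divff ?mul1r // pnatr_eq0.
have -> : - ee z = -1 * ee z by rewrite mulN1r.
rewrite eeMn [in RHS]expfzMl.
have -> : (-1) ^+ `|m|%N = (-1) ^ m :> C.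
  by case: m => n //; rewrite NegzE abszN -exprnN -exprVn invrN1.
ring.
Qed.

Lemma thetaE (eta z : C) : theta eta z = T (ee eta) (ee z).
Proof.
rewrite TE /theta /zsum; suff -> : theta_partial eta z = zpart (tterm (ee eta) (ee z)) by [].
by apply/funext => N; apply: eq_bigr => k _; exact: theta_termE.
Qed.

Section Bound.
Variables (x : R).
Hypothesis x01 : 0 <= x < 1.

(** Consecutive terms have ratio [y * x ^+ n], which is at most 1 from some index [J] on; before
    that [y ^+ J] is a bound. *)
Lemma gauss_bound (y : R) : 1 <= y -> exists B : R, forall n, x ^+ 'C(n, 2) * y ^+ n <= B.
Proof.
move=> y1; have y0 : 0 < y by apply: lt_le_trans y1.
have [x0 x1] := andP x01.
have [J hJ] := expr_to0 y x01 (ltr01 : 0 < 1).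
exists (y ^+ J); elim=> [|n IH]; first by rewrite mul1r expr0 exprn_ege1.
case: (leqP n.+1 J) => nJ.
  apply: (@le_trans _ _ (y ^+ n.+1)); last by rewrite ler_weXn2l.
  by rewrite ler_piMl ?exprn_ge0 ?(ltW y0) // exprn_ile1 // (ltW x1).
have -> : x ^+ 'C(n.+1, 2) * y ^+ n.+1 = x ^+ 'C(n, 2) * y ^+ n * (y * x ^+ n).
  by rewrite binS bin1 exprD exprS; ring.
apply: le_trans IH; rewrite ler_piMr ?mulr_ge0 ?exprn_ge0 ?(ltW y0) //.
by apply: le_trans (ltW hJ); rewrite ler_wpM2l ?(ltW y0) // ler_wiXn2l // (ltW x1).
Qed.

Lemma tri_bound (W r : R) : 1 <= W -> 0 < r < 1 ->
  exists2 B : R, 0 <= B & forall m : int, x ^+ tri m * W ^+ `|m|%N <= B * r ^+ `|m|%N.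
Proof.
move=> W1 /andP[r0 r1]; have [x0 x1] := andP x01.
have Wr : 1 <= W / r by rewrite ler_pdivlMr // mul1r (le_trans _ W1) // ltW.
have [B hB] := gauss_bound Wr; exists B.
  by apply: le_trans (hB 0%N); rewrite mulr1 exprn_ge0.
move=> m; rewrite -ler_pdivrMr ?exprn_gt0 // -mulrA -expr_div_n.
apply: le_trans (hB `|m|%N); rewrite ler_wpM2r ?exprn_ge0 ?(le_trans _ Wr) //.
by rewrite ler_wiXn2l ?tri_ge // ltW.
Qed.
End Bound.

Section Fixed.
Variable q : C.
Hypothesis q1 : nm q < 1.
Let x01 : 0 <= nm q < 1. Proof. by rewrite nm_ge0. Qed.

(** Symmetric under inversion, so that [W ^+ |m|] bounds the powers of [w] of either sign. *)
Definition annulus (W : R) (w : C) := W^-1 <= nm w <= W.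

Lemma annulus_exprz (W : R) (w : C) (m : int) : 1 <= W -> annulus W w -> nm w ^ m <= W ^+ `|m|%N.
Proof.
move=> W1 /andP[w1 w2]; have W0 : 0 < W by apply: lt_le_trans W1.
have w0 : 0 < nm w by apply: lt_le_trans w1; rewrite invr_gt0.
case: m => n; first by rewrite /= lerXn2r // nnegrE ltW.
rewrite NegzE abszN -exprnN -exprVn /= lerXn2r // ?nnegrE ?invr_ge0 ?(ltW w0) ?(ltW W0) //.
by rewrite -[W]invrK lef_pV2 // posrE // invr_gt0.
Qed.

Lemma annulusV W w : 1 <= W -> annulus W w -> annulus W w^-1.
Proof.
move=> W1 /andP[w1 w2]; have W0 : 0 < W by apply: lt_le_trans W1.
have w0 : 0 < nm w by apply: lt_le_trans w1; rewrite invr_gt0.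
by rewrite /annulus nmV lef_pV2 ?posrE // w2 /= -[leRHS]invrK lef_pV2 // posrE invr_gt0.
Qed.

Lemma annulus_near (w0 : C) : w0 != 0 -> exists2 W, 1 <= W &
  annulus W w0 /\ (\forall w \near nbhs w0, annulus W w).
Proof.
rewrite -nm_gt0 => h; pose W := 1 + 2 * nm w0 + 2 / nm w0.
have h2 : 0 < 2 / nm w0 by rewrite divr_gt0.
have W1 : 1 <= W by rewrite /W; lra.
have W0 : 0 < W by apply: lt_le_trans W1.
have hW : W^-1 <= nm w0 / 2.
  by rewrite -[leRHS]invrK lef_pV2 ?posrE ?invr_gt0 ?divr_gt0 // invf_div /W; lra.
exists W => //; split; first by apply/andP; split; [lra|rewrite /W; lra].
apply/nbhsC; exists (nm w0 / 2); first by rewrite divr_gt0.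
move=> w hw; have := nmBB w0 w; have := nmBB w w0; rewrite nmBC => a b.
by apply/andP; split; [lra|rewrite /W; lra].
Qed.

Lemma tterm_geo (W r : R) : 1 <= W -> 0 < r < 1 ->
  exists2 B, 0 <= B & forall w, annulus W w -> geo B r (tterm q w).
Proof.
move=> W1 r01; have [B B0 hB] := tri_bound x01 W1 r01; exists B => // w hw m.
rewrite /tterm nmM nmX nmXz nmN; apply: le_trans (hB m).
by rewrite ler_wpM2l ?exprn_ge0 ?nm_ge0 // annulus_exprz.
Qed.

Lemma tterm_geo1 (w : C) (r : R) : w != 0 -> 0 < r < 1 -> exists B, geo B r (tterm q w).
Proof.
move=> w0 r01; have [W W1 [hW _]] := annulus_near w0.
by have [B B0 hB] := tterm_geo W1 r01; exists B; exact: hB.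
Qed.

Lemma half01 : 0 < (2^-1 : R) < 1.
Proof. by apply/andP; split; lra. Qed.
Lemma half01' : 0 <= (2^-1 : R) < 1.
Proof. by apply/andP; split; lra. Qed.

Lemma tri_succ m : (tri (m + 1))%:Z = (tri m)%:Z + m.
Proof. by have := tri2 m; have := tri2 (m + 1); rewrite !PoszM; nia. Qed.

Lemma tterm_mulq (w : C) (m : int) : w != 0 -> q != 0 ->
  tterm q (q * w) m = - w^-1 * tterm q w (m + 1).
Proof.
move=> w0 q0; rewrite /tterm -mulrN expfzMl mulrA [q ^+ tri m]exprnP -expfzDr // -tri_succ -exprnP.
rewrite expfzDr ?oppr_eq0 // expr1z; field.
by rewrite w0.
Qed.

Lemma T_mulq (w : C) : w != 0 -> q != 0 -> T q (q * w) = - w^-1 * T q w.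
Proof.
move=> w0 q0; have [B hB] := tterm_geo1 w0 half01.
rewrite !TE -(zsumZ _ half01' hB) -(zsum_addz 1 half01 (geoZ (- w^-1) hB)).
by congr zsum; apply/funext => m; exact: tterm_mulq.
Qed.

Lemma T_inv (w : C) : w != 0 -> T q w^-1 = - w^-1 * T q w.
Proof.
move=> w0; have [B hB] := tterm_geo1 w0 half01.
rewrite !TE -(zsumZ _ half01' hB) -(zsum_addz 1 half01 (geoZ (- w^-1) hB)) -zsumN.
congr zsum; apply/funext => m; rewrite /tterm.
have -> : tri (- m) = tri (m + 1).
  by have := tri2 (- m); have := tri2 (m + 1); rewrite !PoszM; nia.
have wN : - w != 0 by rewrite oppr_eq0.
by rewrite -invrN exprz_inv opprK expfzDr // expr1z; field.
Qed.

(** The difference quotient of [w ^ m] written without dividing by [w - w0], so that it visibly has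
    a limit at [w0]. *)
Definition dquot (w w0 : C) (m : int) : C :=
  match m with
  | Posz n => \sum_(i < n) w ^+ (n.-1 - i) * w0 ^+ i
  | Negz n => - (w * w0)^-1 * \sum_(i < n.+1) w^-1 ^+ (n - i) * w0^-1 ^+ i
  end.

Lemma dquotE (w w0 : C) m : w != 0 -> w0 != 0 ->
  w ^ m - w0 ^ m = (w - w0) * dquot w w0 m.
Proof.
move=> h h0; case: m => n /=; first by rewrite -!exprnP subrXX.
rewrite NegzE -!exprnN -!exprVn subrXX /= mulrA; congr (_ * _).
by field; rewrite h h0.
Qed.

Lemma sum_geo_bound (W : R) (u v : C) n : 1 <= W -> nm u <= W -> nm v <= W ->
  nm (\sum_(i < n) u ^+ (n.-1 - i) * v ^+ i) <= n%:R * W ^+ n.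
Proof.
move=> W1 hu hv; have W0 : 0 <= W by apply: le_trans W1.
apply: le_trans (nm_sum _ _ _) _.
apply: le_trans (_ : \sum_(i < n) W ^+ n <= _); last by rewrite sumr_const card_ord mulr_natl.
apply: ler_sum => i _; rewrite nmM !nmX.
apply: (@le_trans _ _ (W ^+ (n.-1 - i) * W ^+ i)).
  by rewrite ler_pM ?exprn_ge0 ?nm_ge0 // lerXn2r // nnegrE nm_ge0.
rewrite -exprD ler_weXn2l //; case: n i => [[]//|n] i /=.
by rewrite subnK // -ltnS.
Qed.

Lemma dquot_bound (W : R) (w w0 : C) m : 1 <= W -> annulus W w -> annulus W w0 ->
  nm (dquot w w0 m) <= W ^+ 2 * (2 * W) ^+ `|m|%N.
Proof.
move=> W1 hw hw0; have W0 : 0 <= W by apply: le_trans W1.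
have h n : n%:R * W ^+ n <= (2 * W) ^+ n.
  rewrite exprMn ler_wpM2r ?exprn_ge0 // -natrX ler_nat ltnW //; exact: ltn_expl.
have h2 n : n%:R * W ^+ n <= W ^+ 2 * (2 * W) ^+ n.
  by apply: le_trans (h n) _; rewrite ler_peMl ?exprn_ge0 ?mulr_ge0 // exprn_ege1.
have /andP[w1 w2] := hw; have /andP[w3 w4] := hw0.
have /andP[v1 v2] := annulusV W1 hw; have /andP[v3 v4] := annulusV W1 hw0.
case: m => n /=; first by apply: le_trans (h2 n); exact: (sum_geo_bound _ W1 w2 w4).
rewrite nmM nmN invfM nmM; apply: ler_pM; rewrite ?mulr_ge0 ?nm_ge0 //.
  by rewrite expr2 ler_pM ?nm_ge0.
by apply: le_trans (h _); exact: (sum_geo_bound _ W1 v2 v4).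
Qed.

Lemma tends_dquot (w0 : C) m : w0 != 0 -> exists d, tends (w0^') (fun w => dquot w w0 m) d.
Proof.
move=> h0; have tid : tends (w0^') id w0 := tends_mono (@dnbhs_sub _ w0) (tends_id w0).
case: m => n /=; eexists.
  apply: tends_sum => i _; apply: tendsM (tends_cst _); exact: tendsX tid.
apply: tendsM.
  by apply: tendsN; apply: tendsV; last (apply: tendsM tid (tends_cst w0)); rewrite mulf_neq0.
by apply: tends_sum => i _; apply: tendsM (tends_cst _); apply: tendsX; exact: tendsV tid.
Qed.

(** Termwise differentiation: Tannery's theorem is applied to the difference quotients. On an
    annulus these grow at most like [(2 * W) ^+ |m|], which the quadratic exponent of [q]
    absorbs. *)
Lemma cdiff_T (w0 : C) : w0 != 0 -> cdiff (T q) w0.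
Proof.
move=> h0; have [W W1 [hW0 hW]] := annulus_near h0.
have [B0 hB0] := tterm_geo1 h0 half01.
have W2 : 1 <= 2 * W by lra.
have Wp : 0 <= W by lra.
have [B Bp hB] := tri_bound x01 W2 half01.
have w0N : - w0 != 0 by rewrite oppr_eq0.
pose G w m := q ^+ tri m * ((-1) ^ m * dquot w w0 m).
have geoG w : annulus W w -> geo (W ^+ 2 * B) 2^-1 (G w).
  move=> hw m; rewrite /G !nmM nmX nmXz nmN nm1 exp1rz mul1r -mulrA.
  apply: le_trans (_ : nm q ^+ tri m * (W ^+ 2 * (2 * W) ^+ `|m|%N) <= _).
    by rewrite ler_wpM2l ?exprn_ge0 ?nm_ge0 // dquot_bound.
  by rewrite mulrCA ler_wpM2l ?exprn_ge0.
have [d hd] := choice (fun m => tends_dquot m h0).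
pose G0 m := q ^+ tri m * ((-1) ^ m * d m).
have tG m : tends (w0^') (G ^~ m) (G0 m) by apply: tendsMl; apply: tendsMl; exact: hd.
have nearW : \forall w \near w0^', annulus W w := dnbhs_sub hW.
have geoG0 : geo (W ^+ 2 * B) 2^-1 G0.
  move=> m; apply: (tends_nm_le _ (tG m)); apply: filterS nearW => w hw; exact: geoG.
apply: (cdiff_quotient (d := zsum G0)).
have nearG : w0^' [set w | geo (W ^+ 2 * B) 2^-1 (G w)] by exact: filterS nearW.
apply: tends_near (tannery half01' nearG geoG0 tG).
have hne : \forall w \near w0^', w != w0 /\ annulus W w.
  apply: filterI nearW; apply/dnbhsC; exists 1 => // w *; exact.
apply: filterS hne => w [ww0 hw] /=.
have hw' : w != 0.
  by rewrite -nm_gt0; case/andP: hw => + _; apply: lt_le_trans; rewrite invr_gt0; lra.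
have [B1 hB1] := tterm_geo1 hw' half01.
apply: (mulIf (_ : w - w0 != 0)); first by rewrite subr_eq0.
rewrite divfK ?subr_eq0 // mulrC -(zsumZ _ half01' (geoG w hw)) !TE.
have hm : 0 <= B1 /\ 0 <= B0 by split; [exact: geo_ge0 hB1|exact: geo_ge0 hB0].
have gB0 : geo (B1 + B0) 2^-1 (tterm q w0).
  move=> m; apply: le_trans (hB0 m) _; rewrite ler_wpM2r ?exprn_ge0 //; lra.
have gB1 : geo (B1 + B0) 2^-1 (tterm q w).
  move=> m; apply: le_trans (hB1 m) _; rewrite ler_wpM2r ?exprn_ge0 //; lra.
have := zsum_lin (-1) half01' gB0 gB1; rewrite mulN1r addrC => <-.
congr zsum; apply/funext => m; rewrite /G /tterm.
rewrite -(mulN1r w) -(mulN1r w0) !expfzMl.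
transitivity (q ^+ tri m * ((-1) ^ m * (w ^ m - w0 ^ m))); last by ring.
by rewrite dquotE //; ring.
Qed.

End Fixed.
End LaurentThetaTheory.
Global Opaque ee zsum.

(** * The triple product *)

Section ProductBounds.
Variable R : realType.
Local Notation C := R[i].

(** Weierstrass' product inequality; the upper bound is carried along because the induction for the
    lower one uses it. *)
Lemma prod1B_ge (y : nat -> R) m k : (forall i, (m <= i)%N -> 0 <= y i <= 1) ->
  1 - \sum_(m <= i < m + k) y i <= \prod_(m <= i < m + k) (1 - y i) <= 1.
Proof.
move=> h; elim: k => [|k IH]; first by rewrite addn0 !big_geq // subr0 lexx.
rewrite addnS !big_nat_recr ?leq_addr //=.
have /andP[y0 y1] := h (m + k)%N (leq_addr _ _).
have p0 : 0 <= \prod_(m <= i < m + k) (1 - y i).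
  rewrite big_nat_cond; apply: prodr_ge0 => i /andP[/andP[mi _] _].
  by rewrite subr_ge0; have /andP[] := h i mi.
move: IH; set S := \sum_(_ <= _ < _) _; set P := \prod_(_ <= _ < _) _ in p0 *.
by move=> /andP[h1 h2]; apply/andP; split; nra.
Qed.

Lemma geo_sum_le (D r : R) m k : 0 <= D -> 0 <= r < 1 ->
  \sum_(m <= i < m + k) D * r ^+ i <= D * r ^+ m / (1 - r).
Proof.
move=> D0 /andP[r0 r1]; have r1' : 0 < 1 - r by rewrite subr_gt0.
suff -> : \sum_(m <= i < m + k) D * r ^+ i = D * r ^+ m / (1 - r) * (1 - r ^+ k).
  rewrite ler_piMr ?divr_ge0 ?mulr_ge0 ?exprn_ge0 ?(ltW r1') //.
  by rewrite gerBl exprn_ge0.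
elim: k => [|k IH]; first by rewrite addn0 big_geq // expr0 subrr mulr0.
rewrite addnS big_nat_recr ?leq_addr //= IH exprD exprS; field.
by rewrite gt_eqF.
Qed.

(** From [1 + y <= exp y]. The bound depends on [D] and [r] alone, not on the sequence. *)
Lemma prod_upper (D r : R) : 0 <= D -> 0 <= r < 1 ->
  exists2 U : R, 0 < U & forall x : nat -> C, (forall i, nm (x i) <= D * r ^+ i) ->
    forall j, nm (\prod_(i < j) (1 - x i)) <= U.
Proof.
move=> D0 r01; exists (expR (D * r ^+ 0 / (1 - r))); first exact: expR_gt0.
move=> x hx j; rewrite nm_prod.
apply: (@le_trans _ _ (expR (\sum_(0 <= i < 0 + j) D * r ^+ i))); last first.
  by rewrite ler_expR geo_sum_le.
rewrite add0n big_mkord expR_sum; apply: ler_prod => i _; rewrite nm_ge0 /=.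
apply: le_trans (nmB _ _) _; rewrite nm1.
apply: le_trans (expR_ge1Dx _); rewrite lerD2l; exact: hx.
Qed.

(** The first [n0] factors are bounded below by [d]; beyond [n0] the geometric tail sums to at most
    1/2 and Weierstrass' inequality leaves at least 1/2. The constant is uniform in [x], which
    allows a varying argument in [T_near1]. *)
Lemma prod_lower (D r : R) (d : nat -> R) : 0 <= D -> 0 <= r < 1 -> (forall i, 0 < d i) ->
  exists2 c : R, 0 < c & forall x : nat -> C, (forall i, nm (x i) <= D * r ^+ i) ->
    (forall i, d i <= nm (1 - x i)) ->
    forall j, c <= nm (\prod_(i < j) (1 - x i)).
Proof.
move=> D0 r01 d0; have [r0 r1] := andP r01; have r1' : 0 < 1 - r by rewrite subr_gt0.
have h2 : 0 < 2^-1 * (1 - r) by rewrite mulr_gt0 ?invr_gt0.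
have [n0 hn0] := expr_to0 D r01 h2.
pose e i := Num.min 1 (d i); have e0 i : 0 < e i by rewrite lt_min ltr01 d0.
have e1 i : e i <= 1 by rewrite ge_min lexx.
have p0 j : 0 < \prod_(i < j) e i by apply: prodr_gt0 => i _.
exists (2^-1 * \prod_(i < n0) e i); first by rewrite mulr_gt0 ?invr_gt0.
move=> x hx hd j; rewrite nm_prod.
have mono j' k : \prod_(i < j' + k) e i <= \prod_(i < j') e i.
  elim: k => [|k IH]; first by rewrite addn0.
  rewrite addnS big_ord_recr /=; by apply: le_trans IH; rewrite ler_piMr // (ltW (p0 _)).
have elow j' : \prod_(i < j') e i <= \prod_(i < j') nm (1 - x i).
  apply: ler_prod => i _; rewrite (ltW (e0 _)) /=; apply: le_trans (hd i).
  by rewrite ge_min lexx orbT.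
case: (leqP j n0) => hj.
  apply: le_trans (elow j); apply: (@le_trans _ _ (\prod_(i < n0) e i)).
    by rewrite ler_piMl ?(ltW (p0 _)) // invf_le1 // ler1n.
  by rewrite -(subnKC hj); exact: mono.
rewrite -(big_mkord xpredT (fun i => nm (1 - x i))) (big_cat_nat _ (n := n0)) ?(ltnW hj) //=.
rewrite mulrC; apply: ler_pM; rewrite ?invr_ge0 ?(ltW (p0 _)) //.
  by rewrite big_mkord; exact: elow.
have hsmall i : (n0 <= i)%N -> D * r ^+ i <= 2^-1.
  move=> hi; apply: (@le_trans _ _ (D * r ^+ n0)).
    by rewrite ler_wpM2l // ler_wiXn2l // ltW.
  apply: le_trans (ltW hn0) _; rewrite ler_piMr ?invr_ge0 //; lra.
rewrite -(subnKC (ltnW hj)).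
have := @prod1B_ge (fun i => D * r ^+ i) n0 (j - n0).
move=> /(_ _)/andP[|h1 _].
  move=> i hi; rewrite mulr_ge0 ?exprn_ge0 //=; apply: le_trans (hsmall _ hi) _.
  by rewrite invf_le1 // ler1n.
apply: (@le_trans _ _ (\prod_(n0 <= i < n0 + (j - n0)) (1 - D * r ^+ i))).
  apply: le_trans h1; have := geo_sum_le n0 (j - n0) D0 r01.
  have : D * r ^+ n0 / (1 - r) <= 2^-1 by rewrite ler_pdivrMr // ltW.
  lra.
rewrite big_nat_cond [leRHS]big_nat_cond; apply: ler_prod => i /andP[/andP[hi _] _].
have := hsmall i hi; have := nmBB 1 (x i); rewrite nm1; have := hx i => a b c.
rewrite subr_ge0 (le_trans c) ?invf_le1 ?ler1n //=.
by apply: le_trans b; rewrite lerD2l lerN2.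
Qed.

End ProductBounds.

Section TripleProduct.
Variable R : realType.
Local Notation C := R[i].
Variable q : C.
Hypothesis q1 : nm q < 1.
Hypothesis q0 : q != 0.
Let x01 : 0 <= nm q < 1. Proof. by rewrite nm_ge0. Qed.

Definition qpoch (N : nat) : C := \prod_(i < N) (1 - q ^+ i.+1).

Definition Pprod (N : nat) (w : C) : C :=
  \prod_(m < N) ((1 - q ^+ m * w) * (1 - q ^+ m.+1 / w)).

Lemma qpow_neq1 n : 1 - q ^+ n.+1 != 0.
Proof.
apply/eqP => /eqP; rewrite subr_eq0 => /eqP/(congr1 (@nm R)).
rewrite nm1 nmX => h; have : nm q ^+ n.+1 < 1 by rewrite exprn_ilt1 ?nm_ge0.
by rewrite -h ltxx.
Qed.

Lemma qpoch_neq0 N : qpoch N != 0.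
Proof. by apply/prodf_neq0 => i _; exact: qpow_neq1. Qed.

Lemma qpochS N : qpoch N.+1 = qpoch N * (1 - q ^+ N.+1).
Proof. by rewrite /qpoch big_ord_recr. Qed.

Definition qbin (n k : nat) : C := qpoch n / (qpoch k * qpoch (n - k)).

Lemma qbin0 n : qbin n 0 = 1.
Proof. by rewrite /qbin subn0 /qpoch big_ord0 mul1r divff ?qpoch_neq0. Qed.

Lemma qbinn n : qbin n n = 1.
Proof. by rewrite /qbin subnn {3}/qpoch big_ord0 mulr1 divff ?qpoch_neq0. Qed.

Lemma qbinS n k : (k < n)%N -> qbin n.+1 k.+1 = qbin n k.+1 + q ^+ (n - k) * qbin n k.
Proof.
move=> kn; rewrite /qbin subSS.
have -> : (n - k = (n - k.+1).+1)%N by lia.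
have := qpoch_neq0 k; have := qpoch_neq0 (n - k.+1); have := qpow_neq1 k; have := qpow_neq1 (n - k.+1).
rewrite !qpochS => h1 h2 h3 h4.
have -> : q ^+ n.+1 = q ^+ k.+1 * q ^+ (n - k.+1).+1 by rewrite -exprD; congr (_ ^+ _); lia.
by field; rewrite h1 h2 h3 h4.
Qed.

Lemma qbinomial n (y : C) :
  \prod_(j < n) (1 - q ^+ j * y) = \sum_(k < n.+1) qbin n k * q ^+ 'C(k, 2) * (- y) ^+ k.
Proof.
elim: n => [|n IH].
  by rewrite big_ord0 big_ord_recr big_ord0 /= qbin0 !mulr1 add0r.
rewrite big_ord_recr /= IH mulrBr mulr1.
rewrite [RHS]big_ord_recl [in RHS]big_ord_recr /=.
rewrite [X in X - _]big_ord_recl [X in _ - X * _]big_ord_recr /= mulrDl mulr_suml.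
rewrite !qbin0 !qbinn !mulr1.
have hb k : bump 0 k = k.+1 by [].
have -> : \sum_(i < n) qbin n.+1 (bump 0 i) * q ^+ 'C(bump 0 i, 2) * (- y) ^+ bump 0 i =
  \sum_(i < n) qbin n (bump 0 i) * q ^+ 'C(bump 0 i, 2) * (- y) ^+ bump 0 i -
  \sum_(i < n) qbin n i * q ^+ 'C(i, 2) * (- y) ^+ i * (q ^+ n * y).
  rewrite -sumrB; apply: eq_bigr => i _; rewrite !hb qbinS // binS bin1.
  have -> : q ^+ n = q ^+ (n - i) * q ^+ i by rewrite -exprD subnK // ltnW.
  rewrite exprS exprD; ring.
by rewrite hb binS bin1 exprD exprS; ring.
Qed.

(** A finite form of the triple product: the q-binomial theorem with [2 * N] factors at
    [y = w / q ^+ N]. *)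
Lemma Pprod_sum N (w : C) : w != 0 ->
  Pprod N w = \sum_(k < (2 * N).+1) qbin (2 * N) k * tterm q w (k%:Z - N%:Z).
Proof.
(* [c] is the product of [- w / q ^+ j] over [1 <= j <= N]; these turn [1 - q ^+ j / w] into
   [1 - w / q ^+ j]. *)
move=> w0; pose c : C := (- w) ^+ N / q ^+ 'C(N.+1, 2).
have qN n : q ^+ n != 0 by rewrite expf_neq0.
have wN : - w != 0 by rewrite oppr_eq0.
have c0 : c != 0 by rewrite mulf_neq0 ?invr_eq0 ?expf_neq0.
apply: (mulfI c0); rewrite mulr_sumr.
transitivity (\prod_(j < 2 * N) (1 - q ^+ j * (w / q ^+ N))).
  rewrite mul2n -addnn big_split_ord /= /Pprod big_split /=.
  rewrite mulrCA mulrC; congr (_ * _); last first.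
    apply: eq_bigr => j _; congr (1 - _); rewrite exprD; field; exact: qN.
  rewrite /c; elim: (N) => [|n IH]; first by rewrite !big_ord0 expr0 divff ?mulr1.
  rewrite big_ord_recr [RHS]big_ord_recl /= expr0 mul1r.
  transitivity ((1 - w / q ^+ n.+1) * ((- w) ^+ n / q ^+ 'C(n.+1, 2) * \prod_(i < n) (1 - q ^+ i.+1 / w))).
    have -> : 'C(n.+2, 2) = (n.+1 + 'C(n.+1, 2))%N by rewrite (binS n.+1 1) bin1 addnC.
    rewrite exprD exprS; field; by rewrite w0 !qN.
  rewrite IH; congr (_ * _); apply: eq_bigr => i _; rewrite /bump /= !add1n; congr (1 - _).
  by rewrite !exprS; field; rewrite qN q0.
rewrite qbinomial; apply: eq_bigr => k _; rewrite mulrCA -mulrA; congr (_ * _).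
rewrite /tterm /c -mulNr expr_div_n -exprM.
have -> : (- w) ^ (k%:Z - N%:Z) = (- w) ^+ k / (- w) ^+ N by rewrite expfzDr // exprnN.
have h : q ^+ 'C(k, 2) * q ^+ 'C(N.+1, 2) = q ^+ tri (k%:Z - N%:Z) * q ^+ (N * k).
  rewrite -!exprD; congr (_ ^+ _).
  have := bin2_mul2 k; have := bin2_mul2 N.+1; have := tri2 (k%:Z - N%:Z) => h1 h2 h3.
  have h4 : ((2 * 'C(k, 2))%:Z = k%:Z * (k%:Z - 1))%R by rewrite h3; case: (nat_of_ord k) => // n; lia.
  have h5 : ((2 * 'C(N.+1, 2))%:Z = (N%:Z + 1) * N%:Z)%R by rewrite h2 /=; lia.
  move: h1 h4 h5; rewrite !PoszM; nia.
have -> : q ^+ 'C(k, 2) * ((- w) ^+ k / q ^+ (N * k)) =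
  (q ^+ 'C(k, 2) * q ^+ 'C(N.+1, 2)) * ((- w) ^+ k / q ^+ (N * k)) / q ^+ 'C(N.+1, 2).
  by field; rewrite !qN.
rewrite h; field; by rewrite !qN expf_neq0.
Qed.

Lemma qpoch_bounds : exists c U : R, [/\ 0 < c, 0 < U & forall N, c <= nm (qpoch N) <= U].
Proof.
have hx i : nm (q ^+ i.+1) <= 1 * nm q ^+ i.
  by rewrite mul1r nmX exprS ler_piMl ?exprn_ge0 ?nm_ge0 // ltW.
have [U U0 hU] := prod_upper (ler01 : 0 <= 1) x01.
have d0 i : 0 < nm (1 - q ^+ i.+1) by rewrite nm_gt0 qpow_neq1.
have [c c0 hc] := prod_lower (ler01 : 0 <= 1) x01 d0.
exists c, U; split=> // N; rewrite (hU (fun i => q ^+ i.+1)) // andbT.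
by apply: (hc (fun i => q ^+ i.+1)).
Qed.

Lemma qpoch_ratio (l : nat) (g : nat -> nat) : (exists n0, forall n, (n <= g n + n0)%N) ->
  tends \oo (fun n => \prod_(i < l) (1 - q ^+ (g n + i).+1)) 1.
Proof.
move=> [n0 hg]; rewrite [X in tends _ _ X](_ : 1 = \prod_(i < l) (1 - 0)); last by rewrite subr0 big1.
apply: tends_prod => i _; apply: tendsB; first exact: tends_cst.
have qq : 0 < nm q by rewrite nm_gt0.
apply: (tends_squeeze _ (tendsn_mul_expr0 (nm q ^- n0) x01)).
apply: filterE => n /=; rewrite sub0r nmN nmX mulrC ler_pdivlMr ?exprn_gt0 // -exprD.
by rewrite ler_wiXn2l ?nm_ge0 ?(ltW q1) //; have := hg n; lia.
Qed.

Lemma qpoch_add N l : qpoch (N + l) = qpoch N * \prod_(i < l) (1 - q ^+ (N + i).+1).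
Proof. by rewrite /qpoch big_split_ord. Qed.

(** Normalised by the inverse of the central q-binomial coefficient, so that each Laurent
    coefficient tends to that of theta. *)
Definition Qprod N w := qpoch N ^+ 2 / qpoch (2 * N) * Pprod N w.

Lemma triple_product (w : C) : w != 0 -> tends \oo (Qprod ^~ w) (T q w).
Proof.
move=> w0; have [c [U [c0 U0 hcU]]] := qpoch_bounds.
have [B hB] := tterm_geo1 q1 w0 (half01 R).
have B0 := geo_ge0 hB.
(* The ratio of a q-binomial coefficient to the central one, extended by 0 outside the window:
   bounded uniformly, and tending to 1 for each [m]. *)
pose b N (m : int) : C := if (`|m| <= N)%N
  then qpoch N ^+ 2 / (qpoch (N - `|m|) * qpoch (N + `|m|)) else 0.
have hb N m : nm (b N m) <= 1 + U ^+ 2 / c ^+ 2.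
  rewrite /b; case: ifP => _; last by rewrite nm0 addr_ge0 ?divr_ge0 ?exprn_ge0 // ltW.
  rewrite nmM nmV nmM nmX; apply: ler_wpDl => //.
  have /andP[a1 a2] := hcU N; have /andP[b1 b2] := hcU (N - `|m|)%N; have /andP[d1 d2] := hcU (N + `|m|)%N.
  apply: ler_pM; rewrite ?exprn_ge0 ?invr_ge0 ?mulr_ge0 ?nm_ge0 //.
    by rewrite lerXn2r // ?nnegrE ?nm_ge0 ?(ltW U0).
  rewrite lef_pV2 ?posrE ?exprn_gt0 ?mulr_gt0 ?(lt_le_trans c0) //.
  by rewrite expr2 ler_pM // ltW.
have hgeo : geo ((1 + U ^+ 2 / c ^+ 2) * B) 2^-1 (tterm q w).
  move=> m; apply: le_trans (hB m) _; rewrite ler_wpM2r ?exprn_ge0 //.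
  by rewrite ler_peMl // lerDl divr_ge0 ?exprn_ge0 // ltW.
have hgeo' N : geo ((1 + U ^+ 2 / c ^+ 2) * B) 2^-1 (fun m => b N m * tterm q w m).
  by move=> m; rewrite nmM -mulrA ler_pM ?nm_ge0 //.
have tb m : tends \oo (b ^~ m) 1.
  pose l := `|m|%N.
  have t1 := @qpoch_ratio l (fun n => n) _; have t2 := @qpoch_ratio l (fun n => n - l)%N _.
  have t3 : tends \oo (fun n => (\prod_(i < l) (1 - q ^+ (n - l + i).+1)) /
                                (\prod_(i < l) (1 - q ^+ (n + i).+1))) 1.
    rewrite -[X in tends _ _ X](divr1 1); apply: tendsM; first by apply: t2; exists l => n; lia.
    by apply: tendsV; [exact: oner_neq0|apply: t1; exists 0%N => n; lia].
  apply: tends_near t3; exists l => // N /= lN; rewrite /b -/l lN.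
  have e2 := qpoch_add N l; have e1 : qpoch N = _ := etrans (congr1 qpoch (esym (subnK lN))) (qpoch_add (N - l) l).
  have h1 := qpoch_neq0 (N - l); have h2 := qpoch_neq0 (N + l); have h3 := qpoch_neq0 N.
  move: h2 h3; rewrite e2 e1 !mulf_eq0 !negb_or => /andP[_ h5] /andP[_ h6].
  by field; rewrite h1 h5 h6.
rewrite TE; apply: (tends_ext (f := fun N => zsum (fun m => b N m * tterm q w m))); last first.
  apply: (tannery (half01' R) _ hgeo); first by apply: filterE => N; exact: hgeo'.
  move=> m; rewrite -[X in tends _ _ X]mul1r; apply: tendsM (tb m) (tends_cst _).
move=> N; apply: zsumE; apply: (tends_near (f := fun=> Qprod N w)); last exact: tends_cst.
exists N => // M /= NM; rewrite -(subnKC NM); elim: (M - N)%N => [|k IH]; last first.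
  rewrite addnS zpartS -IH /b !abszN !absz_nat !ifF ?mul0r ?addr0 //; lia.
rewrite addn0 /zpart /Qprod Pprod_sum // mulr_sumr; apply: eq_bigr => k _.
rewrite mulrA; congr (_ * _); rewrite /b /qbin.
have := ltn_ord k => hk; have -> : (`|(k%:Z - N%:Z)%R| <= N)%N by lia.
have -> : qpoch (N - `|(k%:Z - N%:Z)%R|) * qpoch (N + `|(k%:Z - N%:Z)%R|) = qpoch k * qpoch (2 * N - k).
  case: (leqP k N) => kN.
    by congr (qpoch _ * qpoch _); lia.
  by rewrite mulrC; congr (qpoch _ * qpoch _); lia.
by field; rewrite !qpoch_neq0.
Qed.

(** If [w] is no power of [q], no factor of the product vanishes, and the normalised partial
    products stay away from 0. *)
Lemma T_eq0 (w : C) : w != 0 -> T q w = 0 -> exists m : int, w = q ^ m.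
Proof.
move=> w0 hT; apply: contrapT => hw.
have [c [U [c0 U0 hcU]]] := qpoch_bounds.
have d1 i : 0 < nm (1 - q ^+ i * w).
  rewrite nm_gt0 subr_eq0; apply/eqP => h; apply: hw; exists (- i%:Z).
  rewrite -exprnN; apply: (mulfI (expf_neq0 i q0)).
  by rewrite -h divff // expf_neq0.
have d2 i : 0 < nm (1 - q ^+ i.+1 / w).
  rewrite nm_gt0 subr_eq0; apply/eqP => h; apply: hw; exists i.+1%:Z.
  by rewrite -exprnP; apply: (mulIf (_ : w^-1 != 0)); rewrite ?invr_eq0 // -h divff.
have [c1 c10 h1] := prod_lower (nm_ge0 w) x01 d1.
have D2 : 0 <= nm q / nm w by rewrite divr_ge0 ?nm_ge0.
have [c2 c20 h2] := prod_lower D2 x01 d2.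
have hP N : c ^+ 2 / U * (c1 * c2) <= nm (Qprod N w).
  rewrite /Qprod /Pprod big_split /= nmM [nm (_ / _)]nmM nmX nmV [nm (\prod_(_ < _) _ * _)]nmM.
  have /andP[a1 a2] := hcU N; have /andP[b1 b2] := hcU (2 * N)%N.
  apply: ler_pM; rewrite ?mulr_ge0 ?invr_ge0 ?exprn_ge0 ?(ltW c0) ?(ltW U0) ?(ltW c10) ?(ltW c20) //.
    apply: ler_pM; rewrite ?exprn_ge0 ?invr_ge0 ?(ltW c0) ?(ltW U0) //.
      by rewrite lerXn2r // ?nnegrE ?nm_ge0 ?(ltW c0).
    by rewrite lef_pV2 // posrE // (lt_le_trans c0).
  apply: ler_pM; rewrite ?(ltW c10) ?(ltW c20) //.
    by apply: (h1 (fun i => q ^+ i * w)) => // i; rewrite nmM nmX mulrC.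
  apply: (h2 (fun i => q ^+ i.+1 / w)) => // i.
  by rewrite nmM nmV nmX exprS mulrAC.
have h3 : 0 < c ^+ 2 / U * (c1 * c2) by rewrite !mulr_gt0 ?invr_gt0 ?exprn_gt0.
have := tends_nm_gt (triple_product w0) (c := 0).
have h4 := triple_product w0; rewrite hT in h4.
have h5 : \oo [set N | nm (Qprod N w) < c ^+ 2 / U * (c1 * c2)].
  by apply: (tends_nm_lt h4); rewrite nm0.
have [N /= hN] := filter_ex h5.
by have := le_lt_trans (hP N) hN; rewrite ltxx.
Qed.

Lemma T_qexp (m : int) : T q (q ^ m) = 0.
Proof.
have h1 : T q 1 = 0.
  have h := triple_product (oner_neq0 C); apply: (tends_unique _ h).
  apply: (tends_near (f := fun=> 0)); last exact: tends_cst.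
  exists 1%N => // -[//|N] _ /=.
  by rewrite /Qprod /Pprod big_ord_recl /= expr0 mulr1 subrr !mul0r mulr0.
case: m => n.
  elim: n => [|n IH]; first by rewrite expr0z.
  by rewrite exprSz T_mulq ?expfz_neq0 // IH mulr0.
rewrite NegzE; elim: n.+1 => [|k IH]; first by rewrite oppr0 expr0z.
have h : T q (q * q ^ (- k.+1%:Z)) = 0.
  suff -> : q * q ^ (- k.+1%:Z) = q ^ (- k%:Z) by [].
  have -> : - k%:Z = 1 - k.+1%:Z by lia.
  by rewrite expfzDr // expr1z.
have hq : q ^ (- k.+1%:Z) != 0 by rewrite expfz_neq0.
move: h; rewrite (T_mulq q1 hq q0) => /eqP.
by rewrite mulf_eq0 oppr_eq0 invr_eq0 (negPf (expfz_neq0 _ q0)) /= => /eqP.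
Qed.

(** With the factor [1 - w] set apart, the rest of the product is bounded below uniformly near 1.
    This is what makes the zero simple. *)
Lemma T_near1 : exists2 c : R, 0 < c & \forall w \near nbhs (1 : C), c * nm (1 - w) <= nm (T q w).
Proof.
have [c [U [c0 U0 hcU]]] := qpoch_bounds.
have [qx0 qx1] := andP x01.
(* As [nm q = 1 - 2 * e], every [v] with [nm v <= 1 + e] satisfies [nm (q ^+ i.+1 * v) <= 1 - e]. *)
have [e he] : exists e, e = (1 - nm q) / 2 by eexists.
have e0 : 0 < e by lra.
have D0 : 0 <= 2 :> R by [].
have [c1 c10 h1] := prod_lower D0 x01 (fun _ : nat => e0).
exists (c ^+ 2 / U * (c1 * c1)); first by rewrite !mulr_gt0 ?invr_gt0 ?exprn_gt0.
apply/nbhsC; exists (e / 2); first by rewrite divr_gt0.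
move=> w hw; have e1 : e <= 2^-1 by lra.
have w1 : 1 - e / 2 < nm w by have := nmBB 1 w; rewrite nm1; lra.
have w2 : nm w < 1 + e / 2 by have := nmBB w 1; rewrite nmBC nm1; lra.
have wp : 0 < nm w by lra.
have w0 : w != 0 by rewrite -nm_gt0.
have small i (v : C) : nm v <= 1 + e -> e <= nm (1 - q ^+ i.+1 * v).
  move=> hv; have := nmBB 1 (q ^+ i.+1 * v); rewrite nm1 nmM nmX exprS.
  have : nm q ^+ i <= 1 by rewrite exprn_ile1 // ltW.
  have : 0 <= nm q ^+ i by rewrite exprn_ge0.
  have := nm_ge0 v; set X := nm q ^+ i => a b d.
  have : 0 <= e * (1 - nm q) by rewrite mulr_ge0 // ?subr_ge0 ltW.
  have : nm q * X * nm v <= nm q * (1 + e).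
    by rewrite -mulrA ler_wpM2l //; apply: le_trans hv; rewrite ler_piMl.
  lra.
have hv : nm w^-1 <= 1 + e.
  rewrite nmV -[leRHS]invrK lef_pV2 ?posrE ?invr_gt0 //; last by lra.
  apply: le_trans (ltW w1); rewrite -div1r ler_pdivrMr; nra.
have hgen (v : C) i : nm v <= 1 + e -> nm (q ^+ i.+1 * v) <= 2 * nm q ^+ i.
  move=> hv'; rewrite nmM nmX exprS mulrC mulrA ler_wpM2r ?exprn_ge0 //.
  have := nm_ge0 v; nra.
rewrite leNgt; apply/negP => hlt.
have h5 : \oo [set N | nm (Qprod N w) < c ^+ 2 / U * (c1 * c1) * nm (1 - w)].
  exact: (tends_nm_lt (triple_product w0) hlt).
have h6 : \oo [set N | (1 <= N)%N] by exists 1%N.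
have [N [/= h7 h8]] := filter_ex (filterI h5 h6).
case: N h7 h8 => // N h7 _; move: h7; apply/negP; rewrite -leNgt.
rewrite /Qprod /Pprod big_split /= big_ord_recl /= expr0 mul1r nmM [nm (_ / _)]nmM nmX nmV
  [nm (_ * _ * _)]nmM [nm ((1 - w) * _)]nmM.
have /andP[a1 a2] := hcU N.+1; have /andP[b1 b2] := hcU (2 * N.+1)%N.
rewrite -[leLHS]mulrA; apply: ler_pM; rewrite ?mulr_ge0 ?invr_ge0 ?exprn_ge0 ?nm_ge0 ?(ltW c0) ?(ltW U0) ?(ltW c10) //.
  apply: ler_pM; rewrite ?exprn_ge0 ?invr_ge0 ?(ltW c0) ?(ltW U0) //.
    by rewrite lerXn2r // ?nnegrE ?nm_ge0 ?(ltW c0).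
  by rewrite lef_pV2 // posrE // (lt_le_trans c0).
have hw1 : nm w <= 1 + e by lra.
have k1 := h1 (fun i => q ^+ i.+1 * w) (fun i => hgen w i hw1) (fun i => small i w hw1) N.
have k2 := h1 (fun i => q ^+ i.+1 / w) (fun i => hgen w^-1 i hv) (fun i => small i w^-1 hv) N.+1.
rewrite mulrC -[leRHS]mulrA ler_wpM2l ?nm_ge0 //.
by apply: ler_pM; rewrite ?(ltW c10).
Qed.

End TripleProduct.

(** * Product and bilinear identities for theta *)

Section ThetaProducts.
Variable R : realType.
Local Notation C := R[i].

Lemma prod_1Bprim (n : nat) (om y : C) : n.-primitive_root om ->
  \prod_(m < n) (1 - om ^+ m * y) = 1 - y ^+ n.
Proof.
move=> hom; have n0 := prim_order_gt0 hom.
have [->|y0] := eqVneq y 0.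
  by rewrite expr0n gtn_eqF // subr0 big1 // => i _; rewrite mulr0 subr0.
have := congr1 (horner^~ y^-1) (factor_Xn_sub_1 hom); rewrite horner_prod hornerD hornerN hornerC hornerXn.
rewrite big_mkord => h.
have -> : 1 - y ^+ n = y ^+ n * (y^-1 ^+ n - 1).
  by rewrite mulrBr mulr1 -exprMn divff // expr1n.
have -> : y ^+ n = \prod_(i < n) y by rewrite prodr_const card_ord.
rewrite -h -big_split /=; apply: eq_bigr => i _.
by rewrite hornerD hornerN hornerX hornerC mulrBr divff // mulrC.
Qed.

Lemma primitive_root_neq0 (n : nat) (om : C) : n.-primitive_root om -> om != 0.
Proof.
move=> h; apply/eqP => om0; have := prim_expr_order h.
by rewrite om0 expr0n gtn_eqF ?(prim_order_gt0 h) // => /eqP; rewrite eq_sym oner_eq0.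
Qed.

Lemma prim_rootV (n : nat) (om : C) : n.-primitive_root om -> n.-primitive_root om^-1.
Proof.
move=> h; have n0 := prim_order_gt0 h; rewrite -(prednK n0) in h *.
have -> : om^-1 = om ^+ n.-1.
  have om0 := primitive_root_neq0 h.
  by apply: (mulfI om0); rewrite divff // -exprS prim_expr_order.
by rewrite prim_root_exp_coprime // coprimenS.
Qed.

Lemma big_ord_mul (n N : nat) (f : nat -> C) :
  \prod_(j < n * N) f j = \prod_(m < N) \prod_(r < n) f (n * m + r)%N.
Proof.
elim: N => [|N IH]; first by rewrite muln0 !big_ord0.
rewrite big_ord_recr /= -IH mulnS addnC big_split_ord /=.
by congr (_ * _); apply: eq_bigr => i _; rewrite addnC.
Qed.

Section Fixed.
Variable q : C.
Hypothesis q1 : nm q < 1.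
Hypothesis q0 : q != 0.
Variable n : nat.
Hypothesis n0 : (0 < n)%N.

Lemma nm_qn : nm (q ^+ n) < 1.
Proof. by rewrite nmX exprn_ilt1 ?nm_ge0 // -lt0n. Qed.

Lemma qn_neq0 : q ^+ n != 0.
Proof. by rewrite expf_neq0. Qed.

Lemma Pprod_prim (om w : C) N : n.-primitive_root om ->
  \prod_(m < n) Pprod q N (om ^+ m * w) = Pprod (q ^+ n) N (w ^+ n).
Proof.
move=> hom; rewrite /Pprod exchange_big /=; apply: eq_bigr => j _.
rewrite big_split /=; congr (_ * _).
  rewrite -exprM mulnC exprM -exprMn -(prod_1Bprim _ hom).
  by apply: eq_bigr => i _; rewrite mulrCA.
rewrite -exprM mulnC exprM -expr_div_n -(prod_1Bprim _ (prim_rootV hom)).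
by apply: eq_bigr => i _; rewrite invfM exprVn mulrCA.
Qed.

Lemma Pprod_step (w : C) N :
  \prod_(r < n) Pprod (q ^+ n) N (q ^+ r * w) = Pprod q (n * N) w.
Proof.
rewrite /Pprod exchange_big /= (big_ord_mul n N (fun m => (1 - q ^+ m * w) * (1 - q ^+ m.+1 / w))).
apply: eq_bigr => m _; rewrite !big_split /=; congr (_ * _).
  by apply: eq_bigr => i _; rewrite mulrA -exprM -exprD.
rewrite (reindex_inj rev_ord_inj) /=; apply: eq_bigr => i _.
congr (1 - _); rewrite -exprM mulnS invfM mulrA; congr (_ / _).
rewrite -[in LHS](subnK (_ : (n - i.+1 <= n + n * m)%N)) ?exprD ?mulfK ?expf_neq0 //.
  by congr (_ ^+ _); have := ltn_ord i; lia.
lia.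
Qed.

(** Comparing two points removes the normalising factors: they do not depend on the point, and the
    [Pprod] parts satisfy the identity at each finite stage. *)
Lemma T_prim (om w w' : C) : n.-primitive_root om -> w != 0 -> w' != 0 ->
  (\prod_(m < n) T q (om ^+ m * w)) * T (q ^+ n) (w' ^+ n) =
  (\prod_(m < n) T q (om ^+ m * w')) * T (q ^+ n) (w ^+ n).
Proof.
move=> hom w0 w0'; have om0 := primitive_root_neq0 hom.
have H (u v : C) : u != 0 -> v != 0 ->
    tends \oo (fun N => (\prod_(m < n) Qprod q N (om ^+ m * u)) * Qprod (q ^+ n) N (v ^+ n))
      ((\prod_(m < n) T q (om ^+ m * u)) * T (q ^+ n) (v ^+ n)).
  move=> u0 v0; apply: tendsM.
    by apply: tends_prod => i _; apply: triple_product => //; rewrite mulf_neq0 ?expf_neq0.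
  by apply: triple_product; [exact: nm_qn|exact: qn_neq0|rewrite expf_neq0].
apply: (tends_unique _ (H w w' w0 w0')); apply: tends_ext (H w' w w0' w0) => N.
rewrite /Qprod !big_split /= !Pprod_prim //; ring.
Qed.

Lemma T_step (w w' : C) : w != 0 -> w' != 0 ->
  (\prod_(r < n) T (q ^+ n) (q ^+ r * w)) * T q w' =
  (\prod_(r < n) T (q ^+ n) (q ^+ r * w')) * T q w.
Proof.
move=> w0 w0'.
have H (u v : C) : u != 0 -> v != 0 ->
    tends \oo (fun N => (\prod_(r < n) Qprod (q ^+ n) N (q ^+ r * u)) * Qprod q (n * N) v)
      ((\prod_(r < n) T (q ^+ n) (q ^+ r * u)) * T q v).
  move=> u0 v0; apply: tendsM.
    apply: tends_prod => i _; apply: triple_product; rewrite ?nm_qn ?qn_neq0 //.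
    by rewrite mulf_neq0 ?expf_neq0.
  apply: (tends_subseq (f := Qprod q ^~ v) (g := fun N => (n * N)%N)).
    by move=> N; rewrite leq_pmull.
  exact: triple_product.
apply: (tends_unique _ (H w w' w0 w0')); apply: tends_ext (H w' w w0' w0) => N.
rewrite /Qprod !big_split /= !Pprod_step //; ring.
Qed.

(** The modulus is the square root of [nm q], hence no integral power of it. Dividing by the values
    at such a point turns [T_prim] and [T_step] into identities with a non-zero constant. *)
Lemma generic_point : exists2 w : C, w != 0 & forall m : int, nm w != nm q ^ m.
Proof.
have qp : 0 < nm q by rewrite nm_gt0.
have sp : 0 < Num.sqrt (nm q) by rewrite sqrtr_gt0.
exists (Num.sqrt (nm q))%:C; first by rewrite -nm_gt0 nm_real gtr0_norm.
move=> m; rewrite nm_real gtr0_norm //; apply/eqP => h.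
have : nm q ^ 1 = nm q ^ (2 * m).
  have := sqr_sqrtr (ltW qp); rewrite h exprnP exprz_exp mulrC => ->.
  by rewrite expr1z.
have qn1 : nm q != 1 by rewrite lt_eqF.
by move/(ieexprIz qp qn1); lia.
Qed.

Lemma mul_divfK (a b c : C) : c != 0 -> a * b = a / c * b * c.
Proof. by move=> c0; field. Qed.

Lemma T_prim_cst (om : C) : n.-primitive_root om ->
  exists2 c : C, c != 0 & forall w, w != 0 ->
    \prod_(m < n) T q (om ^+ m * w) = c * T (q ^+ n) (w ^+ n).
Proof.
move=> hom; have [w' w0' hw'] := generic_point; have om0 := primitive_root_neq0 hom.
have nom m : nm (om ^+ m) = 1.
  apply/eqP; rewrite -(pexpr_eq1 n0) ?nm_ge0 // -nmX -exprM mulnC exprM.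
  by rewrite (prim_expr_order hom) expr1n nm1.
have hn : T (q ^+ n) (w' ^+ n) != 0.
  apply/eqP => /(T_eq0 nm_qn qn_neq0); rewrite expf_neq0 // => /(_ isT)[m].
  move=> /(congr1 (@nm R)); rewrite nmX nmXz nmX => h.
  have /eqP := hw' m; apply; apply/eqP; rewrite -(eqrXn2 n0) ?nm_ge0 ?exprz_ge0 ?nm_ge0 //.
  by rewrite h !exprnP exprzAC.
have hp : \prod_(m < n) T q (om ^+ m * w') != 0.
  apply/prodf_neq0 => m _; apply/eqP => /(T_eq0 q1 q0).
  rewrite mulf_neq0 ?expf_neq0 // => /(_ isT)[k] /(congr1 (@nm R)).
  by rewrite nmM nom mul1r nmXz => h; have := hw' k; rewrite h eqxx.
exists ((\prod_(m < n) T q (om ^+ m * w')) / T (q ^+ n) (w' ^+ n)).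
  by rewrite mulf_neq0 ?invr_eq0.
move=> w w0; apply: (mulIf hn); exact: (etrans (T_prim hom w0 w0') (mul_divfK _ _ hn)).
Qed.

Lemma T_step_cst : exists2 c : C, c != 0 & forall w, w != 0 ->
  \prod_(r < n) T (q ^+ n) (q ^+ r * w) = c * T q w.
Proof.
have [w' w0' hw'] := generic_point.
have hn : T q w' != 0.
  apply/eqP => /(T_eq0 q1 q0 w0')[k] /(congr1 (@nm R)).
  by rewrite nmXz => h; have := hw' k; rewrite h eqxx.
have hp : \prod_(r < n) T (q ^+ n) (q ^+ r * w') != 0.
  apply/prodf_neq0 => r _; apply/eqP => /(T_eq0 nm_qn qn_neq0).
  rewrite mulf_neq0 ?expf_neq0 // => /(_ isT)[k] h.
  have h2 : w' = q ^ (n%:Z * k - r%:Z).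
    apply: (mulfI (expf_neq0 r q0)); rewrite h [q ^+ n]exprnP exprz_exp exprnP -expfzDr //.
    by congr (_ ^ _); lia.
  by have := hw' (n%:Z * k - r%:Z); rewrite -nmXz -h2 eqxx.
exists ((\prod_(r < n) T (q ^+ n) (q ^+ r * w')) / T q w').
  by rewrite mulf_neq0 ?invr_eq0.
move=> w w0; apply: (mulIf hn); exact: (etrans (T_step w0 w0') (mul_divfK _ _ hn)).
Qed.

End Fixed.

Lemma geo_weaken (B B' r : R) (a : int -> C) : B <= B' -> 0 <= r -> geo B r a -> geo B' r a.
Proof. by move=> BB r0 h m; apply: le_trans (h m) _; rewrite ler_wpM2r ?exprn_ge0. Qed.

Lemma tri_even (s t : int) :
  (tri (s + t) + tri (s - t))%:Z = (2 * tri s)%:Z + ((2 * tri t)%:Z + t).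
Proof.
by rewrite PoszD !tri2; have := tri2 (s + t); have := tri2 (s - t); rewrite !PoszM; nia.
Qed.

Lemma tri_odd (s t : int) :
  (tri (s + t + 1) + tri (s - t))%:Z = (2 * tri s)%:Z + s + ((2 * tri t)%:Z + 2 * t).
Proof.
by rewrite PoszD !tri2; have := tri2 (s + t + 1); have := tri2 (s - t); rewrite !PoszM; nia.
Qed.

(** Each term on the right separates [w] from [v]; the two terms stem from the two parity classes of
    the double series. This form of rank two is all that Weierstrass' identity needs. *)
Lemma T_bilinear (q w v : C) : nm q < 1 -> q != 0 -> w != 0 -> v != 0 ->
  T q (w * v) * T q (w / v) =
  T (q ^+ 2) (- w ^+ 2) * T (q ^+ 2) (- (q * v ^+ 2))
  - w / v * T (q ^+ 2) (- (q * w ^+ 2)) * T (q ^+ 2) (- v ^+ 2).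
Proof.
move=> q1 q0 w0 v0.
have q21 : nm (q ^+ 2) < 1 by exact: nm_qn.
have q20 : q ^+ 2 != 0 by rewrite expf_neq0.
have r4 : 0 < ((2^-1 : R) ^+ 2) < 1 by rewrite exprn_gt0 // exprn_ilt1 //; lra.
have r2 := half01 R.
have n1 : w * v != 0 by rewrite mulf_neq0.
have n2 : w / v != 0 by rewrite mulf_neq0 ?invr_eq0.
have n3 : - w ^+ 2 != 0 by rewrite oppr_eq0 expf_neq0.
have n4 : - (q * v ^+ 2) != 0 by rewrite oppr_eq0 mulf_neq0 ?expf_neq0.
have n5 : - (q * w ^+ 2) != 0 by rewrite oppr_eq0 mulf_neq0 ?expf_neq0.
have n6 : - v ^+ 2 != 0 by rewrite oppr_eq0 expf_neq0.
have n7 : q ^+ 2 * - v ^+ 2 != 0 by rewrite mulf_neq0.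
have [B1 h1] := tterm_geo1 q1 n1 r4. have [B2 h2] := tterm_geo1 q1 n2 r4.
have [B3 h3] := tterm_geo1 q21 n3 r2. have [B4 h4] := tterm_geo1 q21 n4 r2.
have [B5 h5] := tterm_geo1 q21 n5 r2. have [B6 h6] := tterm_geo1 q21 n7 r2.
have h5' := geoZ (- w) h5; have h6' := geoZ v h6.
have b1 := geo_ge0 h1; have b2 := geo_ge0 h2; have b3 := geo_ge0 h3; have b4 := geo_ge0 h4.
have b5 := geo_ge0 h5'; have b6 := geo_ge0 h6'.
pose B := B1 + B2 + B3 + B4 + nm (- w) * B5 + nm v * B6.
have rp4 : 0 <= (2^-1 : R) ^+ 2 by case/andP: r4 => /ltW.
have rp2 : 0 <= (2^-1 : R) by case/andP: r2 => /ltW.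
have hx := geo_weaken (_ : B1 <= B) rp4 h1; have hy := geo_weaken (_ : B2 <= B) rp4 h2.
have hu := geo_weaken (_ : B3 <= B) rp2 h3; have hv := geo_weaken (_ : B4 <= B) rp2 h4.
have hu' := geo_weaken (_ : nm (- w) * B5 <= B) rp2 h5'; have hv' := geo_weaken (_ : nm v * B6 <= B) rp2 h6'.
have Eab s t : (- (w * v)) ^ (s + t) * (- (w / v)) ^ (s - t) = (w ^+ 2) ^ s * (v ^+ 2) ^ t.
  have -> : w ^+ 2 = (- (w * v)) * (- (w / v)) by field; rewrite v0.
  have -> : v ^+ 2 = (- (w * v)) * (- (w / v))^-1 by field; rewrite w0 v0.
  by rewrite !expfzMl exprz_inv !expfzDr ?oppr_eq0 //; ring.
have r01 := half01 R.
have e1 s t : tterm q (w * v) (s + t) * tterm q (w / v) (s - t) =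
    tterm (q ^+ 2) (- w ^+ 2) s * tterm (q ^+ 2) (- (q * v ^+ 2)) t.
  rewrite /tterm !opprK.
  have E1 : q ^+ tri (s + t) * q ^+ tri (s - t) = q ^+ 2 ^+ tri s * (q ^+ 2 ^+ tri t * q ^ t).
    rewrite -!exprM -exprD !exprnP -!expfzDr //; congr (_ ^ _).
    exact: tri_even.
  by rewrite [(q * v ^+ 2) ^ t]expfzMl mulrACA E1 Eab; ring.
(* The odd class produces the argument [q ^+ 2 * - v ^+ 2]; the quasi-period [T_mulq] brings it back
   to [- v ^+ 2] at the end. *)
have e2 s t : tterm q (w * v) (s + t + 1) * tterm q (w / v) (s - t) =
    - w * tterm (q ^+ 2) (- (q * w ^+ 2)) s * (v * tterm (q ^+ 2) (q ^+ 2 * - v ^+ 2) t).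
  rewrite /tterm !opprK mulrN opprK.
  have E1 : q ^+ tri (s + t + 1) * q ^+ tri (s - t) =
      q ^+ 2 ^+ tri s * q ^ s * (q ^+ 2 ^+ tri t * (q ^+ 2) ^ t).
    rewrite -!exprM -exprD !exprnP exprz_exp -!expfzDr //; congr (_ ^ _).
    exact: tri_odd.
  have wv0 : - (w * v) != 0 by rewrite oppr_eq0.
  rewrite [(q * w ^+ 2) ^ s]expfzMl [(q ^+ 2 * v ^+ 2) ^ t]expfzMl mulrACA E1.
  by rewrite [(- (w * v)) ^ (s + t + 1)]expfzDr // expr1z [X in _ * X]mulrAC Eab; ring.
have x1 : B1 <= B by rewrite /B; lra.
have x2 : B2 <= B by rewrite /B; lra.
have x3 : B3 <= B by rewrite /B; lra.
have x4 : B4 <= B by rewrite /B; lra.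
have x5 : nm (- w) * B5 <= B by rewrite /B; lra.
have x6 : nm v * B6 <= B by rewrite /B; lra.
have E := zsum_mul_rotate r01 (hx x1) (hy x2) (hu x3) (hv x4) (hu' x5) (hv' x6) e1 e2.
rewrite (zsumZ _ (half01' R) h5) (zsumZ _ (half01' R) h6) in E.
rewrite -(TE q (w * v)) -(TE q (w / v)) -(TE (q ^+ 2) (- w ^+ 2)) in E.
rewrite -(TE (q ^+ 2) (- (q * v ^+ 2))) -(TE (q ^+ 2) (- (q * w ^+ 2))) in E.
rewrite -(TE (q ^+ 2) (q ^+ 2 * - v ^+ 2)) (T_mulq q21 n6 q20) in E.
rewrite E; move: (T _ (- w ^+ 2)) (T _ (- (q * v ^+ 2))) (T _ (- (q * w ^+ 2))) (T _ (- v ^+ 2)).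
by move=> t1 t2 t3 t4; field.
Qed.

End ThetaProducts.

(* Up to a Gaussian factor this is Weierstrass' sigma function: the exponential prefactor
   makes theta odd and antiperiodic under translation by [eta]. *)
HB.lock Definition sg (R : realType) (eta X : R[i]) : R[i] :=
  ee (X ^+ 2 / (2 * eta) - X / 2) * T (ee eta) (ee X).

(** * The sigma function: quasi-periods, zeros, Weierstrass' identity *)

Section Sigma.
Variable R : realType.
Local Notation C := R[i].

Lemma sgE (eta X : C) : sg eta X = ee (X ^+ 2 / (2 * eta) - X / 2) * T (ee eta) (ee X).
Proof. by rewrite sg.unlock. Qed.

Lemma ee_prod (I : Type) (r : seq I) (f : I -> C) :
  \prod_(i <- r) ee (f i) = ee (\sum_(i <- r) f i).
Proof. by rewrite (big_morph (@ee R) (@eeD R) (ee0 R)). Qed.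

Section Fixed.
Variable eta : C.
Hypothesis eta_gt0 : 0 < complex.Im eta.

Let eta0 : eta != 0. Proof. exact: eta_neq0. Qed.

Lemma nm_ee_lt1 : nm (ee eta) < 1.
Proof.
by rewrite nm_ee -expR0 ltr_expR oppr_lt0 mulr_gt0 ?mulr_gt0 ?pi_gt0.
Qed.
Let q1 := nm_ee_lt1.
Let q0 : ee eta != 0. Proof. exact: ee_neq0. Qed.

Lemma sg_odd X : sg eta (- X) = - sg eta X.
Proof.
rewrite !sgE eeN (T_inv q1 (ee_neq0 X)) sqrrN.
have -> : ee (X ^+ 2 / (2 * eta) - - X / 2) = ee (X ^+ 2 / (2 * eta) - X / 2) * ee X.
  by rewrite -eeD; congr ee; field.
have := ee_neq0 X; move: (ee X) (ee (X ^+ 2 / (2 * eta) - X / 2)) (T (ee eta) (ee X)) => a b c a0.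
by field.
Qed.

Lemma sg0 : sg eta 0 = 0.
Proof.
have h : sg eta 0 + sg eta 0 = 0 by have := sg_odd 0; rewrite oppr0 => {1}->; rewrite addNr.
by apply/eqP; move/eqP: h; rewrite -mulr2n mulrn_eq0.
Qed.

Lemma sg_addeta X : sg eta (X + eta) = - sg eta X.
Proof.
rewrite !sgE (eeD X) [ee X * _]mulrC (T_mulq q1 (ee_neq0 X) q0).
have -> : ee ((X + eta) ^+ 2 / (2 * eta) - (X + eta) / 2) = ee (X ^+ 2 / (2 * eta) - X / 2) * ee X.
  by rewrite -eeD; congr ee; field.
have := ee_neq0 X; move: (ee X) (ee (X ^+ 2 / (2 * eta) - X / 2)) (T (ee eta) (ee X)) => a b c a0.
by field.
Qed.

Lemma sg_add1 X : sg eta (X + 1) = - ee ((2 * X + 1) / (2 * eta)) * sg eta X.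
Proof.
rewrite !sgE (eeD X 1) ee1 mulr1.
have -> : ee ((X + 1) ^+ 2 / (2 * eta) - (X + 1) / 2) =
   ee ((2 * X + 1) / (2 * eta)) * ee (X ^+ 2 / (2 * eta) - X / 2) / ee 2^-1.
  by rewrite -eeD -eeB; congr ee; field.
by rewrite ee_half invrN1; ring.
Qed.

Lemma sg_addz X (k : int) : sg eta (X + k%:~R * eta) = (-1) ^ k * sg eta X.
Proof.
have H (n : nat) Y : sg eta (Y + n%:R * eta) = (-1) ^+ n * sg eta Y.
  elim: n => [|n IH]; first by rewrite mul0r addr0 mul1r.
  by rewrite -natr1 mulrDl mul1r addrA sg_addeta IH exprS mulN1r mulNr.
case: k => n; first by rewrite -pmulrn H.
have h1 : ((-1 : C) ^+ n.+1) != 0 by rewrite expf_neq0 // oppr_eq0 oner_neq0.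
rewrite NegzE -exprnN; apply: (mulfI h1); rewrite [RHS]mulrA divff // [RHS]mul1r -H.
by congr sg; rewrite mulrNz -pmulrn mulNr subrK.
Qed.

Lemma sg_eq0 X : sg eta X = 0 <-> exists a b : int, X = a%:~R + b%:~R * eta.
Proof.
split.
  move=> /eqP; rewrite sgE mulf_eq0 (negPf (ee_neq0 _)) /= => /eqP /(T_eq0 q1 q0 (ee_neq0 X))[m].
  rewrite -eeMz => h; have : ee (X - m%:~R * eta) = 1 by rewrite eeB h divff ?ee_neq0.
  by move=> /ee_eq1[a ha]; exists a, m; rewrite -ha subrK.
move=> [a [b ->]]; rewrite sg_addz.
suff -> : sg eta a%:~R = 0 by rewrite mulr0.
by rewrite sgE ee_int -[1](expr0z (ee eta)) (T_qexp q1 q0) mulr0.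
Qed.

(** The Gaussian prefactor of [sg] turns the two terms of [T_bilinear] into a 2 by 2 determinant. *)
Lemma sg_bilinear : exists A B : C -> C, forall x y,
  sg eta (x + y) * sg eta (x - y) = A x * B y - B x * A y.
Proof.
exists (fun x => ee (x ^+ 2 / eta - x) * T (ee eta ^+ 2) (- ee x ^+ 2)).
exists (fun x => ee (x ^+ 2 / eta) * T (ee eta ^+ 2) (- (ee eta * ee x ^+ 2))) => x y.
rewrite !sgE mulrACA eeD (eeD x (- y)) eeN.
rewrite (T_bilinear q1 q0 (ee_neq0 x) (ee_neq0 y)).
have -> : ee ((x + y) ^+ 2 / (2 * eta) - (x + y) / 2) * ee ((x - y) ^+ 2 / (2 * eta) - (x - y) / 2)
   = ee (x ^+ 2 / eta - x) * ee (y ^+ 2 / eta).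
  by rewrite -!eeD; congr ee; field.
have -> : ee (y ^+ 2 / eta - y) = ee (y ^+ 2 / eta) / ee y by rewrite eeB.
have -> : ee (x ^+ 2 / eta) = ee (x ^+ 2 / eta - x) * ee x by rewrite -eeD subrK.
have := ee_neq0 x; have := ee_neq0 y.
move: (T _ (- ee x ^+ 2)) (T _ (- ee y ^+ 2)) (T _ (- (_ * ee x ^+ 2))) (T _ (- (_ * ee y ^+ 2))).
move: (ee (x ^+ 2 / eta - x)) (ee (y ^+ 2 / eta)) (ee x) (ee y) => a b c d t1 t2 t3 t4 d0 c0.
by field.
Qed.

(** The Plücker relation between the 2 by 2 minors of the four columns [(A, B)] at [x], [y], [u],
    [v]. *)
Lemma sg_weierstrass x y u v :
  sg eta (x + y) * sg eta (x - y) * (sg eta (u + v) * sg eta (u - v))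
  - sg eta (x + u) * sg eta (x - u) * (sg eta (y + v) * sg eta (y - v))
  + sg eta (x + v) * sg eta (x - v) * (sg eta (y + u) * sg eta (y - u)) = 0.
Proof. by have [A [B h]] := sg_bilinear; rewrite !h; ring. Qed.

Lemma cdiff_sg X : cdiff (sg eta) X.
Proof.
have -> : sg eta = fun X => ee (X ^+ 2 / (2 * eta) - X / 2) * T (ee eta) (ee X).
  by rewrite sg.unlock.
apply: cdiffM.
  apply: (cdiff_comp (f := @ee R)); last exact: cdiff_ee.
  apply: cdiffD; first by apply: cdiffMr; apply: cdiffM; exact: cdiff_id.
  by apply: cdiffN; apply: cdiffMr; exact: cdiff_id.
apply: (cdiff_comp (f := T (ee eta))); first exact: cdiff_ee.
by apply: cdiff_T; [exact: q1|exact: ee_neq0].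
Qed.

(** The limit exists by differentiability. Were it 0, it would contradict the lower bound of
    [T_near1], because [(ee X - 1) / X] has a non-zero limit. *)
Lemma sg_deriv0 : exists2 d : C, d != 0 & tends ((0 : C)^') (fun X => sg eta X / X) d.
Proof.
have [Q [d [hQ tQ]]] := cdiff_sg 0.
have td : tends ((0 : C)^') (fun X => sg eta X / X) d.
  apply: tends_near (tends_mono (@dnbhs_sub _ 0) tQ).
  apply/dnbhsC; exists 1 => // X X0 _ /=; rewrite (hQ X) sg0 add0r subr0 mulrC mulKf //.
exists d => //; apply/eqP => d0.
have [c c0 hc] := T_near1 q1 q0.
have tid : tends ((0 : C)^') id 0 := tends_mono (@dnbhs_sub _ 0) (tends_id 0).
have tee : tends ((0 : C)^') (@ee R) 1 by rewrite -(ee0 R); exact: tends_ee tid.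
have hnear : ((0 : C)^') [set X | c * nm (1 - ee X) <= nm (T (ee eta) (ee X))].
  have /tendsC cee := tee; exact: cee hc.
pose g X : C := ee (X ^+ 2 / (2 * eta) - X / 2) * ((ee X - 1) / X).
have tg : tends ((0 : C)^') g (1 * ((2 * pi)%:C * 'i)).
  apply: tendsM; last exact: ee_diff0.
  rewrite -[X in tends _ _ X](ee0 R); apply: tends_ee.
  rewrite [X in tends _ _ X](_ : _ = 0 ^+ 2 / (2 * eta) - 0 / 2); last by rewrite expr0n !mul0r subrr.
  apply: tendsB; first by apply: tendsM; [exact: tendsX tid|exact: tends_cst].
  by apply: tendsM tid _; exact: tends_cst.
pose gam := nm (1 * ((2 * pi)%:C * 'i) : C).
have gam0 : 0 < gam.
  rewrite nm_gt0 !mulf_neq0 ?oner_neq0 //.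
    by rewrite -nm_gt0 nm_real normr_gt0 mulf_neq0 ?pnatr_eq0 // gt_eqF ?pi_gt0.
  by rewrite eq_complex /= oner_eq0 andbF.
have h1 : ((0 : C)^') [set X | gam / 2 < nm (g X)].
  by apply: (tends_nm_gt tg); rewrite -/gam; lra.
have h2 : ((0 : C)^') [set X | nm (sg eta X / X) < c * (gam / 2)].
  by apply: (tends_nm_lt td); rewrite d0 nm0 !mulr_gt0 // invr_gt0.
have h3 : ((0 : C)^') [set X : C | X != 0] by apply/dnbhsC; exists 1.
have [X [[/= h4 h5] [h6 h7]]] := filter_ex (filterI (filterI h1 h2) (filterI h3 hnear)).
have : c * nm (g X) <= nm (sg eta X / X).
  rewrite /g sgE; move: (ee (X ^+ 2 / (2 * eta) - X / 2)) => E.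
  rewrite nmM [nm (_ / X)]nmM nmV nmBC [leRHS]nmM [nm (E * T _ _)]nmM nmV.
  rewrite [leLHS]mulrCA -[leRHS]mulrA ler_wpM2l ?nm_ge0 // mulrA.
  by rewrite ler_wpM2r ?invr_ge0 ?nm_ge0.
have : c * (gam / 2) < c * nm (g X) by rewrite ltr_pM2l.
lra.
Qed.

End Fixed.

Lemma tends0_comp_sub (a : C) : a != 0 -> (fun X : C => a * X) @ ((0 : C)^') `=>` ((0 : C)^').
Proof.
rewrite -nm_gt0 => a0 A /dnbhsC [e e0 h]; apply/dnbhsC; exists (e / nm a); first by rewrite divr_gt0.
move=> z z0 hz; apply: h; first by rewrite mulf_neq0 // -nm_gt0.
by move: hz; rewrite !sub0r !nmN nmM ltr_pdivlMr // mulrC.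
Qed.

Lemma ee_prim_root (n : nat) : (0 < n)%N -> n.-primitive_root (ee (n%:R^-1 : C)).
Proof.
move=> n0; have nR : n%:R != 0 :> C by rewrite pnatr_eq0 -lt0n.
rewrite /primitive_root_of_unity n0 /=; apply/forallP => i; apply/eqP.
rewrite unity_rootE -eeMn; apply/eqP/eqP => [|->]; last by rewrite divff // ee1.
move=> /ee_eq1[m hm].
have h : (i.+1%:Z = m * n%:Z)%R.
  apply: (@intr_inj C); rewrite rmorphM /= -!pmulrn -hm; field; exact: nR.
have := ltn_ord i; case: m h {hm} => [[|m]|m]; nia.
Qed.

Lemma sum_ord_natr (n : nat) : 2 * \sum_(r < n) (r%:R : C) = n%:R * (n%:R - 1).
Proof.
elim: n => [|n IH]; first by rewrite big_ord0 mulr0 mul0r.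
by rewrite big_ord_recr /= mulrDr IH -natr1; ring.
Qed.

(** * Theta functions of order n as translates of one sigma function *)

Section ThetaN.
Variable eta : C.
Hypothesis eta_gt0 : 0 < complex.Im eta.
Variable n : nat.
Hypothesis n0 : (0 < n)%N.

Let eta0 : eta != 0. Proof. exact: eta_neq0. Qed.
Let nR : n%:R != 0 :> C. Proof. by rewrite pnatr_eq0 -lt0n. Qed.
Let q1 := nm_ee_lt1 eta_gt0.
Let q0 : ee eta != 0. Proof. exact: ee_neq0. Qed.

Lemma Im_neta : 0 < complex.Im (n%:R * eta).
Proof.
have -> : n%:R = (n%:R)%:C :> C by rewrite rmorph_nat.
have -> : complex.Im ((n%:R)%:C * eta) = n%:R * complex.Im eta.
  by case: (eta) => a b /=; rewrite mul0r addr0.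
by rewrite mulr_gt0 ?ltr0n.
Qed.

(** Passage from modulus [n%:R * eta] to [eta]. It evaluates the product of all theta_alpha in the
    numerator of R, and its expansion to second order yields [wp_sum]. *)
Lemma sg_prod : exists2 c : C, c != 0 & forall X,
  \prod_(r < n) sg (n%:R * eta) (X + r%:R * eta) = c * sg eta X.
Proof.
have [c c0 hc] := T_step_cst q1 q0 n0.
pose s := \sum_(r < n) (r%:R ^+ 2 * eta / (2 * n%:R) - r%:R * eta / 2) : C.
exists (ee s * c); first by rewrite mulf_neq0 ?ee_neq0.
move=> X; under eq_bigr do rewrite sgE; rewrite sgE big_split /= ee_prod.
have -> : \prod_(i < n) T (ee (n%:R * eta)) (ee (X + i%:R * eta)) = c * T (ee eta) (ee X).
  rewrite -hc ?ee_neq0 //; apply: eq_bigr => r _.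
  by rewrite eeMn eeD eeMn mulrC.
have -> : \sum_(i < n) ((X + i%:R * eta) ^+ 2 / (2 * (n%:R * eta)) - (X + i%:R * eta) / 2)
   = s + (X ^+ 2 / (2 * eta) - X / 2).
  transitivity (s + (X / n%:R * \sum_(r < n) r%:R + n%:R * (X ^+ 2 / (2 * n%:R * eta) - X / 2))).
    have -> : n%:R * (X ^+ 2 / (2 * n%:R * eta) - X / 2) = \sum_(r < n) (X ^+ 2 / (2 * n%:R * eta) - X / 2).
      by rewrite sumr_const card_ord [LHS]mulr_natl.
    rewrite /s mulr_sumr -!big_split /=; apply: eq_bigr => r _.
    by field; rewrite nR eta0.
  have -> : \sum_(r < n) r%:R = n%:R * (n%:R - 1) / 2 :> C.
    by rewrite -sum_ord_natr mulrC mulKf ?pnatr_eq0.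
  by field; rewrite nR eta0.
by rewrite eeD; ring.
Qed.

(** The product over the shifts [m / n] runs over the n-th roots of unity and collapses to one theta
    function of modulus [n%:R * eta]. The Gaussian factor is the same for all [al], so it factors
    out of the entries of R. *)
Lemma theta_nE : exists2 c : C, c != 0 & forall (al : int) (z : C),
  theta_n n eta al z = c * ee (n%:R * z / 2 - n%:R * z ^+ 2 / (2 * eta))
     * (ee (al%:~R / (2 * n%:R)) * sg (n%:R * eta) (n%:R * z + al%:~R * eta)).
Proof.
have [c c0 hc] := T_prim_cst q1 q0 n0 (ee_prim_root n0).
exists c => // al z.
(* Adding [k * n] to the index changes the root of unity and the sigma value by the same sign
   [(-1) ^ k], so the formula survives reduction modulo [n]. *)
have per (k b : int) : ee ((b + k * n%:Z)%:~R / (2 * n%:R)) * sg (n%:R * eta) (n%:R * z + (b + k * n%:Z)%:~R * eta)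
   = ee (b%:~R / (2 * n%:R)) * sg (n%:R * eta) (n%:R * z + b%:~R * eta).
  have -> : n%:R * z + (b + k * n%:Z)%:~R * eta = n%:R * z + b%:~R * eta + k%:~R * (n%:R * eta).
    by rewrite rmorphD rmorphM /= -pmulrn; ring.
  have -> : ee ((b + k * n%:Z)%:~R / (2 * n%:R)) = ee (b%:~R / (2 * n%:R)) * ee (k%:~R * 2^-1) :> C.
    by rewrite -eeD; congr ee; rewrite rmorphD rmorphM /= -pmulrn; field.
  have h : ((-1 : C) ^ k) * ((-1) ^ k) = 1 by rewrite -expfzMl mulrNN mulr1 exp1rz.
  rewrite (sg_addz Im_neta) (eeMz k 2^-1) ee_half.
  have hr (A t S : C) : A * t * (t * S) = t * t * (A * S) by ring.
  by rewrite hr h mul1r.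
have hal : ((al %% n%:Z)%Z + (al %/ n%:Z)%Z * n%:Z = al)%R by rewrite addrC -divz_eq.
have := per (al %/ n%:Z)%Z (al %% n%:Z)%Z; rewrite hal => ->.
rewrite /theta_n; move: (al %% n%:Z)%Z => {per hal}al'; move: al' => {}al.
rewrite /theta_a sgE.
have -> : \prod_(m < n) theta eta (z + m%:R / n%:R + al%:~R / n%:R * eta) =
   c * T (ee (n%:R * eta)) (ee (n%:R * z + al%:~R * eta)).
  have -> : n%:R * z + al%:~R * eta = n%:R * (z + al%:~R / n%:R * eta) by field.
  rewrite !eeMn -hc ?ee_neq0 //; apply: eq_bigr => m _.
  by rewrite thetaE -eeMn -eeD addrAC addrC.
have -> : ee (al%:~R * z + al%:~R / (2 * n)%:R + (al * (al - n%:Z))%:~R / (2 * n)%:R * eta) =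
  ee (n%:R * z / 2 - n%:R * z ^+ 2 / (2 * eta)) * (ee (al%:~R / (2 * n%:R)) *
  ee ((n%:R * z + al%:~R * eta) ^+ 2 / (2 * (n%:R * eta)) - (n%:R * z + al%:~R * eta) / 2)).
  rewrite -!eeD natrM; congr ee; rewrite rmorphM rmorphB /= -pmulrn.
  by field; rewrite nR eta0.
ring.
Qed.

End ThetaN.
End Sigma.

(** * Kronecker's function and Fay's identity *)

Section Fay.
Variable K : fieldType.
Variable s : K -> K.
Hypothesis s_odd : forall x, s (- x) = - s x.
Hypothesis s_weierstrass : forall x y u v,
  s (x + y) * s (x - y) * (s (u + v) * s (u - v))
  - s (x + u) * s (x - u) * (s (y + v) * s (y - v))
  + s (x + v) * s (x - v) * (s (y + u) * s (y - u)) = 0.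
Hypothesis two_neq0 : 2 != 0 :> K.

Definition kro (x y : K) : K := s (x + y) / (s x * s y).

Lemma kroN x y : kro (- x) (- y) = - kro x y.
Proof. by rewrite /kro -opprD !s_odd mulrNN mulNr. Qed.

(** Weierstrass' identity at half-sums, chosen so that the sums and differences of the four points
    are, up to sign, the arguments that occur here; what remains is to clear denominators. *)
Lemma fay x1 y1 x2 y2 :
  s x1 != 0 -> s x2 != 0 -> s y1 != 0 -> s y2 != 0 -> s (x1 - x2) != 0 -> s (y1 + y2) != 0 ->
  kro x1 y1 * kro x2 y2 =
  kro x1 (y1 + y2) * kro (x2 - x1) y2 + kro x2 (y1 + y2) * kro (x1 - x2) y1.
Proof.
move=> h1 h2 h3 h4 h5 h6.
have := s_weierstrass ((x1 + x2 + y1 + y2) / 2) ((x1 + y1 - x2 - y2) / 2)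
   ((y1 + y2 + x1 - x2) / 2) ((y1 + y2 - x1 + x2) / 2).
have -> : (x1 + x2 + y1 + y2) / 2 + (x1 + y1 - x2 - y2) / 2 = x1 + y1 by field.
have -> : (x1 + x2 + y1 + y2) / 2 - (x1 + y1 - x2 - y2) / 2 = x2 + y2 by field.
have -> : (y1 + y2 + x1 - x2) / 2 + (y1 + y2 - x1 + x2) / 2 = y1 + y2 by field.
have -> : (y1 + y2 + x1 - x2) / 2 - (y1 + y2 - x1 + x2) / 2 = x1 - x2 by field.
have -> : (x1 + x2 + y1 + y2) / 2 + (y1 + y2 + x1 - x2) / 2 = x1 + (y1 + y2) by field.
have -> : (x1 + x2 + y1 + y2) / 2 - (y1 + y2 + x1 - x2) / 2 = x2 by field.
have -> : (x1 + y1 - x2 - y2) / 2 + (y1 + y2 - x1 + x2) / 2 = y1 by field.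
have -> : (x1 + y1 - x2 - y2) / 2 - (y1 + y2 - x1 + x2) / 2 = - (x2 - x1 + y2) by field.
have -> : (x1 + x2 + y1 + y2) / 2 + (y1 + y2 - x1 + x2) / 2 = x2 + (y1 + y2) by field.
have -> : (x1 + x2 + y1 + y2) / 2 - (y1 + y2 - x1 + x2) / 2 = x1 by field.
have -> : (x1 + y1 - x2 - y2) / 2 + (y1 + y2 + x1 - x2) / 2 = x1 - x2 + y1 by field.
have -> : (x1 + y1 - x2 - y2) / 2 - (y1 + y2 + x1 - x2) / 2 = - y2 by field.
rewrite /kro; have -> : x2 - x1 = - (x1 - x2) by rewrite opprB.
rewrite !s_odd; move: h1 h2 h3 h4 h5 h6.
move: (s x1) (s x2) (s y1) (s y2) (s (x1 - x2)) (s (y1 + y2)) => a1 a2 b1 b2 c d.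
move: (s (x1 + y1)) (s (x2 + y2)) (s (x1 + (y1 + y2))) (s (x2 + (y1 + y2))) => e1 e2 e3 e4.
move: (s (x1 - x2 + y1)) (s (- (x1 - x2) + y2)) => f1 f2 h1 h2 h3 h4 h5 h6 E.
apply: (mulIf (_ : a1 * a2 * b1 * b2 * c * d != 0)); first by rewrite !mulf_neq0.
transitivity (e1 * e2 * (d * c)); first by field; rewrite h1 h2 h3 h4.
have -> : e1 * e2 * (d * c) = e3 * a2 * (b1 * - f2) - e4 * a1 * (f1 * - b2).
  by apply/eqP; rewrite -subr_eq0; apply/eqP; rewrite -[RHS]E; ring.
by field; rewrite ?oppr_eq0 h1 h2 h3 h4 h5 h6.
Qed.

(* The analogue of Weierstrass' [wp], normalised to vanish at [c]. *)
Definition wp (c x : K) : K := s (x + c) * s (x - c) / (s x ^+ 2 * s c ^+ 2).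

(** The case [v = 0] of Weierstrass' identity. With this sign [wp] corresponds to minus the
    classical function, up to a constant. *)
Lemma wp_sub c x y : s 0 = 0 -> s c != 0 -> s x != 0 -> s y != 0 ->
  s (x + y) * s (x - y) / (s x ^+ 2 * s y ^+ 2) = wp c x - wp c y.
Proof.
move=> _ h1 h2 h3; have := s_weierstrass x y c 0; rewrite !addr0 !subr0 /wp.
move: h1 h2 h3; move: (s x) (s y) (s c) => a b d h1 h2 h3.
move: (s (x + y)) (s (x - y)) (s (x + c)) (s (x - c)) (s (y + c)) (s (y - c)) => e1 e2 e3 e4 e5 e6 E.
apply: (mulIf (_ : a ^+ 2 * b ^+ 2 * d ^+ 2 != 0)); first by rewrite !mulf_neq0 ?expf_neq0.
transitivity (e1 * e2 * (d * d)); first by field; rewrite h2 h3.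
have -> : e1 * e2 * (d * d) = e3 * e4 * (b * b) - a * a * (e5 * e6).
  by apply/eqP; rewrite -subr_eq0; apply/eqP; rewrite -[RHS]E; ring.
by field; rewrite h1 h2 h3.
Qed.

End Fay.

Section PeriodicSums.
Variables (K : nmodType) (n : nat).
Hypothesis n0 : (0 < n)%N.

Lemma periodic_modz (G : int -> K) (r : int) : (forall r, G (r + n%:Z) = G r) ->
  G r = G (r %% n%:Z)%Z.
Proof.
move=> hG; have H (m : nat) t : G (t + m%:Z * n%:Z) = G t.
  elim: m => [|m IH]; first by rewrite mul0r addr0.
  by rewrite (_ : t + m.+1%:Z * n%:Z = t + m%:Z * n%:Z + n%:Z) ?hG // intS; ring.
rewrite {1}(divz_eq r n%:Z); case: (r %/ n%:Z)%Z => m; first by rewrite addrC H.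
by rewrite NegzE -[LHS](H m.+1); congr G; ring.
Qed.

Lemma periodic_sum (G : int -> K) (k : nat) (t : int) : coprime n k ->
  (forall r, G (r + n%:Z) = G r) ->
  \sum_(r < n) G (k%:Z * r%:Z + t) = \sum_(r < n) G r%:Z.
Proof.
move=> nk hG; have n0z : n%:Z != 0 by rewrite eqz_nat -lt0n.
have lt r : (`|((k%:Z * r%:Z + t) %% n%:Z)%Z|%N < n)%N.
  have := modz_ge0 (k%:Z * r%:Z + t) n0z; have := ltz_mod (k%:Z * r%:Z + t) n0z; lia.
pose h (r : 'I_n) : 'I_n := Ordinal (lt r).
have hinj : injective h.
  move=> r r' /(congr1 val) /= E; apply/val_inj => /=.
  have {}E : ((k%:Z * r%:Z + t) = (k%:Z * r'%:Z + t) %[mod n%:Z])%Z.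
    have := modz_ge0 (k%:Z * r%:Z + t) n0z; have := modz_ge0 (k%:Z * r'%:Z + t) n0z; lia.
  move/eqP: E; rewrite eqz_mod_dvd.
  have -> : k%:Z * r%:Z + t - (k%:Z * r'%:Z + t) = k%:Z * (r%:Z - r'%:Z) by ring.
  rewrite Gauss_dvdzr; last by rewrite /coprimez /gcdz /= -/(coprime n k).
  move=> /dvdzP[m hm]; have := ltn_ord r; have := ltn_ord r'.
  by case: m hm => [[|m]|m] hm; nia.
rewrite [RHS](reindex_inj hinj) /=; apply: eq_bigr => r _.
rewrite (periodic_modz _ hG); congr G.
by have := modz_ge0 (k%:Z * r%:Z + t) n0z; lia.
Qed.

Lemma periodic_sum_shift (G : int -> K) (t : int) : (forall r, G (r + n%:Z) = G r) ->
  \sum_(r < n) G (r%:Z + t) = \sum_(r < n) G r%:Z.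
Proof.
move=> hG; rewrite -[RHS](@periodic_sum G 1 t (coprimen1 n) hG).
by apply: eq_bigr => r _; rewrite mul1r.
Qed.

End PeriodicSums.

(** * Sums of the Weierstrass function over the translates by eta *)

Section ScalarSum.
Variable R : realType.
Local Notation C := R[i].

(** A product rule: when all factors tend to 1, the difference of two products is to first order in
    [e] the sum of the differences of the factors. *)
Lemma tends_prodB (T : Type) (F : set_system T) (FF : Filter F) (n : nat)
    (a b : nat -> T -> C) (e : T -> C) (d : nat -> C) :
  (forall r, (r < n)%N -> tends F (a r) 1) -> (forall r, (r < n)%N -> tends F (b r) 1) ->
  (forall r, (r < n)%N -> tends F (fun y => (a r y - b r y) / e y) (d r)) ->
  tends F (fun y => (\prod_(r < n) a r y - \prod_(r < n) b r y) / e y) (\sum_(r < n) d r).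
Proof.
elim: n => [|n IH] ha hb hd.
  rewrite big_ord0; apply: tends_ext (tends_cst 0) => y.
  by rewrite !big_ord0 subrr mul0r.
have h1 := IH (fun r rn => ha r (ltnW rn)) (fun r rn => hb r (ltnW rn)) (fun r rn => hd r (ltnW rn)).
have hB : tends F (fun y => \prod_(r < n) b r y) 1.
  rewrite [X in tends _ _ X](_ : 1 = \prod_(r < n) 1); last by rewrite big1.
  by apply: tends_prod => r _; exact: (hb r (ltnW (ltn_ord r))).
rewrite big_ord_recr /= -[\sum_(r < n) d r]mulr1 -[d n]mul1r.
apply: (tends_ext _ (tendsD (tendsM h1 (ha n (ltnSn n))) (tendsM hB (hd n (ltnSn n))))) => y.
rewrite !big_ord_recr /=; ring.
Qed.

Variable eta : C.
Hypothesis eta_gt0 : 0 < complex.Im eta.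

Lemma sg_nonzero : exists c, sg eta c != 0.
Proof.
have [d d0 hd] := sg_deriv0 eta_gt0.
have [X /= hX] := filter_ex (tends_neq0 d0 hd).
by exists X; apply: contraNneq hX => ->; rewrite mul0r.
Qed.

Lemma tends_ratio1 (X : C) : sg eta X != 0 ->
  tends ((0 : C)^') (fun y => sg eta (X + y) * sg eta (X - y) / sg eta X ^+ 2) 1.
Proof.
move=> hX; have tid : tends ((0 : C)^') id 0 := tends_mono (@dnbhs_sub _ 0) (tends_id 0).
have cont (u : C) : tends (nbhs u) (sg eta) (sg eta u) := cdiff_cont (cdiff_sg eta_gt0 u).
have t1 : tends ((0 : C)^') (fun y => sg eta (X + y)) (sg eta X).
  have h : tends ((0 : C)^') (fun y => X + y) X.
    by rewrite -[X in tends _ _ X]addr0; apply: tendsD tid; exact: tends_cst.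
  by have /tendsC h' := h; exact: (tends_comp h' (cont X)).
have t2 : tends ((0 : C)^') (fun y => sg eta (X - y)) (sg eta X).
  have h : tends ((0 : C)^') (fun y => X - y) X.
    by rewrite -[X in tends _ _ X]subr0; apply: tendsB tid; exact: tends_cst.
  by have /tendsC h' := h; exact: (tends_comp h' (cont X)).
rewrite [X in tends _ _ X](_ : 1 = sg eta X * sg eta X / sg eta X ^+ 2); last first.
  by rewrite -expr2 divff // expf_neq0.
by apply: tendsM (tends_cst _); exact: tendsM.
Qed.

End ScalarSum.

Section ScalarSumLattice.
Variable R : realType.
Local Notation C := R[i].
Variable eta : C.
Hypothesis eta_gt0 : 0 < complex.Im eta.
Variable n : nat.
Hypothesis n0 : (0 < n)%N.
Let neta_gt0 : 0 < complex.Im (n%:R * eta). Proof. exact: Im_neta. Qed.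

Lemma wp_periodic c X : wp (sg (n%:R * eta)) c (X + n%:R * eta) = wp (sg (n%:R * eta)) c X.
Proof.
rewrite /wp; have -> : X + n%:R * eta + c = X + c + n%:R * eta by ring.
have -> : X + n%:R * eta - c = X - c + n%:R * eta by ring.
by rewrite !(sg_addeta neta_gt0) mulrNN sqrrN.
Qed.

(* Multiplicativity of the products [sg (n eta) (X + r eta)] becomes additivity of [wp] upon
   expanding [s (X + y) s (X - y) / s(X)^2 = 1 + O(y^2)] as [y -> 0]. *)
Lemma wp_sum c : sg (n%:R * eta) c != 0 -> exists2 L : C, L != 0 & forall X X0,
  (forall r, (r < n)%N -> sg (n%:R * eta) (X + r%:R * eta) != 0) ->
  (forall r, (r < n)%N -> sg (n%:R * eta) (X0 + r%:R * eta) != 0) ->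
  \sum_(r < n) wp (sg (n%:R * eta)) c (X + r%:R * eta)
  - \sum_(r < n) wp (sg (n%:R * eta)) c (X0 + r%:R * eta)
  = L * (sg eta (X + X0) * sg eta (X - X0) / (sg eta X ^+ 2 * sg eta X0 ^+ 2)).
Proof.
move=> hc; set sn := sg (n%:R * eta).
have [d1 d10 h1] := sg_deriv0 eta_gt0; have [dn dn0 hn] := sg_deriv0 neta_gt0.
(* [d1] and [dn] are the derivatives at 0 of the two sigma functions; the square comes from
   comparing [sg eta y ^+ 2] with [sn y ^+ 2]. *)
exists ((d1 / dn) ^+ 2); first by rewrite expf_neq0 // mulf_neq0 // invr_eq0.
move=> X X0 hX hX0; rewrite -sumrB.
have [p p0 hp] := sg_prod eta_gt0 n0.
have nz Y : (forall r, (r < n)%N -> sn (Y + r%:R * eta) != 0) -> sg eta Y != 0.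
  move=> h; have := hp Y; apply: contra_eqN => /eqP ->; rewrite mulr0.
  by apply/prodf_neq0 => r _; exact: h.
have sX := nz X hX; have sX0 := nz X0 hX0.
pose rho (Y y : C) := sn (Y + y) * sn (Y - y) / sn Y ^+ 2.
have y1 : ((0 : C)^') [set y | sg eta y / y != 0]  by exact: tends_neq0 h1.
have yn : ((0 : C)^') [set y | sn y / y != 0]  by exact: tends_neq0 hn.
have lim1 : tends ((0 : C)^')
    (fun y => (\prod_(r < n) rho (X + r%:R * eta) y - \prod_(r < n) rho (X0 + r%:R * eta) y) / sn y ^+ 2)
    (\sum_(r < n) (wp sn c (X + r%:R * eta) - wp sn c (X0 + r%:R * eta))).
  apply: (@tends_prodB R C _ _ n (fun r => rho (X + r%:R * eta))
    (fun r => rho (X0 + r%:R * eta)) (fun y => sn y ^+ 2)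
    (fun r => wp sn c (X + r%:R * eta) - wp sn c (X0 + r%:R * eta))).
  - by move=> r rn; exact: (tends_ratio1 neta_gt0 (hX r rn)).
  - by move=> r rn; exact: (tends_ratio1 neta_gt0 (hX0 r rn)).
  - move=> r rn; apply: (tends_near (f := fun=> wp sn c (X + r%:R * eta) - wp sn c (X0 + r%:R * eta))).
      2: exact: tends_cst.
    apply: filterS yn => y /= hy.
    have sy : sn y != 0 by apply: contraNneq hy => ->; rewrite mul0r.
    have W := @wp_sub _ sn (sg_weierstrass neta_gt0) c.
    have hs0 : sn 0 = 0 := sg0 neta_gt0.
    have E1 := W _ y hs0 hc (hX r rn) sy; have E2 := W _ y hs0 hc (hX0 r rn) sy.
    (* Inserting the value at [y] makes each difference an instance of [wp_sub] with second point
       [y]. *)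
    have -> : wp sn c (X + r%:R * eta) - wp sn c (X0 + r%:R * eta) =
      (wp sn c (X + r%:R * eta) - wp sn c y) - (wp sn c (X0 + r%:R * eta) - wp sn c y) by ring.
    rewrite -E1 -E2 /rho; move: (hX r rn) (hX0 r rn); move: (sn (X + _)) (sn (X0 + _)).
    by move=> u v u0 v0; field; rewrite u0 v0 sy.
have prodrho Y y : (forall r, (r < n)%N -> sn (Y + r%:R * eta) != 0) ->
    \prod_(r < n) rho (Y + r%:R * eta) y = sg eta (Y + y) * sg eta (Y - y) / sg eta Y ^+ 2.
  move=> hY; rewrite /rho !big_split /= prodfV prodrXl hp.
  have -> : \prod_(i < n) sn (Y + i%:R * eta + y) = p * sg eta (Y + y).
    by rewrite -hp; apply: eq_bigr => r _; congr sn; ring.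
  have -> : \prod_(i < n) sn (Y + i%:R * eta - y) = p * sg eta (Y - y).
    by rewrite -hp; apply: eq_bigr => r _; congr sn; ring.
  by field; rewrite p0 nz.
apply: (tends_unique _ lim1).
apply: (tends_near (f := fun y => ((sg eta y / y) / (sn y / y)) ^+ 2 *
   (sg eta (X + X0) * sg eta (X - X0) / (sg eta X ^+ 2 * sg eta X0 ^+ 2)))); last first.
  apply: tendsM (tends_cst _); apply: tendsX; apply: tendsM => //; exact: tendsV.
have hy0 : ((0 : C)^') [set y : C | y != 0] by apply/dnbhsC; exists 1.
apply: filterS (filterI hy0 (filterI y1 yn)) => y [/= y0 [hy1 hyn]].
have sy : sn y != 0 by apply: contraNneq hyn => ->; rewrite mul0r.
have s1y : sg eta y != 0 by apply: contraNneq hy1 => ->; rewrite mul0r.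
rewrite !prodrho //.
have W := sg_weierstrass eta_gt0 X X0 y 0.
rewrite !addr0 !subr0 in W.
move: W sX sX0 s1y sy; move: (sg eta (X + X0)) (sg eta (X - X0)) => e1 e2.
move: (sg eta (X + y)) (sg eta (X - y)) (sg eta (X0 + y)) (sg eta (X0 - y)) => e3 e4 e5 e6.
move: (sg eta X) (sg eta X0) (sg eta y) (sn y) => a b u v W a0 b0 u0 v0.
apply: (mulIf (_ : a ^+ 2 * b ^+ 2 * v ^+ 2 != 0)); first by rewrite !mulf_neq0 ?expf_neq0.
transitivity (e1 * e2 * (u * u)); first by field; rewrite y0 a0 b0 v0.
have -> : e1 * e2 * (u * u) = e3 * e4 * (b * b) - a * a * (e5 * e6).
  by apply/eqP; rewrite -subr_eq0; apply/eqP; rewrite -[RHS]W; ring.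
by field; rewrite a0 b0 v0.
Qed.

End ScalarSumLattice.

HB.lock Definition hexp (R : realType) (n : nat) (eta z : R[i]) : R[i] :=
  ee (n%:R * z / 2 - n%:R * z ^+ 2 / (2 * eta)).

HB.lock Definition eroot (R : realType) (n : nat) (al : int) : R[i] :=
  ee (al%:~R / (2 * n%:R)).

(** * The R-matrix and its unitarity *)

Section TensorBasis.
Variable R : realType.
Local Notation C := R[i].
Variables (n k : nat) (eta : C).
Hypothesis n0 : (0 < n)%N.

Lemma prod_skip (F : int -> C) (m : int) : F (m %% n%:Z)%Z != 0 ->
  \prod_(a < n | a%:Z != (m %% n%:Z)%Z) F a%:Z = (\prod_(a < n) F a%:Z) / F (m %% n%:Z)%Z.
Proof.
have nz : n%:Z != 0 by rewrite eqz_nat -lt0n.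
have lt : (`|(m %% n%:Z)%Z|%N < n)%N.
  by have := modz_ge0 m nz; have := ltz_mod m nz; lia.
move=> F0; rewrite [in RHS](bigD1 (Ordinal lt)) //=.
have -> : (`|(m %% n%:Z)%Z|%N)%:Z = (m %% n%:Z)%Z by have := modz_ge0 m nz; lia.
rewrite mulrAC divff // mul1r; apply: eq_bigl => a.
by rewrite -(inj_eq val_inj) /=; have := modz_ge0 m nz; lia.
Qed.

Lemma theta_n_mod (al : int) (z : C) : theta_n n eta (al %% n%:Z)%Z z = theta_n n eta al z.
Proof. by rewrite /theta_n modz_mod. Qed.

Lemma theta_n_shift (al u : int) (z : C) : theta_n n eta (al + u * n%:Z) z = theta_n n eta al z.
Proof. by rewrite /theta_n addrC modzMDl. Qed.

Lemma Rcoef_shift tau z (i j r u v w : int) :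
  Rcoef n k eta tau z (i + u * n%:Z) (j + v * n%:Z) (r + w * n%:Z) = Rcoef n k eta tau z i j r.
Proof.
rewrite /Rcoef.
have -> : j + v * n%:Z - (i + u * n%:Z) - (r + w * n%:Z) = j - i - r + (v - u - w) * n%:Z by ring.
have -> : j + v * n%:Z - (i + u * n%:Z) + (r + w * n%:Z) * (k%:Z - 1)
   = j - i + r * (k%:Z - 1) + (v - u + w * (k%:Z - 1)) * n%:Z by ring.
have -> : k%:Z * (r + w * n%:Z) = k%:Z * r + k%:Z * w * n%:Z by ring.
by rewrite !theta_n_shift [_ + _ * n%:Z]addrC modzMDl.
Qed.

(* [enc i j] is the index of x_i (x) x_j, with [i] and [j] taken modulo [n]. *)
Lemma enc_lt (i j : int) : (`|(i %% n%:Z)%Z| * n + `|(j %% n%:Z)%Z| < n * n)%N.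
Proof.
have nz : n%:Z != 0 by rewrite eqz_nat -lt0n.
have := modz_ge0 i nz; have := ltz_mod i nz; have := modz_ge0 j nz; have := ltz_mod j nz.
nia.
Qed.

Definition enc (i j : int) : 'I_(n * n) := Ordinal (enc_lt i j).

Lemma fst_enc i j : fst_idx (enc i j) = (i %% n%:Z)%Z.
Proof.
have nz : n%:Z != 0 by rewrite eqz_nat -lt0n.
have := modz_ge0 i nz; have := ltz_mod i nz; have := modz_ge0 j nz; have := ltz_mod j nz.
rewrite /fst_idx /= => h1 h2 h3 h4.
by rewrite divnMDl // divn_small; lia.
Qed.

Lemma snd_enc i j : snd_idx (enc i j) = (j %% n%:Z)%Z.
Proof.
have nz : n%:Z != 0 by rewrite eqz_nat -lt0n.
have := modz_ge0 i nz; have := ltz_mod i nz; have := modz_ge0 j nz; have := ltz_mod j nz.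
rewrite /snd_idx /= => h1 h2 h3 h4.
by rewrite modnMDl modn_small; lia.
Qed.

Lemma enc_idx (q : 'I_(n * n)) : enc (fst_idx q) (snd_idx q) = q.
Proof.
apply/val_inj; rewrite /= /fst_idx /snd_idx.
have h : (q %/ n < n)%N by rewrite ltn_divLR // ltn_ord.
by rewrite !modz_nat !absz_nat modn_mod (modn_small h) -divn_eq.
Qed.

Lemma enc_eqP (i j : int) (l : 'I_(n * n)) :
  (l == enc i j) = ((fst_idx l - i) %% n%:Z == 0)%Z && ((snd_idx l - j) %% n%:Z == 0)%Z.
Proof.
have nz : n%:Z != 0 by rewrite eqz_nat -lt0n.
have E (a b : int) : ((a - b) %% n%:Z == 0)%Z = ((a %% n%:Z)%Z == (b %% n%:Z)%Z).
  by rewrite -[RHS]/(a == b %[mod n%:Z])%Z eqz_mod_dvd (sameP dvdz_mod0P eqP).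
rewrite !E; apply/eqP/andP => [->|[/eqP h1 /eqP h2]].
  by rewrite fst_enc snd_enc !modz_mod !eqxx.
by rewrite -(enc_idx l); apply/val_inj; rewrite /= h1 h2.
Qed.

Lemma RmxE tau z (q l : 'I_(n * n)) :
  Rmx n k eta tau z q l =
  \sum_(r < n) (if l == enc (snd_idx q - r%:Z) (fst_idx q + r%:Z)
                then Rcoef n k eta tau z (fst_idx q) (snd_idx q) r%:Z else 0).
Proof. by rewrite mxE; apply: eq_bigr => r _; rewrite enc_eqP. Qed.

Lemma Rcoef_modz tau z (i j r : int) :
  Rcoef n k eta tau z (i %% n%:Z)%Z (j %% n%:Z)%Z r = Rcoef n k eta tau z i j r.
Proof.
rewrite {2}(divz_eq i n%:Z) {2}(divz_eq j n%:Z) -[r in RHS](addr0 r) -(mul0r n%:Z).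
by rewrite [(_ %/ _)%Z * _ + (i %% _)%Z]addrC [(_ %/ _)%Z * _ + (j %% _)%Z]addrC Rcoef_shift.
Qed.

Lemma enc_modz (i j : int) : enc (i %% n%:Z)%Z (j %% n%:Z)%Z = enc i j.
Proof. by apply/val_inj; rewrite /= !modz_mod. Qed.

Lemma enc_shift (i j u v : int) : enc (i + u * n%:Z) (j + v * n%:Z) = enc i j.
Proof. by apply/val_inj; rewrite /= ![_ + _ * n%:Z]addrC !modzMDl. Qed.

Lemma Rmx_enc tau z (i j : int) (l : 'I_(n * n)) :
  Rmx n k eta tau z (enc i j) l =
  \sum_(r < n) (if l == enc (j - r%:Z) (i + r%:Z) then Rcoef n k eta tau z i j r%:Z else 0).
Proof.
rewrite RmxE fst_enc snd_enc; apply: eq_bigr => r _; rewrite Rcoef_modz.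
have -> : enc ((j %% n%:Z)%Z - r%:Z) ((i %% n%:Z)%Z + r%:Z) = enc (j - r%:Z) (i + r%:Z) => //.
rewrite -[in LHS](enc_shift _ _ (j %/ n%:Z)%Z (i %/ n%:Z)%Z); congr enc.
  by rewrite {3}(divz_eq j n%:Z); ring.
by rewrite {3}(divz_eq i n%:Z); ring.
Qed.

(** A shift [r] followed by a shift [s] sends the indices [(i, j)] to [(i - t, j + t)] with
    [t = s - r]. Summing over [t] instead of [s] collects one matrix entry in the inner sum. *)
Lemma Rmx_mul tau z w (i j : int) (l : 'I_(n * n)) :
  (Rmx n k eta tau z *m Rmx n k eta tau w) (enc i j) l =
  \sum_(t < n) (if l == enc (i - t%:Z) (j + t%:Z) then
     \sum_(r < n) Rcoef n k eta tau z i j r%:Z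
        * Rcoef n k eta tau w (j - r%:Z) (i + r%:Z) (r%:Z + t%:Z) else 0).
Proof.
rewrite mxE; under eq_bigr => p _ do rewrite Rmx_enc mulr_suml.
rewrite exchange_big /=.
transitivity (\sum_(r < n) Rcoef n k eta tau z i j r%:Z
    * Rmx n k eta tau w (enc (j - r%:Z) (i + r%:Z)) l).
  apply: eq_bigr => r _; rewrite (bigD1 (enc (j - r%:Z) (i + r%:Z))) //= eqxx.
  by rewrite big1 ?addr0 // => p /negPf ->; rewrite mul0r.
transitivity (\sum_(r < n) \sum_(t < n) (if l == enc (i - t%:Z) (j + t%:Z) then
     Rcoef n k eta tau z i j r%:Z * Rcoef n k eta tau w (j - r%:Z) (i + r%:Z) (r%:Z + t%:Z) else 0)).
  apply: eq_bigr => r _; rewrite Rmx_enc.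
  pose G (s : int) : C := if l == enc (i + r%:Z - s) (j - r%:Z + s)
    then Rcoef n k eta tau w (j - r%:Z) (i + r%:Z) s else 0.
  have hG s : G (s + n%:Z) = G s.
    rewrite /G; have -> : enc (i + r%:Z - (s + n%:Z)) (j - r%:Z + (s + n%:Z)) =
        enc (i + r%:Z - s) (j - r%:Z + s).
      rewrite -(enc_shift (i + r%:Z - s) _ (-1) 1); congr enc; ring.
    by rewrite -(Rcoef_shift tau w (j - r%:Z) (i + r%:Z) s 0 0 1) !mul0r !addr0 mul1r.
  rewrite -[X in _ * X](periodic_sum_shift n0 r%:Z hG) mulr_sumr; apply: eq_bigr => t _.
  rewrite /G; have -> : i + r%:Z - (t%:Z + r%:Z) = i - t%:Z by ring.
  have -> : j - r%:Z + (t%:Z + r%:Z) = j + t%:Z by ring.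
  by rewrite [t%:Z + _]addrC; case: ifP => _ //; rewrite mulr0.
rewrite exchange_big /=; apply: eq_bigr => t _.
by case: ifP => _ //; rewrite big1.
Qed.

End TensorBasis.

Section Unitarity.
Variable R : realType.
Local Notation C := R[i].
Variables (n k : nat) (eta : C).
Hypothesis eta_gt0 : 0 < complex.Im eta.
Hypothesis n1 : (1 < n)%N.
Hypothesis nk : coprime n k.

Let n0 : (0 < n)%N. Proof. exact: ltnW. Qed.
Let nR : n%:R != 0 :> C. Proof. by rewrite pnatr_eq0 -lt0n. Qed.
Let eta0 : eta != 0. Proof. exact: eta_neq0. Qed.
Let neta_gt0 : 0 < complex.Im (n%:R * eta). Proof. exact: Im_neta. Qed.
Let two0 : 2 != 0 :> C. Proof. by rewrite pnatr_eq0. Qed.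

Local Notation s1 := (sg eta).
Local Notation sn := (sg (n%:R * eta)).

Lemma lat_sg (w : C) : s1 (n%:R * w) = 0 <-> in_lat n eta w.
Proof.
rewrite (sg_eq0 eta_gt0); split=> -[a [b h]]; exists a, b.
  by rewrite -h mulrC mulKf.
by rewrite h mulrC divfK.
Qed.

Lemma lat_sgn (w : C) (al : int) : sn (n%:R * w + al%:~R * eta) = 0 -> in_lat n eta w.
Proof.
move=> /(sg_eq0 neta_gt0)[a [b h]]; exists a, (b * n%:Z - al).
apply: (mulfI nR); rewrite [RHS]mulrC divfK // rmorphB rmorphM /= -pmulrn.
by apply: (addIr (al%:~R * eta)); rewrite h; ring.
Qed.

Lemma latN (w : C) : in_lat n eta (- w) <-> in_lat n eta w.
Proof.
have H v : in_lat n eta v -> in_lat n eta (- v).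
  by move=> [a [b ->]]; exists (- a), (- b); rewrite !rmorphN /=; field.
by split=> /H; rewrite ?opprK.
Qed.

Lemma sgn_lat0 (t : int) : sn (t%:~R * eta) = 0 -> (n%:Z %| t)%Z.
Proof.
move=> /(sg_eq0 neta_gt0)[a [b h]].
have h2 : (t - b * n%:Z)%:~R * eta = a%:~R.
  by rewrite rmorphB rmorphM /= -pmulrn mulrBl h; ring.
have h3 : (t - b * n%:Z)%:~R * complex.Im eta = 0 :> R.
  have := congr1 (@complex.Im R) h2.
  have -> : (t - b * n%:Z)%:~R = ((t - b * n%:Z)%:~R)%:C :> C by rewrite rmorph_int.
  have -> : a%:~R = (a%:~R)%:C :> C by rewrite rmorph_int.
  by case: (eta) => x y /=; rewrite mul0r addr0.
move/eqP: h3; rewrite mulf_eq0 (gt_eqF eta_gt0) orbF intr_eq0 subr_eq0 => /eqP ->.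
exact: dvdz_mull.
Qed.

Local Notation hexp := (hexp n eta).
Local Notation eroot := (@eroot R n).

Lemma hexp_neq0 (z : C) : hexp z != 0.
Proof. by rewrite hexp.unlock; exact: ee_neq0. Qed.

Lemma eroot_neq0 al : eroot al != 0.
Proof. by rewrite eroot.unlock; exact: ee_neq0. Qed.

Lemma erootD al be : eroot (al + be) = eroot al * eroot be.
Proof. by rewrite eroot.unlock -eeD rmorphD /= mulrDl. Qed.

Lemma theta_n_hexp : exists2 c : C, c != 0 & forall (al : int) (z : C),
  theta_n n eta al z = c * hexp z * (eroot al * sn (n%:R * z + al%:~R * eta)).
Proof. by rewrite hexp.unlock eroot.unlock; exact: theta_nE. Qed.

(** Since [j - i + r (k - 1)] is the sum of [j - i - r] and [k r], the three thetas form one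
    Kronecker function: the roots of unity cancel, and the Gaussian factors do not depend on [i],
    [j], [r]. Off the lattice the skipped factor may be put back and divided out. *)
Lemma Rcoef_kro (tau : C) : ~ in_lat n eta tau -> exists2 mu : C, mu != 0 &
  forall z, ~ in_lat n eta z -> forall i j r,
    Rcoef n k eta tau z i j r =
    mu * hexp (- z) ^+ n.-1 * hexp (tau - z) * s1 (n%:R * z)
    * kro sn (n%:R * tau + (k%:Z * r)%:~R * eta) (- (n%:R * z) + (j - i - r)%:~R * eta).
Proof.
move=> htau; have [c c0 hth] := theta_n_hexp.
have [p p0 hp] := sg_prod eta_gt0 n0.
pose D := \prod_(a < n | (0 < a)%N) theta_n n eta a%:Z 0.
have nth al v : sn (n%:R * v + al%:~R * eta) != 0 -> theta_n n eta al v != 0.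
  move=> h; rewrite hth; apply: mulf_neq0; last by apply: mulf_neq0 => //; exact: eroot_neq0.
  by apply: mulf_neq0 => //; exact: hexp_neq0.
have D0 : D != 0.
  apply/prodf_neq0 => a a0; apply: nth.
  apply/eqP; rewrite mulr0 add0r => /sgn_lat0 /dvdzP[m hm].
  by have := ltn_ord a; case: m hm => [[|m]|m] hm; nia.
pose e1 : C := \prod_(a < n) eroot a%:Z.
have e10 : e1 != 0 by apply/prodf_neq0 => a _; exact: eroot_neq0.
have tau0 al : sn (n%:R * tau + al%:~R * eta) != 0 by apply/eqP => /lat_sgn.
have hN := hexp_neq0.
exists (- (c ^+ n.-1 * e1 * p / (D * hexp tau))).
  have h1 : D * hexp tau != 0 by exact: mulf_neq0.
  have h2 : c ^+ n.-1 != 0 by exact: expf_neq0.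
  have h3 : c ^+ n.-1 * e1 != 0 by exact: mulf_neq0.
  have h4 : c ^+ n.-1 * e1 * p != 0 by exact: mulf_neq0.
  by rewrite oppr_eq0; apply: mulf_neq0 => //; rewrite invr_eq0.
move=> z hz i j r.
have z0 al : sn (- (n%:R * z) + al%:~R * eta) != 0.
  by apply/eqP; rewrite -mulrN => /lat_sgn/latN.
have hth0 al : theta_n n eta al (- z) != 0.
  by apply: nth; rewrite mulrN.
have full : \prod_(a < n) theta_n n eta a%:Z (- z) = c ^+ n * hexp (- z) ^+ n * e1 * p * - s1 (n%:R * z).
  transitivity (\prod_(a < n) (c * hexp (- z) * (eroot a%:Z * sn (n%:R * - z + a%:R * eta)))).
    by apply: eq_bigr => a _; rewrite hth.
  rewrite !big_split /= hp !prodr_const !card_ord mulrN (sg_odd eta_gt0).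
  by rewrite -/e1; ring.
rewrite /Rcoef (prod_skip n0 (F := fun a => theta_n n eta a (- z))) ?hth0 // full theta_n_mod -/D.
have -> : j - i + r * (k%:Z - 1) = (j - i - r) + k%:Z * r by ring.
move: (j - i - r) (k%:Z * r) => al be.
rewrite !hth /kro [n%:R * - z]mulrN.
have -> : n%:R * (- z + tau) + (al + be)%:~R * eta =
   n%:R * tau + be%:~R * eta + (- (n%:R * z) + al%:~R * eta) by rewrite rmorphD /=; ring.
rewrite erootD.
have -> : c ^+ n = c * c ^+ n.-1 by rewrite -exprS prednK.
have -> : hexp (- z) ^+ n = hexp (- z) * hexp (- z) ^+ n.-1 by rewrite -exprS prednK.
rewrite [- z + tau]addrC.
have [A eA] : exists A, A = sn (- (n%:R * z) + al%:~R * eta) by eexists.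
have [B eB] : exists B, B = sn (n%:R * tau + be%:~R * eta) by eexists.
have [E eE] : exists E, E = sn (n%:R * tau + be%:~R * eta + (- (n%:R * z) + al%:~R * eta)) by eexists.
have A0 : A != 0 by rewrite eA. have B0 : B != 0 by rewrite eB.
rewrite -eA -eB -eE; move: (hN (- z)) (hN tau).
move: (eroot_neq0 al) (eroot_neq0 be).
move: (eroot al) (eroot be) (hexp (- z)) (hexp tau) (hexp (tau - z)) (s1 (n%:R * z)).
move=> x1 x2 x3 x4 x5 x6 h1 h2 h3 h4.
move: (c ^+ n.-1) (x3 ^+ n.-1) => y1 y2.
by field; rewrite A0 B0 D0 c0 h1 h2 h3 h4.
Qed.

Lemma kro_per1 x y (m : int) : kro sn (x + m%:~R * (n%:R * eta)) y = kro sn x y.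
Proof.
rewrite /kro addrAC !(sg_addz neta_gt0) -[X in _ / X]mulrA invfM mulrACA divff ?mul1r //.
by rewrite expfz_neq0 // oppr_eq0 oner_eq0.
Qed.

Lemma kro_per2 x y (m : int) : kro sn x (y + m%:~R * (n%:R * eta)) = kro sn x y.
Proof.
rewrite /kro addrA !(sg_addz neta_gt0) [sn x * _]mulrCA [X in _ * X]invfM mulrACA divff ?mul1r //.
by rewrite expfz_neq0 // oppr_eq0 oner_eq0.
Qed.

Section CoreSum.
Variables tau z : C.
Hypothesis htau : ~ in_lat n eta tau.
Hypothesis hz : ~ in_lat n eta z.

Definition Apt (r : int) : C := n%:R * tau + (k%:Z * r)%:~R * eta.
Definition Ypt (d r : int) : C := n%:R * z + (r - d)%:~R * eta.

Let A0 r : sn (Apt r) != 0. Proof. by apply/eqP => /lat_sgn. Qed.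
Let Y0 d r : sn (Ypt d r) != 0. Proof. by apply/eqP => /lat_sgn. Qed.
Let YN0 d r : sn (- Ypt d r) != 0. Proof. by rewrite (sg_odd neta_gt0) oppr_eq0. Qed.

(** By Fay's identity the summand is [G r - G (r + t)] with [G] periodic modulo [n]. That [n]
    divides neither [t] nor, by coprimality, [k * t] keeps the two extra denominators of the
    identity non-zero. *)
Lemma core_sum_off (d t : int) : ~~ (n%:Z %| t)%Z ->
  \sum_(r < n) kro sn (Apt r%:Z) (- Ypt d r%:Z) * kro sn (Apt (r%:Z + t)) (Ypt d (r%:Z - t)) = 0.
Proof.
move=> ht; pose G r := kro sn (Apt r) (- t%:~R * eta) * kro sn ((k%:Z * t)%:~R * eta) (Ypt d (r - t)).
have hG r : G (r + n%:Z) = G r.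
  rewrite /G; have -> : Apt (r + n%:Z) = Apt r + k%:Z%:~R * (n%:R * eta).
    by rewrite /Apt !rmorphM rmorphD /= -!pmulrn; ring.
  have -> : Ypt d (r + n%:Z - t) = Ypt d (r - t) + 1%:~R * (n%:R * eta).
    by rewrite /Ypt !rmorphB rmorphD /= -!pmulrn; ring.
  by rewrite kro_per1 kro_per2.
rewrite -[RHS](subrr (\sum_(r < n) G r%:Z)) -{2}(periodic_sum_shift n0 t hG) -sumrB.
apply: eq_bigr => r _; rewrite /G.
have dif : Apt r%:Z - Apt (r%:Z + t) = - ((k%:Z * t)%:~R * eta).
  by rewrite /Apt !rmorphM rmorphD /=; ring.
have dif2 : Apt (r%:Z + t) - Apt r%:Z = (k%:Z * t)%:~R * eta by rewrite -opprB dif opprK.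
have sumY : - Ypt d r%:Z + Ypt d (r%:Z - t) = - t%:~R * eta.
  by rewrite /Ypt !rmorphB /=; ring.
rewrite (fay (sg_odd neta_gt0) (sg_weierstrass neta_gt0) two0) ?A0 ?Y0 ?YN0 //.
- rewrite sumY dif2 dif.
  have -> : Ypt d (r%:Z + t - t) = Ypt d r%:Z by rewrite addrK.
  by rewrite (kroN (sg_odd neta_gt0)) mulrN.
- rewrite dif (sg_odd neta_gt0) oppr_eq0; apply/eqP => /sgn_lat0.
  by rewrite Gauss_dvdzr ?(negPf ht).
- by rewrite sumY mulNr (sg_odd neta_gt0) oppr_eq0; apply/eqP => /sgn_lat0; rewrite (negPf ht).
Qed.

(** At [t = 0] Fay's identity degenerates; each product of two Kronecker values is instead a
    difference of values of [wp]. As [k] is a unit modulo [n], the points with [k * r] run through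
    the same translates as those with [r]. *)
Lemma core_sum_diag (c : C) (L : C) (d : int) : sn c != 0 ->
  (forall X X0,
    (forall r, (r < n)%N -> sn (X + r%:R * eta) != 0) ->
    (forall r, (r < n)%N -> sn (X0 + r%:R * eta) != 0) ->
    \sum_(r < n) wp sn c (X + r%:R * eta) - \sum_(r < n) wp sn c (X0 + r%:R * eta)
    = L * (s1 (X + X0) * s1 (X - X0) / (s1 X ^+ 2 * s1 X0 ^+ 2))) ->
  \sum_(r < n) kro sn (Apt r%:Z) (- Ypt d r%:Z) * kro sn (Apt r%:Z) (Ypt d r%:Z) =
  - L * (s1 (n%:R * tau + n%:R * z) * s1 (n%:R * tau - n%:R * z)
         / (s1 (n%:R * tau) ^+ 2 * s1 (n%:R * z) ^+ 2)).
Proof.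
move=> hc hL; rewrite mulNr -hL.
- have per X r : wp sn c (X + (r + n%:Z)%:~R * eta) = wp sn c (X + r%:~R * eta).
    rewrite -[RHS](wp_periodic eta_gt0 n0); congr wp.
    by rewrite rmorphD /= -pmulrn; ring.
  have -> : \sum_(r < n) wp sn c (n%:R * tau + r%:R * eta) = \sum_(r < n) wp sn c (Apt r%:Z).
    rewrite -(periodic_sum n0 (G := fun r => wp sn c (n%:R * tau + r%:~R * eta)) 0 nk (per _)).
    by apply: eq_bigr => r _; rewrite addr0.
  have -> : \sum_(r < n) wp sn c (n%:R * z + r%:R * eta) = \sum_(r < n) wp sn c (Ypt d r%:Z).
    by rewrite -(periodic_sum_shift n0 (G := fun r => wp sn c (n%:R * z + r%:~R * eta)) (- d) (per _)).
  rewrite -sumrB -sumrN; apply: eq_bigr => r _.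
  rewrite -(wp_sub (sg_weierstrass neta_gt0) (sg0 neta_gt0) hc (A0 _) (Y0 _ _)) /kro (sg_odd neta_gt0).
  have := A0 r%:Z; have := Y0 d r%:Z; move: (sn (Apt _)) (sn (Ypt _ _)) => a b b0 a0.
  by field; rewrite a0 b0.
- by move=> r _; apply/eqP => /(@lat_sgn _ r%:Z).
- by move=> r _; apply/eqP => /(@lat_sgn _ r%:Z).
Qed.

End CoreSum.

(** The two prefactors contribute [s1 (n%:R * z) ^+ 2], which cancels the denominator of the
    diagonal sum; hence only the sigma values at [tau + z] and [tau - z] can make the scalar
    vanish. *)
Lemma unitarity_off (tau : C) : ~ in_lat n eta tau -> exists2 ka : C, ka != 0 &
  forall z, ~ in_lat n eta z ->
    Rmx n k eta tau z *m Rmx n k eta tau (- z) =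
    (ka * (hexp z * hexp (- z)) ^+ n.-1 * (hexp (tau - z) * hexp (tau + z))
     * (s1 (n%:R * (tau + z)) * s1 (n%:R * (tau - z))))%:M.
Proof.
move=> htau; have [mu mu0 hmu] := Rcoef_kro htau.
have [c hc] := sg_nonzero neta_gt0.
have [L L0 hL] := wp_sum eta_gt0 n0 hc.
have st0 : s1 (n%:R * tau) != 0 by apply/eqP => /lat_sg.
exists (mu ^+ 2 * L / s1 (n%:R * tau) ^+ 2).
  by rewrite !mulf_neq0 ?invr_eq0 ?expf_neq0.
move=> z hz; have hzN : ~ in_lat n eta (- z) by move=> /latN.
have sz0 : s1 (n%:R * z) != 0 by apply/eqP => /lat_sg.
apply/matrixP => q l; rewrite -(enc_idx n0 q); move: (fst_idx q) (snd_idx q) => i j.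
rewrite Rmx_mul [RHS]mxE.
have inner (t : 'I_n) : \sum_(r < n) Rcoef n k eta tau z i j r%:Z
        * Rcoef n k eta tau (- z) (j - r%:Z) (i + r%:Z) (r%:Z + t%:Z)
   = (mu * hexp (- z) ^+ n.-1 * hexp (tau - z) * s1 (n%:R * z))
     * (mu * hexp z ^+ n.-1 * hexp (tau + z) * - s1 (n%:R * z))
     * \sum_(r < n) kro sn (Apt tau r%:Z) (- Ypt z (j - i) r%:Z)
        * kro sn (Apt tau (r%:Z + t%:Z)) (Ypt z (j - i) (r%:Z - t%:Z)).
  rewrite mulr_sumr; apply: eq_bigr => r _; rewrite (hmu z hz) (hmu (- z) hzN) opprK.
  have -> : - (n%:R * z) + (j - i - r%:Z)%:~R * eta = - Ypt z (j - i) r%:Z.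
    by rewrite /Ypt !rmorphB /=; ring.
  have -> : - (n%:R * - z) + (i + r%:Z - (j - r%:Z) - (r%:Z + t%:Z))%:~R * eta = Ypt z (j - i) (r%:Z - t%:Z).
    by rewrite /Ypt !rmorphB !rmorphD /=; ring.
  rewrite -/(Apt tau r%:Z) -/(Apt tau (r%:Z + t%:Z)) [n%:R * - z]mulrN (sg_odd eta_gt0).
  move: (kro _ _ _) (kro _ _ _) => k1 k2; ring.
have inner0 := inner (Ordinal n0); rewrite /= in inner0.
rewrite (bigD1 (Ordinal n0)) //= inner0 subr0 addr0.
rewrite [X in _ + X]big1 ?addr0; last first.
  move=> t t0; case: ifP => // _; rewrite inner core_sum_off ?mulr0 //.
  apply/negP => /dvdzP[m hm]; move: t0; rewrite -(inj_eq val_inj) /=; have := ltn_ord t.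
  by case: m hm => [[|m]|m] hm; nia.
have -> : \sum_(r < n) kro sn (Apt tau r%:Z) (- Ypt z (j - i) r%:Z)
        * kro sn (Apt tau (r%:Z + 0%:Z)) (Ypt z (j - i) (r%:Z - 0%:Z)) =
   - L * (s1 (n%:R * tau + n%:R * z) * s1 (n%:R * tau - n%:R * z)
         / (s1 (n%:R * tau) ^+ 2 * s1 (n%:R * z) ^+ 2)).
  rewrite -(core_sum_diag htau hz (j - i) hc hL); apply: eq_bigr => r _.
  by congr (_ * kro _ (Apt _ _) (Ypt _ _ _)); lia.
rewrite eq_sym; case: ifP => _; rewrite ?mulr1n ?mulr0n //.
rewrite [n%:R * (tau + z)]mulrDr [n%:R * (tau - z)]mulrBr [(hexp z * hexp (- z)) ^+ n.-1]exprMn.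
move: (hexp z ^+ n.-1) (hexp (- z) ^+ n.-1) => x1 x2.
by field; rewrite st0 sz0.
Qed.

End Unitarity.

(** * Ranks and determinants of families of matrices *)

Section MatrixFamilies.
Variable R : realType.
Local Notation C := R[i].

Lemma prod_if_lt (m r : nat) (x : C) : (r <= m)%N ->
  \prod_(i < m) (if (i < r)%N then 1 else x) = x ^+ (m - r).
Proof.
elim: m => [|m IH]; first by rewrite leqn0 => /eqP ->; rewrite big_ord0.
rewrite leq_eqVlt => /orP[/eqP ->|rm].
  rewrite subnn expr0 big1 // => i _; by rewrite ltn_ord.
by rewrite big_ord_recr /= IH // ltnNge -ltnS rm /= subSn // exprSr.
Qed.

Lemma det_row_scale (m : nat) (a : 'I_m -> C) (P : 'M[C]_m) :
  \det (\matrix_(i, j) (a i * P i j)) = (\prod_i a i) * \det P.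
Proof.
have -> : (\matrix_(i, j) (a i * P i j)) = diag_mx (\row_i a i) *m P.
  by apply/matrixP => i j; rewrite mul_diag_mx !mxE.
by rewrite det_mulmx det_diag; congr (_ * _); apply: eq_bigr => i _; rewrite mxE.
Qed.

(* Bring [M p] to the form [pid_mx r]; then every row of index at least [r] is divisible by
   [z - p]. *)
Lemma det_order (m : nat) (M : C -> 'M[C]_m) (p : C) :
  (forall i j, cdiff (fun z => M z i j) p) ->
  exists D, tends (p^') (fun z => \det (M z) / (z - p) ^+ nullity (M p)) D.
Proof.
move=> hM; pose r := \rank (M p).
pose L := col_ebase (M p); pose U := row_ebase (M p).
have Lu : L \in unitmx by exact: col_ebase_unit.
have Uu : U \in unitmx by exact: row_ebase_unit.
pose N z := invmx L *m M z *m invmx U.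
have hNp : N p = pid_mx r.
  by rewrite /N -{1}(mulmx_ebase (M p)) -/L -/U !mulmxA mulVmx // mul1mx mulmxK.
have hN i j : cdiff (fun z => N z i j) p.
  have -> : (fun z => N z i j) = fun z => \sum_l (\sum_h invmx L i h * M z h l) * invmx U l j.
    apply/funext => z; rewrite /N mxE; apply: eq_bigr => l _; by rewrite mxE.
  apply: cdiff_sum => l _; apply: cdiffMr; apply: cdiff_sum => h _; exact: cdiffMl.
have [Q hQ] := choice (fun ij : 'I_m * 'I_m => hN ij.1 ij.2).
pose P z := \matrix_(i, j) (if (i < r)%N then N z i j else Q (i, j) z).
have tP i j : exists d, tends (p^') (fun z => P z i j) d.
  have [d [hd td]] := hQ (i, j).
  case: (boolP (i < r)%N) => ir; eexists.
    apply: (tends_ext (f := fun z => N z i j)); first by move=> z; rewrite [RHS]mxE ir.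
    exact: (tends_mono (@dnbhs_sub _ p) (cdiff_cont (hN i j))).
  apply: (tends_ext (f := Q (i, j))); first by move=> z; rewrite [RHS]mxE (negPf ir).
  exact: (tends_mono (@dnbhs_sub _ p) td).
have [d hd] := choice (fun ij : 'I_m * 'I_m => tP ij.1 ij.2).
have tdet : tends (p^') (fun z => \det (P z)) (\det (\matrix_(i, j) d (i, j))).
  by apply: tends_det => i j; rewrite mxE; exact: (hd (i, j)).
exists (\det L * \det (\matrix_(i, j) d (i, j)) * \det U).
apply: (tends_near (f := fun z => \det L * \det (P z) * \det U)); last first.
  by apply: tendsM (tends_cst _); apply: tendsMl.
apply/dnbhsC; exists 1 => // z zp _ /=.
have zp0 : z - p != 0 by rewrite subr_eq0.
have hz : N z = \matrix_(i, j) ((if (i < r)%N then 1 else z - p) * P z i j).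
  apply/matrixP => i j; rewrite [RHS]mxE [P z i j]mxE; case: (boolP (i < r)%N) => ir; first by rewrite mul1r.
  have [e [he _]] := hQ (i, j); rewrite /= in he; rewrite he hNp [pid_mx r i j]mxE.
  by rewrite (negPf ir) andbF add0r.
have -> : M z = L *m N z *m U by rewrite /N !mulmxA mulmxV // mul1mx mulmxKV.
rewrite det_mulmx [\det (L *m _)]det_mulmx hz det_row_scale prod_if_lt ?rank_leq_row // /nullity -/r.
have h := expf_neq0 (m - r) zp0; move: h; move: ((z - p) ^+ (m - r)) => x x0.
by field.
Qed.

(** A compression of [M0] to size [\rank M0] is the identity; its determinant stays non-zero nearby,
    and compressing cannot raise the rank. *)
Lemma rank_lsc (T : Type) (F : set_system T) (FF : Filter F) (m : nat)
    (M : T -> 'M[C]_m) (M0 : 'M[C]_m) :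
  (forall i j, tends F (fun t => M t i j) (M0 i j)) ->
  F [set t | (\rank M0 <= \rank (M t))%N].
Proof.
move=> hM; pose r := \rank M0.
pose A : 'M[C]_(r, m) := pid_mx r *m invmx (col_ebase M0).
pose B : 'M[C]_(m, r) := invmx (row_ebase M0) *m pid_mx r.
have rm : (r <= m)%N by exact: rank_leq_row.
have hAB : A *m M0 *m B = 1%:M.
  have e := mulmx_ebase M0; rewrite /A /B -[X in _ *m X *m _]e !mulmxA.
  rewrite mulmxKV ?col_ebase_unit // mulmxK ?row_ebase_unit //.
  by rewrite !pid_mx_id // pid_mx_1.
have td : tends F (fun t => \det (A *m M t *m B)) (\det (A *m M0 *m B)).
  apply: tends_det; apply: tends_mulmx; last by move=> i j; exact: tends_cst.
  by apply: tends_mulmx => // i j; exact: tends_cst.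
have d0 : \det (A *m M0 *m B) != 0 by rewrite hAB det1 oner_neq0.
apply: filterS (tends_neq0 d0 td) => t /= ht.
have : A *m M t *m B \in unitmx by rewrite unitmxE unitfE.
rewrite -row_free_unit -row_leq_rank => h; rewrite -/r.
apply: leq_trans h _; apply: leq_trans (mxrankM_maxl _ _) _; exact: mxrankM_maxr.
Qed.

(** Selecting and rescaling rows and columns is multiplication on both sides. The index maps are
    arbitrary, so this covers submatrices as well as monomial twists. *)
Lemma rank_twist_le (m p : nat) (M : 'M[C]_m) (M' : 'M[C]_p) (c : C) (a b : 'I_p -> C)
    (f g : 'I_p -> 'I_m) :
  (forall i j, M' i j = c * (a i * b j) * M (f i) (g j)) -> (\rank M' <= \rank M)%N.
Proof.
move=> h; have -> : M' = (\matrix_(i, l) (c * a i * (f i == l)%:R)) *m M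
    *m (\matrix_(l, j) ((g j == l)%:R * b j)).
  apply/matrixP => i j; rewrite h !mxE (bigD1 (g j)) //= mxE eqxx mul1r.
  rewrite [X in _ + X]big1 ?addr0; last by move=> l lg; rewrite mxE eq_sym (negPf lg) mul0r mulr0.
  rewrite mxE (bigD1 (f i)) //= mxE eqxx mulr1 big1 ?addr0; first by ring.
  by move=> l lf; rewrite mxE eq_sym (negPf lf) mulr0 mul0r.
by apply: leq_trans (mxrankM_maxl _ _) _; exact: mxrankM_maxr.
Qed.

Lemma rank_twist (m : nat) (M M' : 'M[C]_m) (c : C) (a b : 'I_m -> C) (f f' g g' : 'I_m -> 'I_m) :
  c != 0 -> (forall i, a i != 0) -> (forall i, b i != 0) ->
  cancel f' f -> cancel g' g ->
  (forall i j, M' i j = c * (a i * b j) * M (f i) (g j)) -> \rank M' = \rank M.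
Proof.
move=> c0 a0 b0 hf hg h; apply/eqP; rewrite eqn_leq (rank_twist_le h) /=.
apply: (@rank_twist_le _ _ _ _ c^-1 (fun i => (a (f' i))^-1) (fun j => (b (g' j))^-1) f' g') => i j.
by rewrite h hf hg; field; rewrite c0 a0 b0.
Qed.

End MatrixFamilies.

(** * Multiplicities of the zeros of the determinant *)

Section SigmaTranslations.
Variable R : realType.
Local Notation C := R[i].
Variable eta : C.
Hypothesis eta_gt0 : 0 < complex.Im eta.
Let eta0 : eta != 0. Proof. exact: eta_neq0. Qed.

Lemma sg_addint X (a : int) :
  sg eta (X + a%:~R) = ee ((2 * a%:~R * X + a%:~R ^+ 2) / (2 * eta) - a%:~R / 2) * sg eta X.
Proof.
rewrite !sgE (eeD X) ee_int mulr1 mulrA; congr (_ * _).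
by rewrite -eeD; congr ee; field.
Qed.

Lemma sg_near0 : ((0 : C)^') [set X | sg eta X != 0].
Proof.
have [d d0 hd] := sg_deriv0 eta_gt0.
by apply: filterS (tends_neq0 d0 hd) => X /=; apply: contraNneq => ->; rewrite mul0r.
Qed.

Lemma tends_cdiff (T : Type) (F : set_system T) (FF : Filter F) (f : C -> C) (g : T -> C) (a : C) :
  cdiff f a -> tends F g a -> tends F (fun t => f (g t)) (f a).
Proof. by move=> /cdiff_cont h /tendsC ga; exact: (tends_comp ga h). Qed.

Lemma tends_dnbhs_id (p : C) : tends (p^') id p.
Proof. exact: tends_mono (@dnbhs_sub _ p) (tends_id p). Qed.

Lemma dnbhs_shift (p u : C) : (fun z : C => z - u) @ p^' `=>` (p - u)^'.
Proof.
move=> A /dnbhsC [e e0 h]; apply/dnbhsC; exists e => // z zp pz /=; apply: h.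
  by rewrite (inj_eq (addIr _)).
by rewrite opprB addrA addrNK.
Qed.

Section Lattice.
Variable n : nat.
Hypothesis n1 : (1 < n)%N.
Let n0 : (0 < n)%N. Proof. exact: ltnW. Qed.
Let nR : n%:R != 0 :> C. Proof. by rewrite pnatr_eq0 -lt0n. Qed.

Lemma latD (u v : C) : in_lat n eta u -> in_lat n eta v -> in_lat n eta (u + v).
Proof. by move=> [a [b ->]] [c [d ->]]; exists (a + c), (b + d); rewrite !rmorphD /=; field. Qed.

Lemma latB (u v : C) : in_lat n eta u -> in_lat n eta v -> in_lat n eta (u - v).
Proof. by move=> hu hv; apply: latD => //; apply/latN. Qed.

Lemma simple_zero (w0 : C) : in_lat n eta w0 ->
  exists2 g : C, g != 0 & tends (w0^') (fun w => sg eta (n%:R * w) / (w - w0)) g.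
Proof.
move=> [a [b hw]]; have [d d0 hd] := sg_deriv0 eta_gt0.
have hs : (fun z : C => z - w0) @ w0^' `=>` ((0 : C)^').
  by rewrite -(subrr w0); exact: dnbhs_shift.
have hm : (fun z : C => n%:R * (z - w0)) @ w0^' `=>` ((0 : C)^').
  by move=> A hA; exact: (hs _ (tends0_comp_sub nR hA)).
have hd' : tends (w0^') (fun w => sg eta (n%:R * (w - w0)) / (n%:R * (w - w0))) d.
  by move=> e e0; exact: (hm _ (hd e e0)).
pose E (w : C) := ee ((2 * a%:~R * (n%:R * (w - w0)) + a%:~R ^+ 2) / (2 * eta) - a%:~R / 2).
have hE w : sg eta (n%:R * w) = (-1) ^ b * E w * sg eta (n%:R * (w - w0)).
  have -> : n%:R * w = n%:R * (w - w0) + a%:~R + b%:~R * eta by rewrite hw; field.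
  by rewrite (sg_addz eta_gt0) sg_addint mulrA.
have tE : tends (w0^') E (E w0).
  apply: tends_ee; apply: tendsB; last exact: tends_cst.
  apply: tendsM; last exact: tends_cst.
  apply: tendsD; last exact: tends_cst.
  do 2 apply: tendsMl; apply: tendsB; [exact: tends_dnbhs_id|exact: tends_cst].
exists ((-1) ^ b * E w0 * (n%:R * d)).
  apply: mulf_neq0; last exact: mulf_neq0.
  by apply: mulf_neq0; [rewrite expfz_neq0 // oppr_eq0 oner_eq0|exact: ee_neq0].
apply: (tends_near (f := fun w => (-1) ^ b * E w * (n%:R * (sg eta (n%:R * (w - w0)) / (n%:R * (w - w0)))))).
  apply/dnbhsC; exists 1 => // w ww0 _ /=; rewrite [in RHS]hE.
  by field; rewrite nR subr_eq0 ww0.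
by apply: tendsM; apply: tendsMl.
Qed.

(** The lattice is the zero set of [w -> sg eta (n%:R * w)]: its points are isolated by the simple
    zero of sigma at 0, other points are avoided by continuity. *)
Lemma lat_isolated (z : C) : (z^') [set w | ~ in_lat n eta w].
Proof.
case: (pselect (in_lat n eta z)) => hz.
  have hs : (fun w : C => n%:R * (w - z)) @ z^' `=>` ((0 : C)^').
    have hs : (fun w : C => w - z) @ z^' `=>` ((0 : C)^') by rewrite -(subrr z); exact: dnbhs_shift.
    by move=> A hA; exact: (hs _ (tends0_comp_sub nR hA)).
  have h0 : z^' [set w | sg eta (n%:R * (w - z)) != 0] by exact: (hs _ sg_near0).
  apply: filterS h0 => w /= /eqP hw hlw; apply: hw.
  by apply/(lat_sg eta_gt0 n1)/latB.
have hz0 : sg eta (n%:R * z) != 0 by apply/eqP => /(lat_sg eta_gt0 n1).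
have ht : tends (z^') (fun w => sg eta (n%:R * w)) (sg eta (n%:R * z)).
  by apply: tends_cdiff (cdiff_sg eta_gt0 _) _; apply: tendsMl; exact: tends_dnbhs_id.
by apply: filterS (tends_neq0 hz0 ht) => w /= /eqP h /(lat_sg eta_gt0 n1).
Qed.
End Lattice.
End SigmaTranslations.

Section Multiplicities.
Variable R : realType.
Local Notation C := R[i].
Variables (n k : nat) (eta : C).
Hypothesis eta_gt0 : 0 < complex.Im eta.
Hypothesis n1 : (1 < n)%N.
Hypothesis nk : coprime n k.

Let n0 : (0 < n)%N. Proof. exact: ltnW. Qed.
Let nR : n%:R != 0 :> C. Proof. by rewrite pnatr_eq0 -lt0n. Qed.
Let eta0 : eta != 0. Proof. exact: eta_neq0. Qed.
Let neta_gt0 : 0 < complex.Im (n%:R * eta). Proof. exact: Im_neta. Qed.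

Local Notation s1 := (sg eta).
Local Notation sn := (sg (n%:R * eta)).
Local Notation hexp := (hexp n eta).
Local Notation eroot := (@eroot R n).
Local Notation Rm := (Rmx n k eta).
Local Notation lat := (in_lat n eta).

Lemma cdiff_hexp z : cdiff hexp z.
Proof.
have -> : hexp = fun z => ee (n%:R * z / 2 - n%:R * z ^+ 2 / (2 * eta)) by rewrite hexp.unlock.
apply: (cdiff_comp (f := @ee R)); last exact: cdiff_ee.
apply: cdiffD; first by apply: cdiffMr; apply: cdiffMl; exact: cdiff_id.
by apply: cdiffN; apply: cdiffMr; apply: cdiffMl; apply: cdiffM; exact: cdiff_id.
Qed.

Lemma cdiff_theta_n al z : cdiff (theta_n n eta al) z.
Proof.
have [c c0 h] := theta_n_hexp eta_gt0 n1.
have -> : theta_n n eta al = fun z => c * hexp z * (eroot al * sn (n%:R * z + al%:~R * eta)).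
  by apply/funext => w; exact: h.
apply: cdiffM; first by apply: cdiffMl; exact: cdiff_hexp.
apply: cdiffMl; apply: (cdiff_comp (f := sn)); last exact: cdiff_sg.
by apply: cdiffD; [apply: cdiffMl; exact: cdiff_id|exact: cdiff_cst].
Qed.

Lemma theta_n_neq0 al z : ~ lat z -> theta_n n eta al z != 0.
Proof.
move=> hz; have [c c0 ->] := theta_n_hexp eta_gt0 n1.
apply: mulf_neq0; first by apply: mulf_neq0 => //; exact: hexp_neq0.
apply: mulf_neq0; first exact: eroot_neq0.
by apply/eqP => /(lat_sgn eta_gt0 n1).
Qed.

Lemma Rcoef_tends (T : Type) (F : set_system T) (FF : Filter F) (ta za : T -> C) (tau z : C) i j r :
  ~ lat tau -> tends F ta tau -> tends F za z ->
  tends F (fun t => Rcoef n k eta (ta t) (za t) i j r) (Rcoef n k eta tau z i j r).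
Proof.
move=> htau tta tza; rewrite /Rcoef; apply: tendsM.
  apply: tendsM (tends_cst _); apply: tends_prod => a _.
  by apply: tends_cdiff (cdiff_theta_n _ _) _; exact: tendsN.
apply: tendsM.
  by apply: tends_cdiff (cdiff_theta_n _ _) _; apply: tendsD => //; exact: tendsN.
apply: tendsV; first exact: theta_n_neq0.
exact: tends_cdiff (cdiff_theta_n _ _) _.
Qed.

Lemma Rmx_tends (T : Type) (F : set_system T) (FF : Filter F) (ta za : T -> C) (tau z : C) :
  ~ lat tau -> tends F ta tau -> tends F za z ->
  forall q l, tends F (fun t => Rm (ta t) (za t) q l) (Rm tau z q l).
Proof.
move=> htau tta tza q l; rewrite (RmxE k eta n0).
apply: (tends_ext (fun t => esym (RmxE k eta n0 (ta t) (za t) q l))).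
apply: tends_sum => r _; case: (l == _); [exact: Rcoef_tends|exact: tends_cst].
Qed.

Lemma Rmx_cdiff tau z q l : cdiff (fun z => Rm tau z q l) z.
Proof.
have -> : (fun z => Rm tau z q l) = fun z =>
    \sum_(r < n) (if l == enc n0 (snd_idx q - r%:Z) (fst_idx q + r%:Z)
                  then Rcoef n k eta tau z (fst_idx q) (snd_idx q) r%:Z else 0).
  by apply/funext => w; exact: RmxE.
apply: cdiff_sum => r _; case: (l == _); last exact: cdiff_cst.
rewrite /Rcoef; apply: cdiffM.
  apply: cdiffMr; apply: cdiff_prod => a _.
  apply: (cdiff_comp (f := theta_n n eta a%:Z)); last exact: cdiff_theta_n.
  by apply: cdiffN; exact: cdiff_id.
apply: cdiffMr.
apply: (@cdiff_comp _ (theta_n n eta _)); last exact: cdiff_theta_n.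
by apply: cdiffD; [apply: cdiffN; exact: cdiff_id|exact: cdiff_cst].
Qed.

(** The part of the scalar in [unitarity_off] that never vanishes; the zeros of [cscal] come from
    its sigma factors. *)
Definition cexp (tau z : C) : C :=
  (hexp z * hexp (- z)) ^+ n.-1 * (hexp (tau - z) * hexp (tau + z)).

Definition cscal (tau z : C) : C :=
  cexp tau z * (s1 (n%:R * (tau + z)) * s1 (n%:R * (tau - z))).

Lemma cexp_neq0 tau z : cexp tau z != 0.
Proof.
by apply: mulf_neq0; [apply: expf_neq0|]; apply: mulf_neq0; exact: hexp_neq0.
Qed.

Lemma tends_cexp (T : Type) (F : set_system T) (FF : Filter F) tau (za : T -> C) z :
  tends F za z -> tends F (fun t => cexp tau (za t)) (cexp tau z).
Proof.
move=> hza; have h (f : T -> C) a : tends F f a -> tends F (fun t => hexp (f t)) (hexp a).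
  exact: tends_cdiff (cdiff_hexp _).
apply: tendsM; last first.
  by apply: tendsM; apply: h; [apply: tendsB|apply: tendsD] => //; exact: tends_cst.
by apply: tendsX; apply: tendsM; apply: h => //; exact: tendsN.
Qed.

Lemma tends_cscal (T : Type) (F : set_system T) (FF : Filter F) tau (za : T -> C) z :
  tends F za z -> tends F (fun t => cscal tau (za t)) (cscal tau z).
Proof.
move=> hza; apply: tendsM; first exact: tends_cexp.
by apply: tendsM; apply: tends_cdiff (cdiff_sg eta_gt0 _) _; apply: tendsMl;
  [apply: tendsD|apply: tendsB] => //; exact: tends_cst.
Qed.

(** Both sides are continuous in [z], and the lattice points left out so far are isolated. *)
Lemma unitarity tau : ~ lat tau -> exists2 ka : C, ka != 0 &
  forall z, Rm tau z *m Rm tau (- z) = (ka * cscal tau z)%:M.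
Proof.
move=> htau; have [ka ka0 h] := unitarity_off eta_gt0 n1 nk htau; exists ka => // z.
apply/matrixP => q l.
have t1 := tends_dnbhs_id z.
apply: (@tends_unique _ _ (z^') _ (fun w => (Rm tau w *m Rm tau (- w)) q l)).
  by apply: tends_mulmx => i j; apply: Rmx_tends => //; [exact: tends_cst|exact: tends_cst|exact: tendsN].
apply: (tends_near (f := fun w => (ka * cscal tau w)%:M q l)).
  apply: filterS (lat_isolated eta_gt0 n1 z) => w /= hw.
  by rewrite (h w hw) /cscal /cexp; congr (_%:M _ _); rewrite !mulrA.
rewrite mxE; apply: (tends_ext (f := fun w => ka * cscal tau w *+ (q == l))).
  by move=> w; rewrite mxE.
by case: (q == l); rewrite ?mulr1n ?mulr0n; [apply: tendsMl; exact: tends_cscal|exact: tends_cst].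
Qed.

Lemma lat2 tau : lat (tau + tau) -> in_lat (2 * n) eta tau.
Proof.
move=> [a [b h]]; exists a, b; rewrite natrM invfM mulrCA -h.
by field.
Qed.

Lemma lat_lat2 tau : lat tau -> in_lat (2 * n) eta tau.
Proof. by move=> h; apply: lat2; exact: latD. Qed.

Lemma cscal_neq0 (tau z : C) : ~ lat (z - tau) -> ~ lat (z + tau) -> cscal tau z != 0.
Proof.
move=> h1 h2; apply: mulf_neq0; first exact: cexp_neq0.
apply: mulf_neq0; apply/eqP => /(lat_sg eta_gt0 n1); first by rewrite addrC => /h2.
by move=> h; apply: h1; rewrite -opprB; apply/latN.
Qed.

(** If both sigma factors vanished at [p], then [tau + tau] would lie in the lattice and [tau] in
    [in_lat (2 * n)]. So exactly one of them vanishes, to first order. *)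
Lemma cscal_simple_zero (tau p : C) : ~ in_lat (2 * n) eta tau -> lat (p - tau) \/ lat (p + tau) ->
  exists2 g : C, g != 0 & tends (p^') (fun z => cscal tau z / (z - p)) g.
Proof.
move=> htau hp; have tid := tends_dnbhs_id p.
have tc : tends (p^') (cexp tau) (cexp tau p) by exact: tends_cexp tid.
have c0 := cexp_neq0 tau p.
have nz : ~ (lat (p - tau) /\ lat (p + tau)).
  move=> [h1 h2]; apply: htau; apply: lat2.
  have -> : tau + tau = p + tau - (p - tau) by ring.
  exact: (latB n1 h2 h1).
case: hp => hp.
  have [g g0 hg] := simple_zero eta_gt0 n1 hp.
  have tg : tends (p^') (fun z => s1 (n%:R * (z - tau)) / (z - p)) g.
    have h := tends_comp (@dnbhs_shift R p tau) hg.
    by apply: tends_ext h => z /=; rewrite opprB addrA subrK.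
  have ts : tends (p^') (fun z => s1 (n%:R * (tau + z))) (s1 (n%:R * (tau + p))).
    by apply: tends_cdiff (cdiff_sg eta_gt0 _) _; apply: tendsMl; apply: tendsD => //; exact: tends_cst.
  exists (cexp tau p * (s1 (n%:R * (tau + p)) * - g)).
    apply: mulf_neq0 => //; apply: mulf_neq0; last by rewrite oppr_eq0.
    by apply/eqP => /(lat_sg eta_gt0 n1); rewrite addrC => h; exact: nz.
  apply: tends_ext (tendsM tc (tendsM ts (tendsN tg))) => z.
  have hE : s1 (n%:R * (tau - z)) = - s1 (n%:R * (z - tau)).
    by rewrite -(sg_odd eta_gt0) -mulrN opprB.
  by rewrite /cscal hE; move: (cexp _ _) (s1 _) (s1 _) => x y w; ring.
have [g g0 hg] := simple_zero eta_gt0 n1 hp.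
have tg : tends (p^') (fun z => s1 (n%:R * (tau + z)) / (z - p)) g.
  have hg' : tends ((p - - tau)^') (fun w => s1 (n%:R * w) / (w - (p + tau))) g by rewrite opprK.
  have h := tends_comp (@dnbhs_shift R p (- tau)) hg'.
  by apply: tends_ext h => z /=; rewrite opprK [p + tau]addrC addrKA [z + tau]addrC.
have ts : tends (p^') (fun z => s1 (n%:R * (tau - z))) (s1 (n%:R * (tau - p))).
  by apply: tends_cdiff (cdiff_sg eta_gt0 _) _; apply: tendsMl; apply: tendsB => //; exact: tends_cst.
exists (cexp tau p * (g * s1 (n%:R * (tau - p)))).
  apply: mulf_neq0 => //; apply: mulf_neq0 => //.
  apply/eqP => /(lat_sg eta_gt0 n1) h; apply: nz; split=> //; rewrite -opprB; exact/latN.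
apply: tends_ext (tendsM tc (tendsM tg ts)) => z.
by rewrite /cscal; move: (cexp _ _) (s1 _) (s1 _) => x y w; ring.
Qed.

Lemma multiplicity_sum (tau p : C) : ~ in_lat (2 * n) eta tau -> lat (p - tau) \/ lat (p + tau) ->
  [/\ Rm tau p *m Rm tau (- p) = 0,
      (\rank (Rm tau p) + \rank (Rm tau (- p)) = n * n)%N
    & zero_mult (fun z => \det (Rm tau z)) p (nullity (Rm tau p))].
Proof.
move=> htau hp; have htau1 : ~ lat tau by move=> /lat_lat2.
have [ka ka0 hU] := unitarity htau1.
have [g g0 hg] := cscal_simple_zero htau hp.
have R0 : Rm tau p *m Rm tau (- p) = 0.
  rewrite hU; suff -> : cscal tau p = 0 by rewrite mulr0 raddf0.
  apply: (@tends_unique _ _ (p^') _ (cscal tau)); first exact: tends_cscal (tends_dnbhs_id p).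
  apply: (tends_near (f := fun z => cscal tau z / (z - p) * (z - p))).
    by apply/dnbhsC; exists 1 => // z zp _ /=; rewrite divfK ?subr_eq0.
  rewrite -[X in tends _ _ X](mulr0 g) -[X in tends _ _ (_ * X)](subrr p).
  by apply: tendsM hg _; apply: tendsB; [exact: tends_dnbhs_id|exact: tends_cst].
have rk := mulmx0_rank_max R0.
have [D1 h1] := det_order (Rmx_cdiff tau p).
have [D2 h2] := @det_order _ _ (fun z => Rm tau (- z)) p
  (fun q l => cdiff_comp (cdiffN (cdiff_id p)) (Rmx_cdiff tau (- p) q l)).
set a := nullity _ in h1; set b := nullity _ in h2.
have ra : (a = n * n - \rank (Rm tau p))%N by [].
have rb : (b = n * n - \rank (Rm tau (- p)))%N by [].
have la : (\rank (Rm tau p) <= n * n)%N by exact: rank_leq_row.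
have lb : (\rank (Rm tau (- p)) <= n * n)%N by exact: rank_leq_row.
(* [e] is the excess of the nullities over [n * n]; the truncated subtraction is exact because
   [R(p) R(-p) = 0]. In the limit below, [(p - p) ^+ e] must be non-zero, which forces [e = 0]. *)
pose e := (a + b - n * n)%N.
have ab : (a + b = n * n + e)%N by lia.
have tx : tends (p^') (fun z => (z - p) ^+ e) ((p - p) ^+ e).
  by apply: tendsX; apply: tendsB; [exact: tends_dnbhs_id|exact: tends_cst].
have E : D1 * D2 * (p - p) ^+ e = (ka * g) ^+ (n * n).
  apply: (tends_unique _ (tendsM (tendsM h1 h2) tx)).
  apply: tends_near (tendsX (n * n) (tendsMl ka hg)).
  apply/dnbhsC; exists 1 => // z zp _ /=.
  have zp0 : z - p != 0 by rewrite subr_eq0.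
  have hd : \det (Rm tau z) * \det (Rm tau (- z)) = (ka * cscal tau z) ^+ (n * n).
    by rewrite -det_mulmx hU det_scalar.
  have := congr1 (fun x => (z - p) ^+ x) ab; rewrite !exprD => hx.
  rewrite mulf_div hd hx mulrA expr_div_n.
  have := expf_neq0 (n * n) zp0; have := expf_neq0 e zp0.
  by move: (_ ^+ (n * n)) (_ ^+ e) (_ ^+ (n * n)) => x y w y0 w0; field; rewrite y0 w0.
have kg0 : (ka * g) ^+ (n * n) != 0 by rewrite expf_neq0 // mulf_neq0.
have e0 : e = 0%N.
  apply/eqP; apply: contraNT kg0; rewrite -lt0n => ep.
  by rewrite -E subrr expr0n gtn_eqF // mulr0.
split=> //; first by lia.
exists D1; last by apply/tendsC; exact: h1.
by apply: contraNneq kg0 => D10; rewrite -E D10 !mul0r.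
Qed.

Lemma Rmx_unit (tau z : C) : ~ lat tau -> ~ lat (z - tau) -> ~ lat (z + tau) -> Rm tau z \in unitmx.
Proof.
move=> htau h1 h2; have [ka ka0 hU] := unitarity htau.
have hc : ka * cscal tau z != 0 by rewrite mulf_neq0 // cscal_neq0.
apply: (@mulmx1_unit _ _ _ ((ka * cscal tau z)^-1 *: Rm tau (- z)) _).1.
by rewrite -scalemxAr hU scale_scalar_mx mulVf.
Qed.

Lemma zero_mult_unit (tau p : C) : Rm tau p \in unitmx ->
  zero_mult (fun z => \det (Rm tau z)) p (nullity (Rm tau p)) /\ nullity (Rm tau p) = 0%N.
Proof.
move=> hu; have hn : nullity (Rm tau p) = 0%N by rewrite /nullity mxrank_unit // subnn.
split=> //; rewrite hn; exists (\det (Rm tau p)); first by rewrite -unitfE -unitmxE.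
apply/tendsC; apply: (tends_ext (f := fun z => \det (Rm tau z))).
  by move=> z; rewrite expr0 divr1.
apply: tends_det => i j.
exact: (tends_mono (@dnbhs_sub _ p) (cdiff_cont (Rmx_cdiff tau p i j))).
Qed.

End Multiplicities.

(** * Translations by the lattice *)

Section Periods.
Variable R : realType.
Local Notation C := R[i].
Variables (n k : nat) (eta : C).
Hypothesis eta_gt0 : 0 < complex.Im eta.
Hypothesis n1 : (1 < n)%N.

Let n0 : (0 < n)%N. Proof. exact: ltnW. Qed.
Let nR : n%:R != 0 :> C. Proof. by rewrite pnatr_eq0 -lt0n. Qed.
Let eta0 : eta != 0. Proof. exact: eta_neq0. Qed.

Local Notation sn := (sg (n%:R * eta)).
Local Notation hexp := (hexp n eta).
Local Notation eroot := (@eroot R n).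
Local Notation Rm := (Rmx n k eta).

(** Translation by [1 / n] acts on the theta functions by a character of [al], translation by
    [eta / n] by the shift of [al]: the two generators of the Heisenberg action, up to a factor
    independent of [al]. *)
Lemma theta_n_add1 (w : C) : exists2 psi : C, psi != 0 & forall al : int,
  theta_n n eta al (w + n%:R^-1) = psi * ee (al%:~R / n%:R) * theta_n n eta al w.
Proof.
have [c c0 hth] := theta_n_hexp eta_gt0 n1.
have h0 := hexp_neq0 n eta w.
exists (- (hexp (w + n%:R^-1) / hexp w * ee ((2 * (n%:R * w) + 1) / (2 * (n%:R * eta))))).
  rewrite oppr_eq0; apply: mulf_neq0; last exact: ee_neq0.
  by apply: mulf_neq0; rewrite ?invr_eq0 // hexp_neq0.
move=> al; rewrite !hth.
have -> : n%:R * (w + n%:R^-1) + al%:~R * eta = n%:R * w + al%:~R * eta + 1.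
  by rewrite mulrDr divff //; ring.
rewrite (sg_add1 (Im_neta eta_gt0 n0)).
have -> : (2 * (n%:R * w + al%:~R * eta) + 1) / (2 * (n%:R * eta)) =
   (2 * (n%:R * w) + 1) / (2 * (n%:R * eta)) + al%:~R / n%:R.
  by field; rewrite nR eta0.
rewrite eeD; move: (ee _) (ee _) (sn _) (eroot _) (hexp (w + _)) (hexp w) h0 => x y s e h h' h'0.
by field.
Qed.

Lemma theta_n_addeta (w : C) : exists2 psi : C, psi != 0 & forall al : int,
  theta_n n eta al (w + eta / n%:R) = psi * theta_n n eta (al + 1) w.
Proof.
have [c c0 hth] := theta_n_hexp eta_gt0 n1.
have h0 := hexp_neq0 n eta w.
exists (hexp (w + eta / n%:R) / hexp w * eroot (-1)).
  apply: mulf_neq0; last exact: eroot_neq0.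
  by apply: mulf_neq0; rewrite ?invr_eq0 // hexp_neq0.
move=> al; rewrite !hth.
have -> : n%:R * (w + eta / n%:R) + al%:~R * eta = n%:R * w + (al + 1)%:~R * eta.
  by rewrite rmorphD /=; field.
have -> : eroot al = eroot (-1) * eroot (al + 1) by rewrite -erootD; congr eroot; ring.
move: (sn _) (eroot _) (eroot _) (hexp (w + _)) (hexp w) h0 => s e e' h h' h'0.
by field.
Qed.

Lemma ee_modn (a b : int) : (a == b %[mod n%:Z])%Z -> ee (a%:~R / n%:R) = ee (b%:~R / n%:R) :> C.
Proof.
rewrite eqz_mod_dvd => /dvdzP[m hm].
have -> : a = b + m * n%:Z by lia.
rewrite rmorphD rmorphM /= mulrDl -pmulrn mulfK //.
by rewrite eeD ee_int mulr1.
Qed.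

(** The skipped factor removes the character of [j - i - r], and the numerator restores it; only the
    character of [k * r] survives. The sign of the translation comes from the theta functions being
    taken at [- z]. *)
Lemma Rcoef_sub1 (tau z : C) : exists2 c : C, c != 0 & forall i j r : int,
  Rcoef n k eta tau (z - n%:R^-1) i j r = c * ee ((k%:Z * r)%:~R / n%:R) * Rcoef n k eta tau z i j r.
Proof.
have [p1 p10 h1] := theta_n_add1 (- z).
have [p2 p20 h2] := theta_n_add1 (- z + tau).
pose E : C := \prod_(a < n) (p1 * ee (a%:Z%:~R / n%:R)).
exists (E / p1 * p2).
  apply: mulf_neq0 => //; apply: mulf_neq0; last by rewrite invr_eq0.
  by apply/prodf_neq0 => a _; apply: mulf_neq0 => //; exact: ee_neq0.
move=> i j r; rewrite /Rcoef.
have -> : - (z - n%:R^-1) = - z + n%:R^-1 by rewrite opprB addrC.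
rewrite [- z + n%:R^-1 + tau]addrAC h2.
under eq_bigr do rewrite h1.
rewrite big_split /= (@prod_skip R n n0 (fun a => p1 * ee (a%:~R / n%:R))); last first.
  by apply: mulf_neq0 => //; exact: ee_neq0.
rewrite -/E (@ee_modn _ (j - i - r)) ?eqz_mod ?modz_mod //.
have -> : j - i + r * (k%:Z - 1) = (j - i - r) + k%:Z * r by ring.
move: (j - i - r) (k%:Z * r) => d kr; rewrite rmorphD /= [(_ + _) / n%:R]mulrDl eeD.
have := ee_neq0 (d%:~R / n%:R : C); move: (ee _) (ee _) => x y.
move: (theta_n _ _ _ _) (theta_n _ _ _ _)^-1 => t1 t2.
by move: (\prod_(_ < n | _) _)^-1 (\prod_(_ < n | _) _) => X Y x0; field; rewrite p10 x0.
Qed.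

Lemma Rcoef_subeta (tau z : C) : exists2 c : C, c != 0 & forall i j r : int,
  Rcoef n k eta tau (z - eta / n%:R) i j r = c * Rcoef n k eta tau z i (j + 1) r.
Proof.
have [p1 p10 h1] := theta_n_addeta (- z).
have [p2 p20 h2] := theta_n_addeta (- z + tau).
exists (p1 ^+ n / p1 * p2).
  by rewrite !mulf_neq0 ?invr_eq0 ?expf_neq0.
move=> i j r; rewrite /Rcoef.
have -> : - (z - eta / n%:R) = - z + eta / n%:R by rewrite opprB addrC.
rewrite [- z + eta / n%:R + tau]addrAC h2.
under eq_bigr do rewrite h1.
rewrite big_split /= (@prod_skip R n n0 (fun=> p1)) // prodr_const card_ord.
have -> : j + 1 - i + r * (k%:Z - 1) = j - i + r * (k%:Z - 1) + 1 by ring.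
have -> : \prod_(a < n | a%:Z != ((j + 1 - i - r) %% n%:Z)%Z) theta_n n eta a%:Z (- z) =
   \prod_(a < n | a%:Z != ((j - i - r) %% n%:Z)%Z) theta_n n eta (a%:Z + 1) (- z).
  rewrite (reindex_inj (@ordS_inj n)) /=; apply: eq_big => a.
    have -> : j + 1 - i - r = j - i - r + 1 by ring.
    move: (j - i - r) => m; congr (~~ _).
    have -> : (a.+1 %% n)%N%:Z = ((a%:Z + 1) %% n%:Z)%Z by rewrite -modz_nat -addn1 PoszD.
    rewrite -[LHS]/(a%:Z + 1 == m + 1 %[mod n%:Z])%Z eqz_modDr.
    by rewrite [(a%:Z %% _)%Z]modz_small //= ltz_nat ltn_ord.
  move=> _; have -> : (a.+1 %% n)%N%:Z = ((a%:Z + 1) %% n%:Z)%Z by rewrite -modz_nat -addn1 PoszD.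
  by rewrite theta_n_mod.
move: (theta_n _ _ _ _) (theta_n _ _ _ _)^-1 (\prod_(_ < n | _) _)^-1 (\prod_(_ < n | _) _) => t1 t2 X Y.
by move: (p1 ^+ n) => P; field.
Qed.

(** In the entry [(q, l)] the shift is [r = snd_idx l - fst_idx q] modulo [n], so its character
    splits into a row factor and a column factor. *)
Lemma rank_Rmx_sub1 (tau z : C) : \rank (Rm tau (z - n%:R^-1)) = \rank (Rm tau z).
Proof.
have [c c0 hc] := Rcoef_sub1 tau z.
apply: (@rank_twist _ _ _ _ c (fun q => ee ((k%:Z * - fst_idx q)%:~R / n%:R))
   (fun l => ee ((k%:Z * snd_idx l)%:~R / n%:R)) id id id id) => //.
- by move=> i; exact: ee_neq0.
- by move=> i; exact: ee_neq0.
move=> q l; rewrite !(RmxE k eta n0) mulr_sumr; apply: eq_bigr => r _.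
rewrite (enc_eqP n0); case: (boolP (_ && _)) => [/andP[_ h]|_]; last by rewrite mulr0.
rewrite hc -eeD; congr (_ * _ * _).
rewrite -mulrDl -rmorphD /= -mulrDr; apply: ee_modn.
rewrite eq_sym eqz_mod_dvd -mulrBr; apply: dvdz_mull.
by apply/dvdz_mod0P; rewrite -[RHS](eqP h); congr (_ %% _)%Z; ring.
Qed.

(** Replacing [j] by [j + 1] moves the second index of the input and the first index of the output,
    so rows and columns undergo different permutations. *)
Lemma rank_Rmx_subeta (tau z : C) : \rank (Rm tau (z - eta / n%:R)) = \rank (Rm tau z).
Proof.
have [c c0 hc] := Rcoef_subeta tau z.
pose f (v w : int) (q : 'I_(n * n)) := enc n0 (fst_idx q + v) (snd_idx q + w).
have fK v w : cancel (f (- v) (- w)) (f v w).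
  move=> q; rewrite -[RHS](enc_idx n0) /f fst_enc snd_enc.
  by rewrite -[LHS](enc_modz n0) !modzDml !subrK enc_modz.
apply: (@rank_twist _ _ _ _ c (fun=> 1) (fun=> 1) (f 0 1) (f (- 0) (- 1))
   (f 1 0) (f (- 1) (- 0))) => //; try by move=> i; exact: oner_neq0.
move=> q l; rewrite (RmxE k eta n0) Rmx_enc !mulr1 mulr_sumr; apply: eq_bigr => r _.
have -> : (f 1 0 l == enc n0 (snd_idx q + 1 - r%:Z) (fst_idx q + 0 + r%:Z)) =
   (l == enc n0 (snd_idx q - r%:Z) (fst_idx q + r%:Z)).
  rewrite !(enc_eqP n0) fst_enc snd_enc !modzDml !addr0.
  by congr (((_ %% _)%Z == 0) && _); ring.
by case: (l == _); rewrite ?mulr0 // hc addr0.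
Qed.

Lemma rank_Rmx_lat (tau z zeta : C) : in_lat n eta zeta ->
  \rank (Rm tau (z + zeta)) = \rank (Rm tau z).
Proof.
have H (u : C) : (forall z, \rank (Rm tau (z - u)) = \rank (Rm tau z)) ->
    forall (a : int) (z : C), \rank (Rm tau (z + a%:~R * u)) = \rank (Rm tau z).
  move=> hu; have hn (a : nat) w : \rank (Rm tau (w + a%:R * u)) = \rank (Rm tau w).
    elim: a => [|a IH]; first by rewrite mul0r addr0.
    by rewrite -(hu (w + a.+1%:R * u)) -natr1 mulrDl mul1r addrA addrK IH.
  case=> a w; first exact: hn.
  rewrite NegzE rmorphN /= mulNr; have := hn a.+1 (w - a.+1%:R * u).
  by rewrite subrK => h; exact: esym.
move=> [a [b ->]].
have -> : z + (a%:~R + b%:~R * eta) / n%:R = z + a%:~R * n%:R^-1 + b%:~R * (eta / n%:R) by field.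
by rewrite (H _ (rank_Rmx_subeta tau)) (H _ (rank_Rmx_sub1 tau)).
Qed.

End Periods.

(** * The limit at the origin *)

Section DegenerateLimit.
Variable R : realType.
Local Notation C := R[i].
Variables (n k : nat) (eta : C).
Hypothesis eta_gt0 : 0 < complex.Im eta.
Hypothesis n1 : (1 < n)%N.
Hypothesis nk : coprime n k.

Let n0 : (0 < n)%N. Proof. exact: ltnW. Qed.
Let nR : n%:R != 0 :> C. Proof. by rewrite pnatr_eq0 -lt0n. Qed.
Let nz : n%:Z != 0. Proof. by rewrite eqz_nat -lt0n. Qed.

Local Notation sn := (sg (n%:R * eta)).
Local Notation Rm := (Rmx n k eta).
Local Notation th := (theta_n n eta).
Local Notation D := (\prod_(a < n | (0 < a)%N) th a%:Z 0).

Lemma theta_n_00 : th 0 0 = 0.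
Proof.
have [c c0 ->] := theta_n_hexp eta_gt0 n1.
by rewrite mulr0 mul0r addr0 (sg0 (Im_neta eta_gt0 n0)) !mulr0.
Qed.

Lemma theta_n_at0 (al : int) : ~~ (n%:Z %| al)%Z -> th al 0 != 0.
Proof.
move=> hal; have [c c0 ->] := theta_n_hexp eta_gt0 n1.
apply: mulf_neq0; first by apply: mulf_neq0 => //; exact: hexp_neq0.
apply: mulf_neq0; first exact: eroot_neq0.
by rewrite mulr0 add0r; apply/eqP => /(sgn_lat0 eta_gt0 n1); rewrite (negPf hal).
Qed.

(** The zero of theta_0 at the origin is simple. *)
Lemma theta_0_ratio (a : C) : tends ((0 : C)^') (fun t => th 0 (a * t) / th 0 t) a.
Proof.
have [a0|a0] := eqVneq a 0.
  by rewrite a0; apply: tends_ext (tends_cst 0) => t; rewrite mul0r theta_n_00 mul0r.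
have [g g0 hg] : exists2 g : C, g != 0 & tends ((0 : C)^') (fun t => th 0 t / t) g.
  have [c c0 hc] := theta_n_hexp eta_gt0 n1.
  have [d d0 hd] := sg_deriv0 (Im_neta eta_gt0 n0).
  have hd' : tends ((0 : C)^') (fun t => sn (n%:R * t) / (n%:R * t)) d.
    exact: tends_comp (tends0_comp_sub nR) hd.
  have hh : tends ((0 : C)^') (hexp n eta) (hexp n eta 0).
    exact: tends_cdiff (cdiff_hexp n eta 0) (tends_dnbhs_id 0).
  exists (c * hexp n eta 0 * (@eroot R n 0 * (n%:R * d))).
    apply: mulf_neq0; first by apply: mulf_neq0 => //; exact: hexp_neq0.
    by apply: mulf_neq0; [exact: eroot_neq0|exact: mulf_neq0].
  apply: tends_ext (tendsM (tendsMl c hh) (tendsMl (@eroot R n 0) (tendsMl n%:R hd'))) => t.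
  rewrite hc mul0r addr0 invfM.
  move: (hexp _ _ _) (sn _) (eroot _ _) (t^-1) => h s e t'.
  by field.
have ha : tends ((0 : C)^') (fun t => th 0 (a * t) / (a * t)) g.
  exact: tends_comp (tends0_comp_sub a0) hg.
have hl : tends ((0 : C)^') (fun t => a * (th 0 (a * t) / (a * t)) * (th 0 t / t)^-1) (a * g / g).
  by apply: tendsM; [exact: tendsMl|exact: tendsV].
rewrite -{2}(mulfK g0 a); apply: tends_near hl; apply/dnbhsC; exists 1 => // t t0 _ /=.
rewrite [(th 0 t / t)^-1]invfM invrK; move: (th 0 _) (th 0 _)^-1 => x y.
by field; rewrite a0 t0.
Qed.

Lemma tends_theta_n (T : Type) (F : set_system T) (FF : Filter F) (f : T -> C) (al : int) (z : C) :
  tends F f z -> tends F (fun t => th al (f t)) (th al z).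
Proof. by move=> hf; exact: tends_cdiff (cdiff_theta_n eta_gt0 n1 al z) hf. Qed.

Lemma theta_D_neq0 : D != 0.
Proof.
apply/prodf_neq0 => a a0; apply: theta_n_at0; apply/negP => /dvdzP[m hm].
by have := ltn_ord a; case: m hm => [[|m]|m] hm; nia.
Qed.

Local Notation P m z := (\prod_(a < n | a%:Z != (m %% n%:Z)%Z) th a%:Z z).

Lemma theta_skip_dvd (m : int) : (n%:Z %| m)%Z -> P m 0 = D.
Proof.
move=> /dvdz_mod0P ->; apply: eq_bigl => a; lia.
Qed.

(** A product that skips an index other than 0 still contains theta_0, which vanishes at the origin;
    [Q] is the rest, and putting theta_m in place of theta_0 gives the denominator of R. *)
Lemma theta_skip_ndvd (m : int) : ~~ (n%:Z %| m)%Z -> exists Q : C -> C,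
  [/\ forall z, P m z = th 0 z * Q z, cdiff Q 0 & Q 0 * th m 0 = D].
Proof.
move=> hm; have mz : (m %% n%:Z)%Z != 0 by apply: contraNneq hm => h; exact/dvdz_mod0P.
have lt : (`|(m %% n%:Z)%Z|%N < n)%N.
  by have := modz_ge0 m nz; have := ltz_mod m nz; lia.
have eqm : (`|(m %% n%:Z)%Z|%N)%:Z = (m %% n%:Z)%Z by have := modz_ge0 m nz; lia.
pose o : 'I_n := Ordinal n0.
exists (fun z => \prod_(a < n | (a%:Z != (m %% n%:Z)%Z) && (a != o)) th a%:Z z); split.
- by move=> z; rewrite (bigD1 o) //= eq_sym.
- by apply: cdiff_prod => a _; exact: cdiff_theta_n.
rewrite [RHS](bigD1 (Ordinal lt)) /=; last by lia.
rewrite eqm theta_n_mod mulrC; congr (_ * _); apply: eq_bigl => a.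
by rewrite -!(inj_eq val_inj) /= -lt0n andbC -eqm.
Qed.

(** For [r = 0] the vanishing denominator theta_0(t) is compensated by theta_0(t - c t) if [n]
    divides [j - i], giving [1 - c], and by theta_0(- c t) from the product otherwise, giving [- c].
    For [r != 0] nothing degenerates, and the product tends to 0 unless [n] divides [j - i - r]. *)
Lemma Rcoef_lim0 (c : C) (i j : int) (r : 'I_n) :
  tends ((0 : C)^') (fun t => Rcoef n k eta t (c * t) i j r%:Z)
    ((n%:Z %| j - i - r%:Z)%Z%:R - c * (r == 0 :> nat)%:R).
Proof.
have tid := tends_dnbhs_id (0 : C).
have tc : tends ((0 : C)^') (fun t => - (c * t)) 0.
  have h : tends ((0 : C)^') (fun t => - (c * t)) (- (c * 0)) by exact: tendsN (tendsMl c tid).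
  by rewrite mulr0 oppr0 in h.
have tc1 : tends ((0 : C)^') (fun t => - (c * t) + t) 0.
  have h : tends ((0 : C)^') (fun t => - (c * t) + t) (0 + 0) by exact: tendsD tc tid.
  by rewrite addr0 in h.
have D0 := theta_D_neq0.
rewrite /Rcoef.
have -> : j - i + r%:Z * (k%:Z - 1) = j - i - r%:Z + k%:Z * r%:Z by ring.
move: (j - i - r%:Z) => m.
have [r0|r0] := eqVneq (r : nat) 0%N.
  rewrite r0 mulr0 addr0 mulr1.
  case: (boolP (n%:Z %| m)%Z) => hm.
    have hP : tends ((0 : C)^') (fun t => P m (- (c * t)) / D) 1.
      have hP : tends ((0 : C)^') (fun t => P m (- (c * t))) (P m 0).
        by apply: tends_prod => a _; exact: tends_theta_n.
      rewrite theta_skip_dvd // in hP.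
      have h : tends ((0 : C)^') (fun t => P m (- (c * t)) / D) (D / D).
        by apply: tendsM; [exact: hP|exact: tends_cst].
      by rewrite divff in h.
    have hR : tends ((0 : C)^') (fun t => th 0 ((1 - c) * t) / th 0 t) (1 - c) by exact: theta_0_ratio.
    rewrite -[1 - c]mul1r; apply: tends_ext (tendsM hP hR) => t.
    have E u : th m u = th 0 u by case/dvdzP: hm => u' ->; rewrite -[u' * _]add0r theta_n_shift.
    by rewrite E mulrBl mul1r [- (c * t) + t]addrC.
  have [Q [hQ cQ QD]] := theta_skip_ndvd hm.
  have tQ : tends ((0 : C)^') (fun t => Q (- (c * t))) (Q 0) by exact: tends_cdiff cQ tc.
  have tm : tends ((0 : C)^') (fun t => th m (- (c * t) + t)) (th m 0) by exact: tends_theta_n.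
  have -> : 0 - c = - c * (D^-1 * (Q 0 * th m 0)) by rewrite QD mulVf // mulr1 sub0r.
  apply: tends_ext (tendsM (theta_0_ratio (- c)) (tendsMl D^-1 (tendsM tQ tm))) => t.
  rewrite hQ mulNr; move: (th 0 t)^-1 D^-1 (th 0 _) (Q _) (th m _) => x1 x2 x3 x4 x5.
  by ring.
rewrite mulr0 subr0.
have hkr : ~~ (n%:Z %| k%:Z * r%:Z)%Z.
  by rewrite Gauss_dvdzr //; apply/negP => /dvdzP[[[|u]|u] hu]; have := ltn_ord r; nia.
have -> : (n%:Z %| m)%Z%:R = P m 0 / D * (th (m + k%:Z * r%:Z) 0 / th (k%:Z * r%:Z) 0) :> C.
  case: (boolP (n%:Z %| m)%Z) => hm.
    rewrite theta_skip_dvd // divff // mul1r.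
    by case/dvdzP: hm => u ->; rewrite addrC theta_n_shift divff // theta_n_at0.
  by have [Q [-> _ _]] := theta_skip_ndvd hm; rewrite theta_n_00 !mul0r.
apply: tendsM; first by apply: tendsM (tends_cst _); apply: tends_prod => a _; exact: tends_theta_n.
apply: tendsM; first exact: tends_theta_n.
by apply: tendsV; [exact: theta_n_at0|exact: tends_theta_n].
Qed.

(** The shift [r = j - i] returns the basis vector itself and the shift [r = 0] swaps its factors,
    hence identity minus [c] times flip. *)
Lemma Rmx_lim0 (c : C) (q l : 'I_(n * n)) :
  tends ((0 : C)^') (fun t => Rm t (c * t) q l)
    ((l == q)%:R - c * (l == enc n0 (snd_idx q) (fst_idx q))%:R).
Proof.
have -> : (fun t => Rm t (c * t) q l) = fun t =>
    \sum_(r < n) (if l == enc n0 (snd_idx q - r%:Z) (fst_idx q + r%:Z)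
                  then Rcoef n k eta t (c * t) (fst_idx q) (snd_idx q) r%:Z else 0).
  by apply/funext => t; exact: RmxE.
move: (fst_idx q) (snd_idx q) (enc_idx n0 q) => i j <-.
pose A (r : int) := l == enc n0 (j - r) (i + r).
have lt : (`|((j - i) %% n%:Z)%Z|%N < n)%N.
  by have := modz_ge0 (j - i) nz; have := ltz_mod (j - i) nz; lia.
have eqm : (`|((j - i) %% n%:Z)%Z|%N)%:Z = ((j - i) %% n%:Z)%Z by have := modz_ge0 (j - i) nz; lia.
have -> : (l == enc n0 i j)%:R - c * (l == enc n0 j i)%:R =
    \sum_(r < n) (if A r%:Z then (n%:Z %| j - i - r%:Z)%Z%:R - c * (r == 0 :> nat)%:R else 0).
  transitivity (\sum_(r < n) ((A r%:Z && (n%:Z %| j - i - r%:Z)%Z)%:R - c * (A r%:Z && (r == 0 :> nat))%:R)).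
    rewrite sumrB; congr (_ - _).
      rewrite (bigD1 (Ordinal lt)) //= big1 ?addr0 => [|a].
        rewrite eqm -eqz_mod_dvd modz_mod eqxx andbT /A; congr ((_ == _)%:R).
        rewrite -[LHS](enc_modz n0) -[RHS](enc_modz n0); congr enc.
          apply/eqP; rewrite eqz_mod_dvd; move: (modz_mod (j - i) n%:Z) => /eqP.
          by rewrite eqz_mod_dvd; congr (_ %| _)%Z; ring.
        by rewrite modzDmr; congr (_ %% _)%Z; ring.
      rewrite -(inj_eq val_inj) /= => ha; case: (boolP (n%:Z %| _)%Z); last by rewrite andbF.
      rewrite -eqz_mod_dvd => /eqP h; exfalso; move: ha; rewrite -eqz_nat eqm h.
      by rewrite modz_nat modn_small ?eqxx.
    rewrite -mulr_sumr; congr (_ * _); rewrite (bigD1 (Ordinal n0)) //= big1 ?addr0 => [|a].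
      by rewrite andbT /A subr0 addr0.
    by rewrite -(inj_eq val_inj) /= => /negPf ->; rewrite andbF.
  by apply: eq_bigr => r _; case: (A _); rewrite //= mulr0 subr0.
apply: tends_sum => r _; rewrite -/(A r%:Z); case: (A _); last exact: tends_cst.
exact: Rcoef_lim0.
Qed.

End DegenerateLimit.

(** * Ranks of R at the two exceptional points *)

Section RankBounds.
Variable R : realType.
Local Notation C := R[i].

Lemma rank_diag_sub (I : finType) (A : {pred I}) (m : nat) (M : 'M[C]_m) (f : I -> 'I_m) (a : I -> C) :
  {in A, forall p, a p != 0} ->
  {in A &, forall p p', M (f p) (f p') = (p == p')%:R * a p} -> (#|A| <= \rank M)%N.
Proof.
move=> a0 hM; pose d : 'rV[C]_#|A| := \row_i a (enum_val i).
have Nu : diag_mx d \in unitmx.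
  rewrite unitmxE det_diag unitfE; apply/prodf_neq0 => i _.
  by rewrite mxE a0 // enum_valP.
rewrite -(mxrank_unit Nu).
apply: (@rank_twist_le _ _ _ _ _ 1 (fun=> 1) (fun=> 1) (fun i => f (enum_val i)) (fun i => f (enum_val i))) => i j.
rewrite !mul1r hM ?enum_valP // (inj_eq enum_val_inj) !mxE.
by case: (i == j); rewrite ?mul1r ?mul0r ?mulr1n ?mulr0n.
Qed.

Lemma card_lt_pairs (n : nat) : #|[pred p : 'I_n * 'I_n | (p.2 < p.1)%N]| = 'C(n, 2).
Proof.
rewrite -sum1_card -(pair_big_dep xpredT (fun i j : 'I_n => (j < i)%N) (fun _ _ => 1%N)) /=.
rewrite -bin2_sum big_mkord; apply: eq_bigr => i _.
by rewrite (big_ord_narrow (ltnW (ltn_ord i))) sum1_card card_ord.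
Qed.

Lemma card_le_pairs (n : nat) : #|[pred p : 'I_n * 'I_n | (p.2 <= p.1)%N]| = 'C(n.+1, 2).
Proof.
rewrite -sum1_card -(pair_big_dep xpredT (fun i j : 'I_n => (j <= i)%N) (fun _ _ => 1%N)) /=.
rewrite -bin2_sum big_mkord big_ord_recl add0n; apply: eq_bigr => i _.
rewrite (eq_bigl (fun j : 'I_n => (j < i.+1)%N)) //.
by rewrite (big_ord_narrow (ltn_ord i)) sum1_card card_ord.
Qed.

Lemma binS_add_bin (n : nat) : ('C(n, 2) + 'C(n.+1, 2) = n * n)%N.
Proof. by elim: n => // n IH; rewrite ['C(n.+2, 2)]binS bin1 ['C(n.+1, 2)]binS bin1; rewrite binS bin1 in IH; nia. Qed.

(** As a real-valued function [h] has derivative 0 everywhere, which replaces an appeal to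
    connectedness. *)
Lemma locally_constant (h : R -> nat) :
  (forall t : R, nbhs t [set s | h s = h t]) -> forall x y, h x = h y.
Proof.
move=> hl x y; apply/eqP; rewrite -(eqr_nat R); apply/eqP.
apply: (is_derive_0_is_cst (f := fun t => (h t)%:R)) => t.
have fg : \forall s \near t, cst (h t)%:R s = (h s)%:R :> R^o.
  by apply: filterS (hl t) => s /= ->.
exact: near_eq_is_derive fg (is_derive_cst _ _ _).
Qed.

End RankBounds.

Section RankOfR.
Variable R : realType.
Local Notation C := R[i].
Variables (n k : nat) (eta : C).
Hypothesis eta_gt0 : 0 < complex.Im eta.
Hypothesis n1 : (1 < n)%N.
Hypothesis nk : coprime n k.

Let n0 : (0 < n)%N. Proof. exact: ltnW. Qed.

Local Notation Rm := (Rmx n k eta).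
Local Notation lat := (in_lat n eta).
Local Notation lat2 := (in_lat (2 * n) eta).

Definition Rlim (c : C) : 'M[C]_(n * n) :=
  \matrix_(q, l) ((l == q)%:R - c * (l == enc n0 (snd_idx q) (fst_idx q))%:R).

Lemma enc_ord_eq (i j i' j' : 'I_n) :
  (enc n0 i%:Z j%:Z == enc n0 i'%:Z j'%:Z) = ((i, j) == (i', j')).
Proof.
rewrite (enc_eqP n0) fst_enc snd_enc xpair_eqE -!(inj_eq val_inj) /=.
have E (a b : 'I_n) : (((a%:Z %% n%:Z)%Z - b%:Z) %% n%:Z == 0)%Z = (a == b :> nat).
  rewrite modz_nat modn_small // -[RHS]eqz_nat.
  rewrite -(sameP dvdz_mod0P eqP) -eqz_mod_dvd !modz_nat !modn_small //.
by rewrite !E.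
Qed.

Lemma Rlim_enc (c : C) (p p' : 'I_n * 'I_n) :
  Rlim c (enc n0 p.1%:Z p.2%:Z) (enc n0 p'.1%:Z p'.2%:Z) = (p == p')%:R - c * (p' == (p.2, p.1))%:R.
Proof.
case: p p' => i j [i' j'] /=; rewrite mxE enc_ord_eq fst_enc snd_enc enc_modz enc_ord_eq.
by rewrite [(i', j') == (i, j)]eq_sym.
Qed.

(** Lower bounds for the two limit ranks suffice: they add up to [n * n], as do the ranks nearby, so
    equality follows in [rank_near0]. Swapping a pair with [j < i] leaves this set of pairs, so the
    submatrix on it is the identity. *)
Lemma rank_Rlim_1 : ('C(n, 2) <= \rank (Rlim 1%R))%N.
Proof.
rewrite -card_lt_pairs.
apply: (@rank_diag_sub R _ [pred p : 'I_n * 'I_n | (p.2 < p.1)%N] _ (Rlim 1)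
  (fun p => enc n0 p.1%:Z p.2%:Z) (fun=> 1)) => [p _|p p' hp hp'].
  exact: oner_neq0.
rewrite Rlim_enc [p' == _]negbTE ?mulr0 ?subr0 ?mulr1 //; move: hp hp'; rewrite !inE => hp hp'.
by apply: contraL hp' => /eqP -> /=; rewrite -leqNgt ltnW.
Qed.

(** On the pairs with [j <= i] the flip contributes on the diagonal only, where the entry becomes
    2. *)
Lemma rank_Rlim_N1 : ('C(n.+1, 2) <= \rank (Rlim (-1)%R))%N.
Proof.
rewrite -card_le_pairs.
apply: (@rank_diag_sub R _ [pred p : 'I_n * 'I_n | (p.2 <= p.1)%N] _ (Rlim (-1))
  (fun p => enc n0 p.1%:Z p.2%:Z) (fun p => 1 + (p.1 == p.2)%:R)) => [p _|p p'].
  by case: (p.1 == p.2); rewrite ?addr0 ?oner_neq0 // -(natrD _ 1 1) pnatr_eq0.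
rewrite Rlim_enc !inE; case: p p' => i j [i' j'] /= hp hp'.
rewrite mulNr mul1r opprK !xpair_eqE -!(inj_eq val_inj) /=.
have [ii|ii] := eqVneq (i : nat) i'; have [jj|jj] := eqVneq (j : nat) j'; rewrite /= ?mul1r ?mul0r ?add0r.
- by congr (_ + _%:R); rewrite -ii -jj eq_sym [nat_of_ord j == i]eq_sym andbb.
- by rewrite -ii (_ : (_ && _) = false) //; lia.
- by rewrite -jj (_ : (_ && _) = false) //; lia.
- by rewrite (_ : (_ && _) = false) //; lia.
Qed.

Lemma rank_sum (tau : C) : ~ lat2 tau -> (\rank (Rm tau tau) + \rank (Rm tau (- tau)%R) = n * n)%N.
Proof.
move=> htau.
have h : lat (tau - tau) \/ lat (tau + tau).
  by left; exists 0, 0; rewrite subrr mul0r addr0 mul0r.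
by have [_ ->] := multiplicity_sum eta_gt0 n1 nk htau h.
Qed.

Lemma rank_near0 : ((0 : C)^') [set t | \rank (Rm t t) = 'C(n, 2)].
Proof.
have h1 : ((0 : C)^') [set t | (\rank (Rlim 1%R) <= \rank (Rm t (1 * t)%R))%N].
  apply: rank_lsc => q l; rewrite mxE; exact: Rmx_lim0.
have h2 : ((0 : C)^') [set t | (\rank (Rlim (-1)%R) <= \rank (Rm t (-1 * t)%R))%N].
  apply: rank_lsc => q l; rewrite mxE; exact: Rmx_lim0.
have n2 : (1 < 2 * n)%N by lia.
have h3 := lat_isolated eta_gt0 n2 0.
apply: filterS (filterI h3 (filterI h1 h2)) => t [/= /rank_sum hs []].
rewrite mul1r mulN1r => l1 l2.
have := leq_trans rank_Rlim_1 l1; have := leq_trans rank_Rlim_N1 l2.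
move: hs (binS_add_bin n); move: (\rank _) (\rank _) => x y; lia.
Qed.

Lemma rank_path (g : R -> C) : (forall t, tends (nbhs t) g (g t)) -> (forall t, ~ lat2 (g t)) ->
  forall x y, \rank (Rm (g x) (g x)) = \rank (Rm (g y) (g y)).
Proof.
move=> tg hg; apply: (@locally_constant _ (fun t => \rank (Rm (g t) (g t)))) => t.
have hl : ~ lat (g t) by move=> /(lat_lat2 n1) /hg.
have h1 : nbhs t [set s | (\rank (Rm (g t) (g t)) <= \rank (Rm (g s) (g s)))%N].
  by apply: rank_lsc => q l; apply: Rmx_tends.
have h2 : nbhs t [set s | (\rank (Rm (g t) (- g t)%R) <= \rank (Rm (g s) (- g s)%R))%N].
  by apply: rank_lsc => q l; apply: Rmx_tends => //; exact: tendsN.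
apply: filterS (filterI h1 h2) => s [/= l1 l2].
move: (rank_sum (hg s)) (rank_sum (hg t)) l1 l2; move: (\rank _) (\rank _) (\rank _) (\rank _) => a b c d; lia.
Qed.

End RankOfR.

(** * Paths from tau to the origin in the basis 1, eta *)

Section Connection.
Variable R : realType.
Local Notation C := R[i].
Variables (n k : nat) (eta : C).
Hypothesis eta_gt0 : 0 < complex.Im eta.
Hypothesis n1 : (1 < n)%N.
Hypothesis nk : coprime n k.

Let n0 : (0 < n)%N. Proof. exact: ltnW. Qed.

Local Notation Rm := (Rmx n k eta).
Local Notation lat2 := (in_lat (2 * n) eta).

Definition eta_pt (x y : R) : C := x%:C + y%:C * eta.

Lemma eta_pt_eq0 (x y : R) : eta_pt x y = 0 -> x = 0 /\ y = 0.
Proof.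
rewrite /eta_pt; case: (eta) eta_gt0 => u v /= v0 [].
rewrite !mul0r subr0 addr0 add0r => h1 /eqP; rewrite mulf_eq0 (gt_eqF v0) orbF => /eqP y0.
by split=> //; move: h1; rewrite y0 mul0r addr0.
Qed.

Lemma eta_pt_lat (m : nat) (x y : R) : (0 < m)%N -> in_lat m eta (eta_pt x y) ->
  exists a b : int, m%:R * x = a%:~R /\ m%:R * y = b%:~R.
Proof.
move=> m0 [a [b h]]; exists a, b.
have mR : m%:R != 0 :> C by rewrite pnatr_eq0 -lt0n.
have e : eta_pt (m%:R * x - a%:~R) (m%:R * y - b%:~R) = 0.
  have h' : m%:R * eta_pt x y = a%:~R + b%:~R * eta by rewrite h mulrC divfK.
  rewrite /eta_pt !rmorphB !rmorphM /= !rmorph_int !rmorph_nat.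
  by move: h'; rewrite /eta_pt => h'; rewrite mulrBl addrACA -opprD -mulrA -mulrDr h' subrr.
by have [/eqP + /eqP] := eta_pt_eq0 e; rewrite !subr_eq0 => /eqP -> /eqP ->.
Qed.

Lemma eta_pt_coord (tau : C) : exists x y, tau = eta_pt x y.
Proof.
exists (complex.Re tau - complex.Im tau / complex.Im eta * complex.Re eta), (complex.Im tau / complex.Im eta).
rewrite /eta_pt; case: (eta) eta_gt0 tau => u v /= v0 [p q] /=.
apply/eqP; rewrite eq_complex /= !mul0r subr0 addr0 add0r subrK (divfK (lt0r_neq0 v0)).
by rewrite !eqxx.
Qed.

Lemma lat2_intro (x y : R) (a b : int) :
  (2 * n)%:R * x = a%:~R -> (2 * n)%:R * y = b%:~R -> lat2 (eta_pt x y).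
Proof.
move=> hx hy; exists a, b.
have mR : (2 * n)%:R != 0 :> C by rewrite pnatr_eq0 -lt0n muln_gt0.
apply: (mulfI mR); rewrite [RHS]mulrC divfK // /eta_pt mulrDr mulrA.
have E (u : R) (c : int) : (2 * n)%:R * u = c%:~R -> (2 * n)%:R * u%:C = c%:~R :> C.
  by move=> h; rewrite -[RHS](rmorph_int (@real_complex R)) -h rmorphM /= rmorph_nat.
by rewrite (E x a hx) (E y b hy).
Qed.

(** A horizontal or vertical line avoids [lat2] when its fixed coordinate is not aligned, and a
    point off [lat2] has at least one such coordinate. *)
Definition aligned (x : R) : Prop := exists a : int, (2 * n)%:R * x = a%:~R.

Lemma tends_realC (t : R) : tends (nbhs t) (fun s : R => s%:C) t%:C.
Proof. by apply: tends_real; apply/tendsP; exact: cvg_id. Qed.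

Lemma rank_horizontal (x x' y : R) : ~ aligned y ->
  \rank (Rm (eta_pt x y) (eta_pt x y)) = \rank (Rm (eta_pt x' y) (eta_pt x' y)).
Proof.
move=> hy; apply: (@rank_path _ _ _ _ eta_gt0 n1 nk (fun t => eta_pt t y)) => t.
  by apply: tendsD; [exact: tends_realC|exact: tends_cst].
have m0 : (0 < 2 * n)%N by rewrite muln_gt0.
by move=> /(eta_pt_lat m0)[a [b [_ hb]]]; apply: hy; exists b.
Qed.

Lemma rank_vertical (x y y' : R) : ~ aligned x ->
  \rank (Rm (eta_pt x y) (eta_pt x y)) = \rank (Rm (eta_pt x y') (eta_pt x y')).
Proof.
move=> hx; apply: (@rank_path _ _ _ _ eta_gt0 n1 nk (fun t => eta_pt x t)) => t.
  apply: tendsD; first exact: tends_cst.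
  by apply: tendsM; [exact: tends_realC|exact: tends_cst].
have m0 : (0 < 2 * n)%N by rewrite muln_gt0.
by move=> /(eta_pt_lat m0)[a [b [ha _]]]; apply: hx; exists a.
Qed.

Lemma rank_corner : exists2 e : R, ~ aligned e &
  \rank (Rm (eta_pt e e) (eta_pt e e)) = 'C(n, 2).
Proof.
have [d d0 hd] := (dnbhsC 0 _).1 (rank_near0 eta_gt0 n1 nk).
pose N : R := (2 * n)%:R; have N0 : 0 < N by rewrite ltr0n muln_gt0.
pose s : R := 1 + nm eta; have s0 : 0 < s by rewrite ltr_pwDl ?ltr01 ?nm_ge0.
(* The first bound gives [0 < N * e < 1], so [e] is not aligned; the second keeps the point
   [e + e * eta] within distance [d] of the origin. *)
pose e := Num.min (2 * N)^-1 (d / (2 * s)).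
have e0 : 0 < e by rewrite lt_min invr_gt0 divr_gt0 ?mulr_gt0.
have eN : N * e <= 2^-1.
  by rewrite -ler_pdivlMl // -invfM [N * 2]mulrC ge_min lexx.
have he : ~ aligned e.
  move=> [a ha]; have h1 : 0 < a%:~R :> R by rewrite -ha mulr_gt0.
  have h2 : a%:~R < 1 :> R by rewrite -ha; apply: le_lt_trans eN _; rewrite invf_lt1 ?ltr1n.
  by move: h1 h2; rewrite ltr0z ltrz1; lia.
exists e => //; apply: hd.
  apply/eqP => /eta_pt_eq0[h _]; by rewrite h ltxx in e0.
rewrite sub0r nmN; apply: le_lt_trans (nmD _ _) _; rewrite nmM !nm_real gtr0_norm //.
rewrite -{1}[e]mulr1 -mulrDr -/s -ltr_pdivlMr //.
apply: le_lt_trans (_ : d / (2 * s) < _); first by rewrite ge_min lexx orbT.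
by rewrite ltr_pM2l // ltf_pV2 ?posrE ?mulr_gt0 // ltr_pMl // ltr1n.
Qed.

Lemma rank_tau (tau : C) : ~ lat2 tau -> \rank (Rm tau tau) = 'C(n, 2).
Proof.
have [x [y ->]] := eta_pt_coord tau; move=> htau.
have [e he <-] := rank_corner.
(* Two segments lead to the corner point; the first runs along a line through [tau] whose fixed
   coordinate is not aligned, the second along a coordinate equal to [e]. *)
case: (pselect (aligned y)) => hy; last by rewrite (rank_horizontal x e hy) (rank_vertical y e he).
have hx : ~ aligned x.
  by case: hy => b hb [a ha]; apply: htau; exact: lat2_intro ha hb.
by rewrite (rank_vertical y e hx) (rank_horizontal x e he).
Qed.

End Connection.

Theorem theorem5p7 (R : realType) (n k : nat) (eta : R[i]) :
  (1 <= k)%N -> (k < n)%N -> coprime n k -> 0 < complex.Im eta ->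
  (forall tau : R[i], ~ in_lat (2 * n) eta tau ->
     [/\ (* (1) *)
         (forall z : R[i],
            Rmx n k eta tau z \in unitmx <->
            ~ (in_lat n eta (z - tau) \/ in_lat n eta (z + tau))),
         (* (2) *)
         (forall zeta : R[i], in_lat n eta zeta ->
            (Rmx n k eta tau (tau + zeta)%R
               == kermx (Rmx n k eta tau (- tau - zeta)%R))%MS /\
            (Rmx n k eta tau (- tau - zeta)%R
               == kermx (Rmx n k eta tau (tau + zeta)%R))%MS) &
         (* (3) *)
         (forall p : R[i],
            zero_mult (fun z => \det (Rmx n k eta tau z)) p
                      (nullity (Rmx n k eta tau p)) /\
            nullity (Rmx n k eta tau p) =
              (if `[< in_lat n eta (p - tau) >] then 'C(n.+1, 2)
               else if `[< in_lat n eta (p + tau) >] then 'C(n, 2)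
               else 0%N))]) /\
  (forall tau : R[i], in_lat (2 * n) eta tau -> ~ in_lat n eta tau ->
     nullity (Rmx n k eta tau tau) = nullity (Rmx n k eta tau (- tau)) /\
     ('C(n.+1, 2) <= nullity (Rmx n k eta tau tau))%N).
Proof.
move=> k1 kn nk eta_gt0; have n1 : (1 < n)%N by exact: leq_ltn_trans kn.
have n0 : (0 < n)%N by exact: ltnW.
have nC : (n%:R : R[i]) != 0 by rewrite pnatr_eq0 -lt0n.
have bin2D := binS_add_bin n.
have bin_pos : (0 < 'C(n, 2))%N by rewrite bin_gt0.
have binS_pos : (0 < 'C(n.+1, 2))%N by rewrite bin_gt0 ltnW.
split=> tau.
  move=> htau; have htau1 : ~ in_lat n eta tau by move=> /(lat_lat2 n1).
  have rp z : in_lat n eta (z - tau) -> \rank (Rmx n k eta tau z) = 'C(n, 2).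
    by move=> hz; rewrite -(subrK tau z) addrC rank_Rmx_lat // rank_tau.
  have rm z : in_lat n eta (z + tau) -> \rank (Rmx n k eta tau z) = 'C(n.+1, 2).
    move=> hz; rewrite -(addrK tau z) addrC rank_Rmx_lat //.
    have := rank_sum eta_gt0 n1 nk htau; rewrite rank_tau //.
    move: (\rank _) => r; lia.
  have unitE z : Rmx n k eta tau z \in unitmx <->
      ~ (in_lat n eta (z - tau) \/ in_lat n eta (z + tau)).
    split=> [hu hz|hz]; last by apply: Rmx_unit => // h; apply: hz; [left|right].
    have := mxrank_unit hu; by case: hz => [/rp|/rm] -> e; move: bin2D; rewrite -e; lia.
  (* Matrices act on row vectors, so [R(p) R(-p) = 0] puts the image of [R(p)] into the kernel of
     [R(-p)]; the sum of the ranks gives equality. *)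
  have prod0 p : in_lat n eta (p - tau) \/ in_lat n eta (p + tau) ->
      (Rmx n k eta tau p == kermx (Rmx n k eta tau (- p)%R))%MS.
    move=> hp; have [h0 hs _] := multiplicity_sum eta_gt0 n1 nk htau hp.
    have hsub : (Rmx n k eta tau p <= kermx (Rmx n k eta tau (- p)%R))%MS by apply/sub_kermxP.
    rewrite -(mxrank_leqif_eq hsub) mxrank_ker; apply/eqP.
    by move: hs; move: (\rank _) (\rank _) => a b; lia.
  split=> // [zeta hzeta|p].
    split.
      have -> : - tau - zeta = - (tau + zeta) by rewrite opprD.
      by apply: prod0; left; rewrite addrAC subrr add0r.
    have := prod0 (- tau - zeta); rewrite opprD !opprK; apply.
    by right; rewrite addrAC addNr add0r; apply/latN.
  have [hp|hp] := pselect (in_lat n eta (p - tau) \/ in_lat n eta (p + tau)).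
    have [_ _ hz] := multiplicity_sum eta_gt0 n1 nk htau hp; split=> //.
    rewrite /nullity; case: asboolP => [/rp ->|h1]; first by lia.
    case: asboolP => [/rm ->|h2]; first by lia.
    by case: hp.
  have hu : Rmx n k eta tau p \in unitmx by apply/unitE.
  have [hz h0] := zero_mult_unit eta_gt0 n1 hu; split=> //; rewrite h0.
  case: asboolP => [h|_]; first by case: hp; left.
  by case: asboolP => // h; case: hp; right.
move=> htau2 htau.
(* Here [tau] and [- tau] differ by a period, so their ranks agree instead of being
   complementary. *)
have h2 : in_lat n eta (- tau - tau).
  have [a [b ->]] := htau2; exists (- a), (- b).
  by rewrite natrM !rmorphN /=; field.
have hr : \rank (Rmx n k eta tau (- tau)%R) = \rank (Rmx n k eta tau tau).
  by rewrite -(subrK tau (- tau)) addrC rank_Rmx_lat.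
split; first by rewrite /nullity hr.
have tid := tends_dnbhs_id tau.
have h1 : (tau^') [set t | (\rank (Rmx n k eta tau tau) <= \rank (Rmx n k eta t t))%N].
  by apply: rank_lsc => q l; exact: Rmx_tends.
have n2 : (1 < 2 * n)%N by lia.
(* At a generic [t] near [tau] the rank is known, and by semicontinuity it bounds the rank at [tau]
   from above. *)
have [t [/= ht /(rank_tau eta_gt0 n1 nk) hrt]] := filter_ex (filterI h1 (lat_isolated eta_gt0 n2 tau)).
by rewrite /nullity; rewrite hrt in ht; lia.
Qed.
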